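(* Let $\Omega_1,\Omega_2\subset\mathbb{R}^2$ be two open disks with non-empty intersection, neither contained in the other, and let $\mathcal{H}$, $A$, $\mathcal{H}_L$, $\mathbb{P}_L$ be as in the context. For every $\mathbf{g}\in\mathcal{H}$ there exists a unique $\mathbf{u}\in\mathcal{H}$ with $A\mathbf{u}=\mathbf{g}$ (the continuous ddCOSMO equation). Moreover, for every $L\in\mathbb{N}$ (and every $\mathbf g\in\mathcal H$) there exists a unique $\mathbf{u}_L\in\mathcal{H}_L$ with $\mathbb{P}_LA\mathbb{P}_L\mathbf{u}_L=\mathbb{P}_L\mathbf{g}$ (the discrete ddCOSMO equation).
   Context: Geometry: $\Omega_i=B_{r_i}(\mathbf{x}_i)\subset\mathbb{R}^2$, $i=1,2$, are open disks with $\Omega_1\cap\Omega_2\ne\emptyset$ and neither contained in the other; $\Omega=\Omega_1\cup\Omega_2$; $\Gamma_i^{\rm ext}=\partial\Omega_i\cap\partial\Omega$, $\Gamma_i^{\rm int}=\partial\Omega_i\setminus\Gamma_i^{\rm ext}$. $L^2(\partial\Omega_i)$ is the complex $L^2$ space for the one-dimensional Hausdorff measure $\mathscr{H}^1$, and $\mathcal{H}=L^2(\partial\Omega_1)\times L^2(\partial\Omega_2)$ is the Hilbert direct sum. For $i\ne j$, $\gamma_j:L^2(\partial\Omega_i)\to L^2(\partial\Omega_j)$ sends $g$ to the function equal to $\mathrm{P}_i[g]|_{\Gamma_j^{\rm int}}$ on $\Gamma_j^{\rm int}$ and $0$ on $\Gamma_j^{\rm ext}$, where $\mathrm{P}_i[g](\mathbf{x})=\frac1{2\pi}\int_{\partial\Omega_i}\frac{r_i^2-|\mathbf{x}-\mathbf{x}_i|^2}{r_i|\mathbf{x}-\mathbf{y}|^2}g(\mathbf{y})\,d\mathscr{H}^1(\mathbf{y})$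 for $\mathbf{x}\in\Omega_i$ is the Poisson integral. This is a bounded operator. The ddCOSMO operator is $A:\mathcal{H}\to\mathcal{H}$, $A(u_1,u_2)=(u_1-\gamma_1u_2,\;u_2-\gamma_2u_1)$. For $L\in\mathbb{N}$, identifying $\mathbb{R}^2\simeq\mathbb{C}$, $\mathcal{H}_L(\partial\Omega_j)\subset L^2(\partial\Omega_j)$ is the span of the restrictions to $\partial\Omega_j$ of $(\mathbf{x}-\mathbf{x}_j)^\ell$ and $\overline{(\mathbf{x}-\mathbf{x}_j)}^{\,\ell}$, $0\le\ell\le L$; $\mathcal{H}_L=\mathcal{H}_L(\partial\Omega_1)\times\mathcal{H}_L(\partial\Omega_2)$, and $\mathbb{P}_L:\mathcal{H}\to\mathcal{H}_L$ is the orthogonal projection. *)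

(* Defs.v *)
From HB Require Import structures.
From mathcomp Require Import all_boot all_order all_algebra.
From mathcomp Require Import complex.
From mathcomp Require Import all_classical all_reals all_analysis.

Set Implicit Arguments.
Unset Strict Implicit.
Unset Printing Implicit Defensive.

Import Order.TTheory GRing.Theory Num.Theory.
Import numFieldNormedType.Exports.

Local Open Scope classical_set_scope.
Local Open Scope ring_scope.
Local Open Scope complex_scope.

Section Plane.
Context {R : realType}.
Local Notation plane := (R * R)%type.
Implicit Types (x y : plane) (A : set plane).

(* The norm that the library puts on a product is the sup norm. *)
Definition edist x y : R :=
  Num.sqrt ((x.1 - y.1) ^+ 2 + (x.2 - y.2) ^+ 2).

Definition toC x : R[i] := x.1 +i* x.2.

Definition bdry A : set plane := closure A `\` interior A.

(* 0 is added so that the diameter of the empty set is 0 and not -oo. *)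
Definition diam A : \bar R :=
  ereal_sup (0%E |` [set (edist x y)%:E | x in A & y in A]).

Definition hausdorff1_pre (d : R) A : \bar R :=
  ereal_inf [set (\sum_(0 <= k <oo) diam (U k))%E | U in
    [set U : nat -> set plane |
       A `<=` \bigcup_k U k /\ forall k, (diam (U k) <= d%:E)%E]].

(* One-dimensional Hausdorff outer measure. It is countably additive on the
   Borel sets of the plane, the only sets on which the integral evaluates it;
   the library's [integral] and [ae] accept any set function. *)
Definition hausdorff1 A : \bar R :=
  ereal_sup [set hausdorff1_pre d A | d in [set d : R | 0 < d]].

Definition cint A (f : plane -> R[i]) : R[i] :=
  fine (\int[hausdorff1]_(x in A) (complex.Re (f x))%:E)%E +i*
  fine (\int[hausdorff1]_(x in A) (complex.Im (f x))%:E)%E.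

(* Representatives of the classes in L^2(A): functions on the plane of which
   only the values on A matter, to be compared almost everywhere on A. *)
Definition L2 A : set (plane -> R[i]) :=
  [set f : plane -> R[i] |
    [/\ measurable_fun A (fun x => complex.Re (f x) : R),
        measurable_fun A (fun x => complex.Im (f x) : R) &
    (\int[hausdorff1]_(x in A) (Normc.normc (f x) ^+ 2)%:E < +oo)%E]].

Definition L2eq A (f g : plane -> R[i]) : Prop :=
  f = g %[ae hausdorff1 in A].

Definition L2ip A (f g : plane -> R[i]) : R[i] :=
  cint A (fun x => f x * conjc (g x)).

End Plane.

Record disk (R : realType) := Disk {
  center : R * R;
  radius : R;
  radius_gt0 : 0 < radius }.

Section Disks.
Context {R : realType}.
Local Notation plane := (R * R)%type.
Local Notation fct := (plane -> R[i]).
Implicit Types (D : disk R).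

Definition open_disk D : set plane :=
  [set x | edist x (center D) < radius D].

Definition circle D : set plane := bdry (open_disk D).

Definition ext_arc D D' : set plane :=
  circle D `&` bdry (open_disk D `|` open_disk D').

Definition int_arc D D' : set plane := circle D `\` ext_arc D D'.

Definition poisson_kernel D (x y : plane) : R :=
  (radius D ^+ 2 - edist x (center D) ^+ 2) / (radius D * edist x y ^+ 2).

Definition poisson D (g : fct) : fct := fun x =>
  ((2 * pi)^-1)%:C * cint (circle D) (fun y => (poisson_kernel D x y)%:C * g y).

(* [transfer Di Dj] maps functions on the circle of Di to functions on the
   circle of Dj. *)
Definition transfer (Di Dj : disk R) (g : fct) : fct := fun x =>
  if x \in int_arc Dj Di then poisson Di g x else 0.

Definition harmonics D (L : nat) : set fct :=
  [set f | L2 (circle D) f /\ exists a b : nat -> R[i],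
     L2eq (circle D) f (fun x => \sum_(0 <= l < L.+1)
       (a l * toC (x - center D) ^+ l +
        b l * conjc (toC (x - center D)) ^+ l))].

Section Pair.
Variables D1 D2 : disk R.
Implicit Types u v : fct * fct.

Definition HH : set (fct * fct) :=
  [set u | L2 (circle D1) u.1 /\ L2 (circle D2) u.2].

Definition HHeq u v : Prop :=
  L2eq (circle D1) u.1 v.1 /\ L2eq (circle D2) u.2 v.2.

Definition HHip u v : R[i] :=
  L2ip (circle D1) u.1 v.1 + L2ip (circle D2) u.2 v.2.

Definition HHL (L : nat) : set (fct * fct) :=
  [set u | harmonics D1 L u.1 /\ harmonics D2 L u.2].

Definition ddcosmo u : fct * fct :=
  (u.1 - transfer D2 D1 u.2, u.2 - transfer D1 D2 u.1).

(* A representative of the orthogonal projection of u on HHL L, i.e. of the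
   class p in HHL L such that u - p is orthogonal to HHL L. The default value
   of [xget] is irrelevant, since such a p exists for every u in HH. *)
Definition projL (L : nat) u : fct * fct :=
  xget 0 [set p | HHL L p /\ forall q, HHL L q -> HHip (u - p) q = 0].

End Pair.
End Disks.

(* Main.v *)
From HB Require Import structures.
From mathcomp Require Import all_boot all_order all_algebra.
From mathcomp Require Import complex.
From mathcomp Require Import all_classical all_reals all_analysis.
From mathcomp Require Import measurable_realfun.
From mathcomp Require Import ring lra.
Require Import Defs.

Set Implicit Arguments.
Unset Strict Implicit.
Unset Printing Implicit Defensive.

Import Order.TTheory GRing.Theory Num.Theory.
Import numFieldNormedType.Exports.

Local Open Scope classical_set_scope.
Local Open Scope ring_scope.

Section Circles.
Context {R : realType}.
Local Notation plane := (R * R)%type.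
Implicit Types (x y c e : plane) (r t s : R) (D : disk R).

Lemma edist_ge0 x y : 0 <= edist x y.
Proof. exact: sqrtr_ge0. Qed.

Lemma edist_sqr x y : edist x y ^+ 2 = (x.1 - y.1) ^+ 2 + (x.2 - y.2) ^+ 2.
Proof. by rewrite /edist sqr_sqrtr// addr_ge0// sqr_ge0. Qed.

Lemma edistC x y : edist x y = edist y x.
Proof.
rewrite /edist; congr Num.sqrt.
by rewrite -(sqrrN (x.1 - _)) -(sqrrN (x.2 - _)) !opprB.
Qed.

Lemma edist_le x y t : 0 <= t ->
  (edist x y <= t) = ((x.1 - y.1) ^+ 2 + (x.2 - y.2) ^+ 2 <= t ^+ 2).
Proof. by move=> t0; rewrite -edist_sqr ler_pXn2r ?nnegrE ?edist_ge0. Qed.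

Lemma edist_lt x y t : 0 <= t ->
  (edist x y < t) = ((x.1 - y.1) ^+ 2 + (x.2 - y.2) ^+ 2 < t ^+ 2).
Proof. by move=> t0; rewrite -edist_sqr ltr_pXn2r ?nnegrE ?edist_ge0. Qed.

Lemma edist_triangle x y z : edist x z <= edist x y + edist y z.
Proof.
have d0 := edist_ge0 x y; have d1 := edist_ge0 y z.
rewrite edist_le ?addr_ge0// (sqrrD (edist x y)) !edist_sqr.
set a := x.1 - y.1; set b := x.2 - y.2; set a' := y.1 - z.1; set b' := y.2 - z.2.
have -> : x.1 - z.1 = a + a' by rewrite /a/a'; ring.
have -> : x.2 - z.2 = b + b' by rewrite /b/b'; ring.
suff : a * a' + b * b' <= edist x y * edist y z by move=> h; lra.
rewrite (le_trans (ler_norm _))// -(ler_pXn2r (_ : 0 < 2)%N) ?nnegrE ?mulr_ge0//.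
rewrite real_normK ?num_real// exprMn !edist_sqr -/a -/b -/a' -/b' -subr_ge0.
have -> : (a ^+ 2 + b ^+ 2) * (a' ^+ 2 + b' ^+ 2) - (a * a' + b * b') ^+ 2
  = (a * b' - b * a') ^+ 2 by ring.
exact: sqr_ge0.
Qed.

Lemma continuous_edist c : continuous (fun x => edist x c).
Proof.
move=> x; rewrite /edist.
apply: continuous_comp; last exact: sqrt_continuous.
have sq (f : plane -> R) : {for x, continuous f} -> {for x, continuous (fun y => f y ^+ 2)}.
  by move=> cf; exact: (@continuous_comp _ _ _ f (fun t => t ^+ 2) x cf (@exprn_continuous R 2 (f x))).
apply: continuousD; apply: sq; apply: continuousB.
- exact: cvg_fst.
- exact: cst_continuous.
- exact: cvg_snd.
- exact: cst_continuous.
Qed.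

Lemma open_open_disk D : open (open_disk D).
Proof.
rewrite /open_disk.
apply: (@open_comp _ _ (fun x => edist x (center D)) [set t | t < radius D]).
  by move=> x _; exact: continuous_edist.
exact: open_lt.
Qed.

Definition closed_disk D : set plane := [set x | edist x (center D) <= radius D].

Lemma closed_closed_disk D : closed (closed_disk D).
Proof.
apply: (@closed_comp _ _ (fun x => edist x (center D)) [set t | t <= radius D]).
  by move=> x _; exact: continuous_edist.
exact: closed_le.
Qed.

Lemma closure_open_disk D : closure (open_disk D) = closed_disk D.
Proof.
apply/seteqP; split.
  rewrite closureE; apply: smallest_sub; first exact: closed_closed_disk.
  by move=> x /ltW.
move=> x xD B /nbhs_ballP[eps /= eps0 epsB].
have r0 := radius_gt0 D.
(* moving x towards the centre by a small factor brings it inside *)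
set c := center D; set K : R := (1 + `|x.1 - c.1| + `|x.2 - c.2|).
have K1 : 1 <= K by rewrite /K -addrA lerDl addr_ge0.
set l : R := Num.min (1/2) (eps / (2 * K)).
have K0 : 0 < K by lra.
have l0 : 0 < l by rewrite /l lt_min; apply/andP; split; [lra|rewrite divr_gt0// mulr_gt0//].
have l1 : l <= 1/2 by rewrite /l ge_min lexx.
have l2 : l * K < eps.
  apply: (@le_lt_trans _ _ (eps / 2)); last lra.
  rewrite -ler_pdivlMr// (le_trans (_ : l <= eps / (2 * K)))//.
    by rewrite /l ge_min lexx orbT.
  by rewrite invfM mulrA.
have lB u : `|u| <= K -> `|l * u| < eps.
  move=> uK; apply: le_lt_trans l2; rewrite normrM (gtr0_norm l0) ler_pM2l//.
exists (x.1 - l * (x.1 - c.1), x.2 - l * (x.2 - c.2)); split.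
  rewrite /open_disk /= edist_lt ?(ltW r0)//=.
  have := xD; rewrite /closed_disk/= edist_le ?(ltW r0)// -/c => h.
  have -> : (x.1 - l * (x.1 - c.1) - c.1) ^+ 2 + (x.2 - l * (x.2 - c.2) - c.2) ^+ 2
    = (1 - l) ^+ 2 * ((x.1 - c.1) ^+ 2 + (x.2 - c.2) ^+ 2) by ring.
  apply: (@le_lt_trans _ _ ((1 - l) ^+ 2 * radius D ^+ 2)).
    by rewrite ler_wpM2l// sqr_ge0.
  rewrite -{2}[radius D ^+ 2]mul1r ltr_pM2r ?exprn_gt0//.
  by rewrite expr_lt1//; lra.
apply: epsB; split => /=; rewrite /ball/= opprB addrC subrK; apply: lB.
  by rewrite /K -addrA addrCA lerDl addr_ge0.
by rewrite /K lerDr addr_ge0.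
Qed.

Lemma interior_open_disk D : interior (open_disk D) = open_disk D.
Proof. exact/interior_id/open_open_disk. Qed.

Lemma circleE D : circle D = [set x | edist x (center D) = radius D].
Proof.
rewrite /circle /bdry closure_open_disk interior_open_disk.
apply/seteqP; split => x; rewrite /closed_disk /open_disk /=.
  by case=> h /negP; rewrite -leNgt => h'; apply/eqP; rewrite eq_le h.
by move=> ->; rewrite ltxx.
Qed.

Lemma int_arcE D D' : int_arc D D' = circle D `&` open_disk D'.
Proof.
rewrite /int_arc /ext_arc; apply/seteqP; split => x /=.
  move=> [xD nx]; split => //.
  apply: contrapT => xD'; apply: nx; split => //; split.
    apply: (closureS (@subsetUl _ (open_disk D) (open_disk D'))).
    by rewrite closure_open_disk /closed_disk /=; move: xD; rewrite circleE /= => ->.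
  move=> /interior_subset [|//].
  by rewrite /open_disk/=; move: xD; rewrite circleE /= => ->; rewrite ltxx.
move=> [xD xD']; split => // -[_ [_]]; apply.
apply: (interiorS (@subsetUr _ (open_disk D) (open_disk D'))).
by rewrite interior_open_disk.
Qed.

End Circles.

Section SineBounds.
Context {R : realType}.
Implicit Types x : R.

Lemma sin_le_id x : 0 <= x -> sin x <= x.
Proof.
move=> x0.
have [c _] := @MVT_segment R sin cos 0 x x0 (fun y _ => is_derive_sin y)
  (continuous_subspaceT (@continuous_sin R)).
rewrite sin0 !subr0 => ->.
by rewrite -{2}[x]mul1r ler_wpM2r// cos_le1.
Qed.

Lemma normr_sin_le x : `|sin x| <= `|x|.
Proof.
wlog x0 : x / 0 <= x.
  move=> h; have [/h//|/ltW x0] := leP 0 x.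
  by rewrite -normrN -sinN -(normrN x); apply: h; rewrite oppr_ge0.
have [x1|x1] := leP x 1.
  rewrite (ger0_norm x0) ger0_norm ?sin_le_id// sin_ge0_pi// x0/=.
  by rewrite (le_trans x1)// (le_trans _ (pi_ge2 R))// ler1n.
by rewrite (ger0_norm x0) (le_trans (sin_max x)) ?ltW.
Qed.

Lemma sin_ge_near0 (k : R) : 0 < k ->
  exists2 d : R, 0 < d <= 1 & forall x, 0 <= x <= d -> (1 - k) * x <= sin x.
Proof.
move=> k0.
have /cvgrPdist_lt /(_ _ k0) : cos x @[x --> (0 : R)] --> (1 : R).
  by rewrite -[X in _ --> X](@cos0 R); exact: continuous_cos.
move=> [/= eps eps0 epsP].
pose d : R := Num.min 1 (eps / 2).
have d0 : 0 < d by rewrite /d lt_min ltr01 divr_gt0.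
exists d; first by rewrite d0 /d ge_min lexx.
move=> x /andP[x0 xd].
have [c] := @MVT_segment R sin cos 0 x x0 (fun y _ => is_derive_sin y)
  (continuous_subspaceT (@continuous_sin R)).
rewrite in_itv/= => /andP[c0 cx].
rewrite sin0 !subr0 => ->; rewrite ler_wpM2r//.
have : `|1 - cos c| < k.
  apply: epsP; rewrite /= sub0r normrN ger0_norm//.
  rewrite (le_lt_trans cx)// (le_lt_trans xd)//.
  by rewrite /d gt_min; apply/orP; right; lra.
move/(le_lt_trans (ler_norm _)); lra.
Qed.

Lemma sin_ge_away (k eps : R) : 0 < k -> 0 < eps < pi ->
  exists2 d : R, 0 < d &
    forall x, 0 <= x <= pi - eps -> sin x <= d -> (1 - k) * x <= sin x.
Proof.
move=> k0 /andP[e0 epi].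
have [x0 /andP[x00 x01] x0P] := sin_ge_near0 k0.
have pi2 := pi_ge2 R.
pose eta : R := Num.min eps (pi / 2).
have eta0 : 0 < eta by rewrite /eta lt_min e0/= divr_gt0 ?pi_gt0.
have eta1 : eta <= pi / 2 by rewrite /eta ge_min lexx orbT.
have eta2 : eta <= eps by rewrite /eta ge_min lexx.
pose y : R := Num.min x0 eta.
have y0 : 0 < y by rewrite /y lt_min x00.
have yx0 : y <= x0 by rewrite /y ge_min lexx.
have yeta : y <= eta by rewrite /y ge_min lexx orbT.
have sy : 0 < sin y.
  by apply: sin_gt0_pi; rewrite y0/=; lra.
exists (sin y / 2); first by rewrite divr_gt0.
move=> x /andP[xge0 xle] sx.
have [xx0|x0x] := leP x x0; first by apply: x0P; rewrite xge0.
suff : sin y <= sin x by lra.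
have mono a b : - (pi / 2) <= a -> a <= b -> b <= pi / 2 -> sin a <= sin b.
  move=> h1 + h3; rewrite le_eqVlt => /orP[/eqP->//|ab].
  by apply/ltW; rewrite ltr_sin// in_itv/=; apply/andP; split; lra.
have [xp|px] := leP x (pi / 2); first by apply: mono; lra.
have -> : sin x = sin (pi - x) by rewrite sinB sinpi cospi; lra.
by apply: mono; lra.
Qed.

End SineBounds.

Section CircleParam.
Context {R : realType}.
Local Notation plane := (R * R)%type.
Variables (D : disk R) (e : plane).
Hypothesis e1 : e.1 ^+ 2 + e.2 ^+ 2 = 1.
Local Notation r := (radius D).
Local Notation c := (center D).

Definition arcpt (s : R) : plane :=
  (c.1 + r * (e.1 * cos (s / r) - e.2 * sin (s / r)),
   c.2 + r * (e.2 * cos (s / r) + e.1 * sin (s / r))).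

Definition arcdom : set R := `[- (pi * r), pi * r[%classic.

Let r0 : 0 < r := radius_gt0 D.

Let cvg_divr (s : R) : (fun u : R => u / r) u @[u --> s] --> s / r.
Proof. by apply: cvgM; [exact: cvg_id|exact: cvg_cst]. Qed.

Lemma continuous_arcpt1 : continuous (fun s => (arcpt s).1).
Proof.
move=> s; apply: cvgD; first exact: cvg_cst.
apply: cvgM; first exact: cvg_cst.
apply: cvgB; (apply: cvgM; first exact: cvg_cst).
  exact: (cvg_comp _ _ (@cvg_divr s) (@continuous_cos R (s / r))).
exact: (cvg_comp _ _ (@cvg_divr s) (@continuous_sin R (s / r))).
Qed.

Lemma continuous_arcpt2 : continuous (fun s => (arcpt s).2).
Proof.
move=> s; apply: cvgD; first exact: cvg_cst.
apply: cvgM; first exact: cvg_cst.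
apply: cvgD; (apply: cvgM; first exact: cvg_cst).
  exact: (cvg_comp _ _ (@cvg_divr s) (@continuous_cos R (s / r))).
exact: (cvg_comp _ _ (@cvg_divr s) (@continuous_sin R (s / r))).
Qed.

Lemma measurable_arcpt : measurable_fun [set: R] arcpt.
Proof.
by apply: measurable_fun_pair; apply: continuous_measurable_fun;
  [exact: continuous_arcpt1 | exact: continuous_arcpt2].
Qed.

Lemma arcpt_circle s : circle D (arcpt s).
Proof.
rewrite circleE /=; apply/eqP.
rewrite -(@eqrXn2 _ 2%N) ?edist_ge0 ?ltW// edist_sqr /=; apply/eqP.
have h := cos2Dsin2 (s / r); set C := cos _ in h *; set S := sin _ in h *.
transitivity (r ^+ 2 * ((e.1 ^+ 2 + e.2 ^+ 2) * (C ^+ 2 + S ^+ 2))); first by ring.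
by rewrite h e1 !mulr1.
Qed.

Lemma arcpt_surj x : circle D x -> exists2 s, arcdom s & arcpt s = x.
Proof.
rewrite circleE /= => xc.
have xc2 : (x.1 - c.1) ^+ 2 + (x.2 - c.2) ^+ 2 = r ^+ 2 by rewrite -edist_sqr xc.
pose A := (e.1 * (x.1 - c.1) + e.2 * (x.2 - c.2)) / r.
pose B := (e.1 * (x.2 - c.2) - e.2 * (x.1 - c.1)) / r.
have rn0 : r != 0 by rewrite gt_eqF.
have AB : A ^+ 2 + B ^+ 2 = 1.
  have -> : A ^+ 2 + B ^+ 2 = (e.1 ^+ 2 + e.2 ^+ 2) *
    ((x.1 - c.1) ^+ 2 + (x.2 - c.2) ^+ 2) / r ^+ 2 by rewrite /A /B; field.
  by rewrite e1 xc2 mul1r divff// expf_neq0.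
have A1 : -1 <= A <= 1 by apply/andP; split; nra.
have E1 : e.1 * A - e.2 * B = (x.1 - c.1) / r.
  transitivity ((e.1 ^+ 2 + e.2 ^+ 2) * (x.1 - c.1) / r); first by rewrite /A /B; field.
  by rewrite e1 mul1r.
have E2 : e.2 * A + e.1 * B = (x.2 - c.2) / r.
  transitivity ((e.1 ^+ 2 + e.2 ^+ 2) * (x.2 - c.2) / r); first by rewrite /A /B; field.
  by rewrite e1 mul1r.
have [t tI [ct st]] : exists2 t, -pi <= t < pi & cos t = A /\ sin t = B.
  have ac : cos (acos A) = A by rewrite acosK// in_itv.
  have as_ : sin (acos A) = `|B|.
    by rewrite sin_acos// -AB addrC addKr sqrtr_sqr.
  have pi0 := pi_gt0 R.
  have [B0|B0] := leP B 0.
    exists (- acos A); last by rewrite cosN sinN ac as_ ler0_norm ?opprK.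
    rewrite lerN2 acos_lepi//=.
    by rewrite (le_lt_trans _ pi0)// oppr_le0 acos_ge0.
  exists (acos A); last by rewrite ac as_ gtr0_norm.
  rewrite (le_trans _ (acos_ge0 A1)) ?oppr_le0 ?ltW//=.
  rewrite acos_ltpi//; case/andP: A1 => A1 ->; rewrite andbT lt_neqAle A1 andbT.
  by apply/eqP => A1'; move: AB; rewrite -A1'; nra.
exists (t * r).
  by rewrite /arcdom/= in_itv/= -mulNr ler_pM2r// ltr_pM2r.
rewrite /arcpt mulfK// ct st E1 E2; case: (x) => a b /=.
by congr pair; field.
Qed.

Lemma edist_arcpt s t : edist (arcpt s) (arcpt t) = 2 * r * `|sin ((s - t) / (2 * r))|.
Proof.
apply/eqP; rewrite -(@eqrXn2 _ 2%N) ?edist_ge0 ?(mulr_ge0 _ (normr_ge0 _)) ?mulr_ge0 ?ltW//.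
rewrite edist_sqr exprMn real_normK ?num_real// /=; apply/eqP.
set u := (s - t) / (2 * r); set v := (s + t) / (2 * r).
have rn0 : r != 0 by rewrite gt_eqF.
have -> : s / r = v + u by rewrite /u /v; field.
have -> : t / r = v - u by rewrite /u /v; field.
rewrite !cosD !sinD !cosN !sinN.
have hu := cos2Dsin2 u; have hv := cos2Dsin2 v.
move: (cos u) (sin u) (cos v) (sin v) hu hv => cu su cv sv hu hv.
transitivity (4 * r ^+ 2 * su ^+ 2 * ((e.1 ^+ 2 + e.2 ^+ 2) * (cv ^+ 2 + sv ^+ 2))).
  by ring.
by rewrite e1 hv; ring.
Qed.

Lemma edist_arcpt_le s t : edist (arcpt s) (arcpt t) <= `|s - t|.
Proof.
rewrite edist_arcpt.
have := normr_sin_le ((s - t) / (2 * r)).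
have r20 : 0 < 2 * r by rewrite mulr_gt0.
rewrite (normrM (s - t)) (gtr0_norm (_ : 0 < (2 * r)^-1)) ?invr_gt0//.
by rewrite ler_pdivlMr// mulrC.
Qed.

End CircleParam.

Section DiamBounds.
Context {R : realType}.
Local Notation plane := (R * R)%type.
Implicit Types A : set plane.

Lemma diam_ge0 A : (0%:E <= diam A)%E.
Proof. by apply: ereal_sup_ubound; left. Qed.

Lemma le_diam A x y : A x -> A y -> ((edist x y)%:E <= diam A)%E.
Proof. by move=> Ax Ay; apply: ereal_sup_ubound; right; exists x => //; exists y. Qed.

Lemma diam_le A (d : \bar R) : (0 <= d)%E ->
  (forall x y, A x -> A y -> ((edist x y)%:E <= d)%E) -> (diam A <= d)%E.
Proof.
move=> d0 h; apply: ge_ereal_sup => _ [->//|[x Ax [y Ay <-]]].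
exact: h.
Qed.

End DiamBounds.

Section HausdorffArc.
Context {R : realType}.
Local Notation plane := (R * R)%type.
Local Notation mu := (@lebesgue_measure R).
Variables (D : disk R) (e : plane).
Hypothesis e1 : e.1 ^+ 2 + e.2 ^+ 2 = 1.
Local Notation r := (radius D).
Local Notation g := (arcpt D e).
Let r0 : 0 < r := radius_gt0 D.

(* The parametrization does not increase lengths. *)
Lemma diam_arcpt_image (A : set R) : is_interval A -> measurable A ->
  (diam (g @` A) <= mu A)%E.
Proof.
move=> iA mA; apply: diam_le; first exact: measure_ge0.
move=> _ _ [s As <-] [t At <-].
wlog st : s t As At / s <= t.
  move=> h; have [|/ltW] := leP s t; first exact: h.
  by rewrite edistC; exact: h.
apply: (@le_trans _ _ (mu `[s, t]%classic)).
  rewrite lebesgue_measure_itv/= lte_fin.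
  have := edist_arcpt_le D e1 s t; rewrite distrC ger0_norm ?subr_ge0// => h.
  case: ltP => ts; first by rewrite lee_fin.
  by rewrite lee_fin (le_trans h)// subr_le0.
apply: le_measure; rewrite ?inE//.
by move=> u /=; rewrite in_itv/= => /andP[su ut]; apply: (iA s t) => //; rewrite su.
Qed.

Let piece (N : nat) (j : nat) : set R :=
  `[- (pi * r) + j%:R * (2 * pi * r / N%:R),
    - (pi * r) + j.+1%:R * (2 * pi * r / N%:R)[%classic.

Let piecesU (F : set R) N n : (0 < N)%N -> measurable F ->
  (\sum_(0 <= j < n) mu (F `&` piece N j) =
   mu (F `&` `[(- (pi * r))%R, (- (pi * r) + n%:R * (2 * pi * r / N%:R))%R[%classic))%E.
Proof.
move=> N0 mF; have d0 : 0 <= 2 * pi * r / N%:R.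
  by rewrite divr_ge0// mulr_ge0 ?ltW// mulr_gt0// pi_gt0.
elim: n => [|n IH].
  by rewrite big_nil mul0r addr0 set_itvco0 setI0 measure0.
rewrite big_nat_recr//= IH -measureU//; last 3 first.
- by apply: measurableI => //; exact: measurable_itv.
- by apply: measurableI => //; exact: measurable_itv.
- rewrite -setIIr (_ : _ `&` piece N n = set0) ?setI0//.
  apply/seteqP; split => // x [] /=; rewrite !in_itv/= => /andP[_ h] /andP[h' _].
  by move: (lt_le_trans h h'); rewrite ltxx.
congr (mu _); rewrite -setIUr; congr (_ `&` _).
rewrite /piece; apply/seteqP; split => x /=; rewrite !in_itv/=.
  have e' : n%:R * (2 * pi * r / N%:R) <= n.+1%:R * (2 * pi * r / N%:R).
    by rewrite ler_wpM2r// ler_nat.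
  have e'' : 0 <= n%:R * (2 * pi * r / N%:R) by rewrite mulr_ge0.
  by move=> [|] /andP[h h']; apply/andP; split; lra.
move=> /andP[h h'].
by have [h''|h''] := ltP x (- (pi * r) + n%:R * (2 * pi * r / N%:R));
  [left; rewrite h|right].
Qed.

Let piecesT N : (0 < N)%N -> forall s, arcdom D s -> exists2 j, (j < N)%N & piece N j s.
Proof.
move=> N0 s; rewrite /arcdom/= in_itv/= => /andP[s1 s2].
set d := 2 * pi * r / N%:R.
have d0 : 0 < d by rewrite /d divr_gt0 ?ltr0n// !mulr_gt0// pi_gt0.
pose j := Num.trunc ((s + pi * r) / d).
have x0 : 0 <= (s + pi * r) / d.
  by apply: divr_ge0; [rewrite -lerBlDr sub0r|exact: ltW].
have /andP[j1 j2] := truncn_itv x0.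
move: j1 j2; rewrite -/j ler_pdivlMr// ltr_pdivrMr// => j1 j2.
exists j; last by rewrite /piece/= in_itv/= -/d; apply/andP; split; lra.
rewrite -(ltr_nat R) -(ltr_pM2r d0) (le_lt_trans j1)//.
by rewrite /d mulrCA divff ?mulr1 ?pnatr_eq0 -?lt0n//; lra.
Qed.

Lemma hausdorff1_arc_le (B : set plane) : B `<=` circle D ->
  (hausdorff1 B <= mu (arcdom D `&` g @^-1` B))%E.
Proof.
move=> BD; set J := _ `&` _; apply: ge_ereal_sup => _ [d /= d0 <-].
apply/lee_addgt0Pr => eps eps0.
have Jfin : mu J \is a fin_num.
  rewrite ge0_fin_numE ?measure_ge0//.
  apply: (@le_lt_trans _ _ (mu (arcdom D))).
    by apply: (@le_mu_ext _ _ R (wlength idfun)); exact: subIsetl.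
  by rewrite /arcdom lebesgue_measure_itv/=; case: ifP => _; rewrite ?ltry.
have [F [Fitv JF] /ltW Feps] : exists2 F, open_itv_cover J F &
    (\sum_(0 <= k <oo) (@wlength R idfun) (F k) < mu J + eps%:E)%E.
  have h : mu J = ereal_inf [set (\sum_(k <oo) (@wlength R idfun) (F k))%E | F in open_itv_cover J].
    exact: (outer_measure_open_itv_cover J).
  have := Jfin; rewrite h => /lb_ereal_inf_adherent-/(_ _ eps0)[_ [F JF <-] hF].
  by exists F.
have mF k : measurable (F k) by have [ab ->] := Fitv k; exact: measurable_itv.
have lF k : (@wlength R idfun) (F k) = mu (F k).
  by have [[a b] ->] := Fitv k; rewrite wlength_itv/= lebesgue_measure_itv.
have iF k : is_interval (F k) by have [ab ->] := Fitv k; exact: interval_is_interval.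
have [N N0 Nd] : exists2 N, (0 < N)%N & 2 * pi * r / N%:R <= d.
  exists (Num.trunc (2 * pi * r / d)).+1 => //.
  rewrite ler_pdivrMr ?ltr0n// -ler_pdivrMl// [leLHS]mulrC ltW//.
  by rewrite truncnS_gt.
pose U n : set plane := g @` (F (n %/ N)%N `&` piece N (n %% N)%N).
have dU n : (diam (U n) <= mu (F (n %/ N)%N `&` piece N (n %% N)%N))%E.
  apply: diam_arcpt_image; last by apply: (measurableI (F _)); [exact: mF|exact: measurable_itv].
  move=> x y [Fx px] [Fy py] z xzy; split; first exact: (iF _ x y).
  by apply: (@interval_is_interval R _ x y).
apply: (@le_trans _ _ (\sum_(0 <= n <oo) diam (U n))%E).
  apply: ereal_inf_lbound; exists U => //; split.
    move=> x Bx; have [s sI gs] := arcpt_surj e1 (BD _ Bx).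
    have [k _ Fks] : (\bigcup_k F k) s by apply: JF; split => //=; rewrite gs.
    have [j jN pj] := piecesT N0 sI.
    exists (k * N + j)%N => //; exists s => //.
    by rewrite divnMDl// divn_small// addn0 modnMDl modn_small.
  move=> n; apply: (le_trans (dU n)).
  apply: (@le_trans _ _ (mu (piece N (n %% N)%N))).
    apply: le_measure; rewrite ?inE; [|exact: measurable_itv|exact: subIsetr].
    by apply: (measurableI (F _)); [exact: mF|exact: measurable_itv].
  rewrite /piece lebesgue_measure_itv/=; case: ifP => _; last by rewrite lee_fin ltW.
  rewrite -EFinB lee_fin -(@natr1 R (n %% N)%N).
  lra.
apply: le_trans Feps; apply: lime_le.
  by apply: is_cvg_nneseries => n _ _; exact: diam_ge0.
apply: nearW => n.
apply: (@le_trans _ _ (\sum_(0 <= i < n * N) diam (U i))%E).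
  by apply: lee_sum_nneg_natr; [move=> k _ _; exact: diam_ge0|rewrite leq_pmulr].
apply: (@le_trans _ _ (\sum_(0 <= k < n) mu (F k))%E); last first.
  under eq_bigr do rewrite -lF.
  by apply: nneseries_lim_ge => k _ _; rewrite lF measure_ge0.
elim: n => [|n IH]; first by rewrite mul0n !big_nil.
rewrite mulSn addnC (@big_cat_nat _ _ _ (n * N))//=; last exact: leq_addr.
rewrite [leRHS]big_nat_recr//=; apply: leeD => //.
rewrite -{1}[(n * N)%N]add0n big_addn addnC addnK.
apply: (@le_trans _ _ (\sum_(0 <= j < N) mu (F n `&` piece N j))%E).
  rewrite big_nat [leRHS]big_nat; apply: lee_sum => j /andP[_ jN].
  apply: (le_trans (dU _)).
  by rewrite addnC divnMDl// divn_small// addn0 modnMDl modn_small.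
rewrite piecesU//; apply: le_measure; rewrite ?inE//.
by apply: (measurableI (F _)); [exact: mF|exact: measurable_itv].
exact: mF.
Qed.


Let measurable_dom (B : set plane) : measurable B -> measurable (arcdom D `&` g @^-1` B).
Proof.
move=> mB; apply: measurableI; first exact: measurable_itv.
by rewrite -[_ @^-1` _]setTI; apply: measurable_arcpt.
Qed.

(* Chords shorter than some d are almost as long as the arcs they span, as long
   as the parametrization does not come back to its starting point. *)
Let chord_lower (k : R) : 0 < k -> k < pi * r -> exists2 d : R, 0 < d &
  forall s t, - (pi * r) + k <= s <= pi * r - k -> - (pi * r) + k <= t <= pi * r - k ->
    edist (g s) (g t) <= d -> (1 - k) * `|s - t| <= edist (g s) (g t).
Proof.
move=> k0 kr; have rn0 : r != 0 by rewrite gt_eqF.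
have r20 : 0 < 2 * r by rewrite mulr_gt0.
have [|d d0 dP] := @sin_ge_away R k (k / r) k0.
  by rewrite divr_gt0//= ltr_pdivrMr.
exists (2 * r * d); first by rewrite mulr_gt0.
move=> s t; wlog st : s t / t <= s.
  move=> h hs ht; have [|/ltW] := leP t s => st; first exact: h.
  by rewrite edistC distrC; apply: h.
move=> /andP[s1 s2] /andP[t1 t2].
rewrite edist_arcpt// (ger0_norm (_ : 0 <= s - t)) ?subr_ge0//.
set x := (s - t) / (2 * r).
have x0 : 0 <= x by rewrite divr_ge0 ?subr_ge0// ltW.
have x1 : x <= pi - k / r.
  rewrite /x ler_pdivrMr//.
  have -> : (pi - k / r) * (2 * r) = 2 * (pi * r - k) by field.
  lra.
have sx0 : 0 <= sin x.
  apply: sin_ge0_pi; rewrite x0/= (le_trans x1)// gerBl divr_ge0// ltW//.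
rewrite ger0_norm// ler_pM2l// => hx.
have -> : s - t = 2 * r * x by rewrite /x; field.
rewrite mulrCA ler_pM2l//; apply: dP => //.
by rewrite x0.
Qed.

Lemma hausdorff1_arc_ge (B : set plane) : measurable B ->
  (mu (arcdom D `&` g @^-1` B) <= hausdorff1 B)%E.
Proof.
move=> mB; set J := _ `&` _.
have mJ : measurable J by exact: measurable_dom.
have pir : 0 < pi * r by rewrite mulr_gt0// pi_gt0.
have H0 : (0 <= hausdorff1 B)%E.
  apply: le_ereal_sup_tmp; exists (hausdorff1_pre 1 B); first by exists 1 => //=.
  apply: le_ereal_inf_tmp => _ [U _ <-].
  by apply: nneseries_ge0 => k _ _; exact: diam_ge0.
suff key k : 0 < k -> k < 1 -> k < pi * r ->
    ((1 - k)%:E * mu (J `&` `[(- (pi * r) + k)%R, (pi * r - k)%R]) <= hausdorff1 B)%E.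
  have muJ : mu J \is a fin_num.
    rewrite ge0_fin_numE ?measure_ge0//.
    apply: (@le_lt_trans _ _ (mu (arcdom D))).
      apply: le_measure; rewrite ?inE//; [exact: measurable_itv|exact: subIsetl].
    by rewrite /arcdom lebesgue_measure_itv/=; case: ifP => _; rewrite ?ltry.
  have [a muJa] : exists a, mu J = a%:E by exists (fine (mu J)); rewrite fineK.
  rewrite muJa.
  have a0 : 0 <= a by rewrite -lee_fin -muJa measure_ge0.
  case: (hausdorff1 B) H0 key => [h| |]; [|by move=> *; rewrite leey|by rewrite leeNy_eq].
  move=> h0 key.
  rewrite lee_fin; apply/ler_addgt0Pr => eps eps0.
  pose k := Num.min (Num.min (1/2) (pi * r / 2)) (eps / (a + 2)).
  have k0 : 0 < k by rewrite /k !lt_min !divr_gt0// ltr_wpDl.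
  have k1 : k < 1 by rewrite /k !gt_min; apply/orP; left; apply/orP; left; lra.
  have k2 : k < pi * r by rewrite /k !gt_min; apply/orP; left; apply/orP; right; lra.
  have k3 : k * (a + 2) <= eps by rewrite -ler_pdivlMr ?ltr_wpDl// /k ge_min lexx orbT.
  have := key k k0 k1 k2; set Jk := J `&` _ => hk.
  have mJk : measurable Jk by apply: measurableI => //; exact: measurable_itv.
  have JJk : (mu J <= mu Jk + (2 * k)%:E)%E.
    pose L : set R := `[(- (pi * r))%R, (- (pi * r) + k)%R]%classic.
    pose M : set R := `[(pi * r - k)%R, (pi * r)%R]%classic.
    have mL : measurable L by exact: measurable_itv.
    have mM : measurable M by exact: measurable_itv.
    have muL : mu L = k%:E.
      rewrite lebesgue_measure_itv/= lte_fin ltrDl k0 -EFinB; congr EFin; lra.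
    have muM : mu M = k%:E.
      rewrite lebesgue_measure_itv/= lte_fin ltrBlDr ltrDl k0 -EFinB; congr EFin; lra.
    apply: (@le_trans _ _ (mu (Jk `|` (L `|` M)))).
      apply: le_measure; rewrite ?inE//; first by apply: measurableU => //; exact: measurableU.
      move=> s Js; move: (Js) => []; rewrite {1}/arcdom/= in_itv/= => /andP[s1 s2] _.
      have [h1|h1] := leP s (- (pi * r) + k).
        by right; left; rewrite /L/= in_itv/= s1.
      have [h2|h2] := leP (pi * r - k) s.
        by right; right; rewrite /M/= in_itv/= h2 ltW.
      by left; split => //=; rewrite in_itv/= !ltW.
    apply: (le_trans (measureU2 _ _ _)) => //; first exact: measurableU.
    rewrite leeD2l//; apply: (le_trans (measureU2 _ _ _)) => //.
    by rewrite [X in (X + _)%E]muL [X in (_ + X)%E]muM -EFinD lee_fin; lra.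
  have [b Jkb] : exists b, mu Jk = b%:E.
    exists (fine (mu Jk)); rewrite fineK// ge0_fin_numE ?measure_ge0//.
    apply: (le_lt_trans _ (_ : (mu J < +oo)%E)); last by rewrite muJa ltry.
    by apply: le_measure; rewrite ?inE//; exact: subIsetl.
  move: hk JJk; rewrite muJa Jkb -EFinM -EFinD !lee_fin => hk hJ.
  have : (1 - k) * (a - 2 * k) <= h.
    apply: le_trans hk; rewrite ler_wpM2l//; lra.
  by nra.
move=> k0 k1 k2; set Jk := J `&` _.
have mJk : measurable Jk by apply: measurableI => //; exact: measurable_itv.
have [d d0 dP] := chord_lower k0 k2.
apply: le_ereal_sup_tmp; exists (hausdorff1_pre d B); first by exists d.
apply: le_ereal_inf_tmp => _ [U [BU Ud] <-].
have k10 : 0 < 1 - k by lra.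
pose S n := g @^-1` (U n) `&` Jk.
have Sfar n s t : S n s -> S n t -> ((1 - k)%:E * `|s - t|%:E <= diam (U n))%E.
  move=> [/= Us [_]]; rewrite /= in_itv/= => hs [/= Ut [_]]; rewrite /= in_itv/= => ht.
  have st := le_diam Us Ut.
  apply: le_trans (st); rewrite -EFinM lee_fin; apply: dP => //.
  by rewrite -lee_fin (le_trans st).
pose V n : set R := [set s | S n !=set0 /\ inf (S n) <= s <= sup (S n)].
have VE n : S n !=set0 -> V n = `[inf (S n), sup (S n)]%classic.
  by move=> Sn; apply/seteqP; split => s /=; rewrite /V/= in_itv/=; [case|].
have V0 n : ~ (S n !=set0) -> V n = set0.
  by move=> Sn; apply/seteqP; split => s //= [].
have mV n : measurable (V n).
  by have [Sn|Sn] := pselect (S n !=set0); [rewrite VE//; exact: measurable_itv|rewrite V0].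
have Sub n : has_ubound (S n).
  by exists (pi * r - k) => s [_ [_]]; rewrite /= in_itv/= => /andP[].
have Slb n : has_lbound (S n).
  by exists (- (pi * r) + k) => s [_ [_]]; rewrite /= in_itv/= => /andP[].
have muV n : ((1 - k)%:E * mu (V n) <= diam (U n))%E.
  have [Sn|Sn] := pselect (S n !=set0); last by rewrite V0// measure0 mule0 diam_ge0.
  rewrite VE// lebesgue_measure_itv/=; case: ifP => _; last by rewrite mule0 diam_ge0.
  have Ufin : diam (U n) \is a fin_num.
    by rewrite ge0_fin_numE ?diam_ge0// (le_lt_trans (Ud n))// ltry.
  rewrite -EFinB -(fineK Ufin) -EFinM lee_fin mulrC -ler_pdivlMr//.
  rewrite lerBlDr; apply: ge_sup => // s Ss.
  rewrite -lerBlDl; apply: lb_le_inf => // t St.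
  rewrite lerBlDr -lerBlDl (le_trans (ler_norm _))//.
  rewrite ler_pdivlMr// mulrC.
  have := Sfar n s t Ss St.
  by rewrite -EFinM -{1}(fineK Ufin) lee_fin.
apply: (@le_trans _ _ ((1 - k)%:E * \sum_(0 <= n <oo) mu (V n))%E).
  rewrite lee_wpmul2l ?lee_fin ?(ltW k10)//.
  apply: measure_sigma_subadditive => //.
  move=> s Js; have [n _ Un] : (\bigcup_k U k) (g s).
    by apply: BU; case: Js => -[].
  exists n => //; have Sns : S n s by split.
  split; first by exists s.
  by rewrite ge_inf//= ub_le_sup.
rewrite -nneseriesZl; last by move=> n _; exact: measure_ge0.
apply: lee_nneseries => n // _ _.
by rewrite mule_ge0 ?lee_fin ?(ltW k10)// measure_ge0.
Qed.

End HausdorffArc.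

Import HBNNSimple.

Section IntegralSub.
Context d (T : measurableType d) (R : realType).

Lemma eq_integral_setfun (m1 m2 : set T -> \bar R) (A : set T)
    (f : T -> \bar R) : m1 set0 = 0%E -> m2 set0 = 0%E ->
  (forall B, measurable B -> B `<=` A -> m1 B = m2 B) ->
  (\int[m1]_(x in A) f x = \int[m2]_(x in A) f x)%E.
Proof.
move=> m10 m20 m12.
have key (h : {nnsfun T >-> R}) (F : T -> \bar R) : (forall x, ~ A x -> (F x <= 0)%E) ->
    (forall x, ((h x)%:E <= F x)%E) -> sintegral m1 h = sintegral m2 h.
  move=> FA hF; rewrite /sintegral; apply: eq_fsbigr => a _.
  have [->|a0] := eqVneq a 0; first by rewrite !mul0e.
  congr (_ * _)%E; have [a1|a1] := ltP 0 a; last first.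
    suff -> : h @^-1` [set a] = set0 by rewrite m10 m20.
    apply/seteqP; split => // x /= hx; have h0 : 0 <= h x by [].
    by move: a0; rewrite -hx eq_le h0 hx a1.
  apply: m12; first exact: measurable_sfunP.
  move=> x /= hx; apply: contrapT => nAx.
  by have := le_trans (hF x) (FA _ nAx); rewrite hx lee_fin leNgt a1.
rewrite /integral; congr (_ - _)%E; congr ereal_sup;
  apply: eq_imagel => h /= hF; (apply: key hF) => x nAx.
  by rewrite funeposE patchN ?maxxx// ?notin_setE.
by rewrite funenegE patchN ?oppe0 ?maxxx// ?notin_setE.
Qed.

End IntegralSub.

Section CircleMeasure.
Context {R : realType}.
Local Notation plane := (R * R)%type.
Local Notation mu := (@lebesgue_measure R).
Variables (D : disk R) (e : plane).

Lemma measurable_arcdom : measurable (arcdom D : set R).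
Proof. exact: measurable_itv. Qed.

Definition arclen : set plane -> \bar R :=
  pushforward (mrestr mu measurable_arcdom) (arcpt D e).

Let marc := @measurable_arcpt R D e.

HB.instance Definition _ := isMeasurableFun.Build _ _ _ _ (arcpt D e) marc.

Let arclen0 : arclen set0 = 0%E. Proof. exact: measure0. Qed.

Let arclen_ge0 B : (0 <= arclen B)%E. Proof. exact: measure_ge0. Qed.

Let arclen_sigma_additive : semi_sigma_additive arclen.
Proof. exact: measure_semi_sigma_additive. Qed.

HB.instance Definition _ := isMeasure.Build _ _ _ arclen
  arclen0 arclen_ge0 arclen_sigma_additive.

Lemma arclenE (B : set plane) : arclen B = mu (arcdom D `&` arcpt D e @^-1` B).
Proof. by rewrite setIC. Qed.

Lemma arclen_fin : fin_num_fun arclen.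
Proof.
have h : (arclen setT < +oo)%E.
  rewrite arclenE preimage_setT setIT /arcdom lebesgue_measure_itv/=.
  by case: ifP => _; rewrite ?ltry.
exact: lty_fin_num_fun h.
Qed.

HB.instance Definition _ := Measure_isFinite.Build _ _ _ arclen arclen_fin.

Lemma ge0_integral_arclen (A : set plane) (f : plane -> \bar R) :
  measurable A -> measurable_fun A f -> (forall x, A x -> 0 <= f x)%E ->
  (\int[arclen]_(x in A) f x =
   \int[mu]_(s in arcdom D `&` arcpt D e @^-1` A) f (arcpt D e s))%E.
Proof.
move=> mA mf f0.
rewrite ge0_integral_pushforward//; last by move=> x /[!inE] /f0.
set B := _ @^-1` A.
have mB : measurable B by rewrite -[B]setTI; exact: marc.
have mdom := measurable_arcdom.
have mI : measurable (B `&` arcdom D) by exact: measurableI.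
have mN : measurable (B `\` arcdom D) by exact: measurableD.
have mfB : measurable_fun B (f \o arcpt D e).
  apply: (measurable_comp mA) => //; first by move=> _ [s Bs <-].
  by apply: (measurable_funS measurableT).
rewrite -{1}(setUIDK B (arcdom D)) ge0_integral_setU//; last 3 first.
- by rewrite setUIDK.
- by move=> s; rewrite setUIDK => Bs; exact: f0.
- rewrite disj_set2E; apply/eqP/seteqP; split => // s [[_ ?] []//].
rewrite [X in (_ + X)%E](_ : _ = 0%E) ?adde0; last first.
  apply: null_set_integral => //; first by apply: (measurable_funS mB) => // s [].
  by rewrite /= /mrestr setDKI measure0.
rewrite setIC; apply: eq_integral_setfun; rewrite ?measure0//.
move=> C mC CA; rewrite /mrestr; congr (mu _); apply/seteqP; split => s; first by case.
by move=> Cs; split => //; have [] := CA _ Cs.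
Qed.

End CircleMeasure.

Section HausdorffCircle.
Context {R : realType}.
Local Notation plane := (R * R)%type.
Local Notation mu := (@lebesgue_measure R).
Variables (D : disk R) (e : plane).
Hypothesis e1 : e.1 ^+ 2 + e.2 ^+ 2 = 1.

Lemma hausdorff1_arclen (B : set plane) : measurable B -> B `<=` circle D ->
  hausdorff1 B = arclen D e B.
Proof.
move=> mB BD; rewrite arclenE; apply/eqP; rewrite eq_le.
by rewrite hausdorff1_arc_le//= hausdorff1_arc_ge.
Qed.

Lemma hausdorff1_set0 : @hausdorff1 R set0 = 0%E.
Proof. by rewrite (hausdorff1_arclen measurable0)// measure0. Qed.

Lemma integral_hausdorff1 (A : set plane) (f : plane -> \bar R) : A `<=` circle D ->
  (\int[hausdorff1]_(x in A) f x = \int[arclen D e]_(x in A) f x)%E.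
Proof.
move=> AD; apply: eq_integral_setfun; rewrite ?measure0 ?hausdorff1_set0//.
by move=> B mB BA; apply: hausdorff1_arclen => //; exact: subset_trans AD.
Qed.

Lemma measurable_edist (c : plane) : measurable_fun [set: plane] (fun x : plane => edist x c).
Proof.
apply: (measurableT_comp (f := @Num.sqrt R)).
  apply: continuous_measurable_fun; exact: sqrt_continuous.
apply: measurable_funD; apply: measurable_funX; apply: measurable_funB => //.
Qed.

Lemma measurable_circle : measurable (circle D).
Proof.
rewrite circleE -[X in measurable X]setTI.
exact: (measurable_edist (center D) measurableT (measurable_set1 (radius D))).
Qed.

Lemma arclen_circleC : arclen D e (~` circle D) = 0%E.
Proof.
rewrite arclenE (_ : _ `&` _ = set0) ?measure0//.
by apply/seteqP; split => // s [_ /=]; apply; exact: arcpt_circle.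
Qed.

Lemma ae_hausdorff1 (P : plane -> Prop) :
  (\forall x \ae hausdorff1, circle D x -> P x) <->
  (\forall x \ae arclen D e, circle D x -> P x).
Proof.
have mC := measurable_circle.
have sub (N : set plane) : ~` [set x | circle D x -> P x] `<=` N ->
    ~` [set x | circle D x -> P x] `<=` N `&` circle D.
  by move=> PN x /= h; split; [exact: PN|apply: contrapT => nx; exact: h].
split=> -[N [mN N0 PN]]; exists (N `&` circle D); (split;
  [exact: measurableI| |exact: sub]); have mNC := measurableI _ _ mN mC;
  have HN := hausdorff1_arclen mNC (@subIsetr _ N (circle D)).
- rewrite -HN; apply/eqP; rewrite eq_le HN measure_ge0 andbT -HN -N0.
  apply: ge_ereal_sup => _ [d /= d0 <-].
  apply: le_ereal_sup_tmp; exists (hausdorff1_pre d N); first by exists d.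
  apply: ereal_inf_le_tmp => _ [U [NU Ud] <-]; exists U => //; split => //.
  by apply: subset_trans NU; exact: subIsetl.
- rewrite HN; apply/eqP; rewrite eq_le measure_ge0 andbT -N0.
  by apply: le_measure; rewrite ?inE//; exact: subIsetl.
Qed.

End HausdorffCircle.

Section OpenFTC.
Context {R : realType}.
Local Notation mu := (@lebesgue_measure R).

Lemma is_derive_continuous (f : R -> R) (x df : R) :
  is_derive x (1 : R) f df -> {for x, continuous f}.
Proof. by move=> [d _]; apply/differentiable_continuous/derivable1_diffP. Qed.

Lemma ge0_FTC_oo_le (f F : R -> R) (a b la lb : R) : a < b ->
  {in `]a, b[, continuous f} ->
  (forall x : R, x \in `]a, b[ -> 0 <= f x) ->
  (forall x : R, x \in `]a, b[ -> is_derive x 1 F (f x)) ->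
  (forall x : R, x \in `]a, b[ -> la <= F x <= lb) ->
  (\int[mu]_(x in `]a, b[) (f x)%:E <= (lb - la)%:E)%E.
Proof.
move=> ab cf f0 dF Fb.
pose c n : R := (b - a) / (n.+3)%:R.
have c0 n : 0 < c n by rewrite divr_gt0 ?subr_gt0.
have cd n : c n <= (b - a) / 3%:R.
  by rewrite ler_pM2l ?subr_gt0// lef_pV2 ?posrE// ler_nat.
pose I n : set R := `[a + c n, b - c n]%classic.
have IE : `]a, b[%classic = \bigcup_n I n.
  apply/seteqP; split => x /=; rewrite in_itv/=; last first.
    by move=> [n _]; rewrite /I/= in_itv/= => /andP[h1 h2]; have := c0 n; move=> h;
      apply/andP; split; lra.
  move=> /andP[ax xb].
  pose del := Num.min (x - a) (b - x).
  have del0 : 0 < del by rewrite lt_min !subr_gt0 ax.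
  exists (Num.trunc ((b - a) / del)) => //.
  have cle : c (Num.trunc ((b - a) / del)) <= del.
    rewrite /c ler_pdivrMr// -ler_pdivrMl// [leLHS]mulrC ltW//.
    rewrite (lt_le_trans (truncnS_gt _))// ler_nat.
    by rewrite ltnW.
  have d1 : del <= x - a by rewrite ge_min lexx.
  have d2 : del <= b - x by rewrite ge_min lexx orbT.
  by rewrite /I/= in_itv/=; apply/andP; split; lra.
have Isub n x : x \in `[a + c n, b - c n] -> x \in `]a, b[.
  by rewrite !in_itv/= => /andP[h1 h2]; have := c0 n => h; apply/andP; split; lra.
have ltI n : a + c n < b - c n by have := cd n; lra.
have mI n : measurable (I n) by exact: measurable_itv.
have mf n : measurable_fun (I n) (EFin \o f).
  apply/measurable_EFinP; apply: (@measurable_funS _ _ _ _ `]a, b[%classic) => //.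
    by move=> x /Isub.
  by apply: open_continuous_measurable_fun => // x /[!inE]; exact: cf.
rewrite IE.
have hc : (\int[mu]_(x in I n) (f x)%:E @[n --> \oo] --> \int[mu]_(x in \bigcup_n I n) (f x)%:E)%E.
  apply: ge0_nondecreasing_set_cvg_integral => //.
    move=> m n mn; rewrite subsetEset => x; rewrite /I/= !in_itv/= => /andP[h1 h2].
    have cmn : c n <= c m.
      by rewrite ler_pM2l ?subr_gt0// lef_pV2 ?posrE// ler_nat.
    by apply/andP; split; lra.
  by move=> n x /Isub xab; rewrite lee_fin f0.
refine (cvge_to_le hc _).
apply: nearW => n.
rewrite (@continuous_FTC2 _ f F)//.
- have ha : a + c n \in `]a, b[ by apply: (Isub n); rewrite in_itv/= lexx ltW.
  have hb : b - c n \in `]a, b[ by apply: (Isub n); rewrite in_itv/= lexx ltW.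
  have /andP[h1 _] := Fb _ ha; have /andP[_ h2] := Fb _ hb.
  by rewrite -EFinB lee_fin; lra.
- apply: continuous_in_subspaceT => x; rewrite inE => /Isub; exact: cf.
- have cF x : x \in `]a, b[ -> {for x, continuous F}.
    by move=> /dF/is_derive_continuous.
  split.
  + move=> x xI; have : x \in `[a + c n, b - c n] by apply: subset_itv_oo_cc.
    by move/Isub/dF => [].
  + apply: cvg_at_right_filter; apply: cF; apply: (Isub n).
    by rewrite in_itv/= lexx ltW.
  + apply: cvg_at_left_filter; apply: cF; apply: (Isub n).
    by rewrite in_itv/= lexx ltW.
- move=> x xI; have : x \in `[a + c n, b - c n] by apply: subset_itv_oo_cc.
  by move/Isub/dF => d; rewrite derive1E derive_val.
Qed.

End OpenFTC.

Section Bipolar.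
Context {R : realType}.
Local Notation plane := (R * R)%type.
Local Notation mu := (@lebesgue_measure R).
Implicit Types (o e : plane) (h eta v : R).

Definition bden eta v : R := v ^+ 4 - 2 * cos eta * v ^+ 2 + 1.

Definition bpt o e h eta v : plane :=
  let X := 2 * h * sin eta * v ^+ 2 / bden eta v in
  let Y := h * (v ^+ 4 - 1) / bden eta v in
  (o.1 + X * e.1 - Y * e.2, o.2 + X * e.2 + Y * e.1).

Lemma bden_gt0 eta v : 0 < eta < pi -> 0 < bden eta v.
Proof.
move=> eI; have s0 : 0 < sin eta by exact: sin_gt0_pi.
have -> : bden eta v = (v ^+ 2 - cos eta) ^+ 2 + sin eta ^+ 2.
  by rewrite sin2cos2 /bden; ring.
by rewrite ltr_wpDl ?sqr_ge0// exprn_gt0.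
Qed.

Definition arc_frame (D : disk R) o e h eta :=
  [/\ e.1 ^+ 2 + e.2 ^+ 2 = 1, 0 < eta < pi, h = radius D * sin eta &
    center D = (o.1 + radius D * cos eta * e.1, o.2 + radius D * cos eta * e.2)].

Section ArcFTC.
Variables (D : disk R) (o e : plane) (h eta : R).
Hypothesis fr : arc_frame D o e h eta.
Local Notation r := (radius D).
Let r0 : 0 < r := radius_gt0 D.
Let rn0 : r != 0. Proof. by rewrite gt_eqF. Qed.
Let e1 : e.1 ^+ 2 + e.2 ^+ 2 = 1. Proof. by case: fr. Qed.
Let eI : 0 < eta < pi. Proof. by case: fr. Qed.
Let s0 : 0 < sin eta. Proof. exact: sin_gt0_pi. Qed.
Let hE : h = r * sin eta. Proof. by case: fr. Qed.
Let h0 : 0 < h. Proof. by rewrite hE mulr_gt0. Qed.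

Let P s := cos (s / (2 * r) - eta / 2).
Let M s := cos (s / (2 * r) + eta / 2).

Let Itv := `](- ((pi - eta) * r)), ((pi - eta) * r)[.

Let PM0 s : s \in Itv -> 0 < P s /\ 0 < M s.
Proof.
rewrite in_itv/= => /andP[s1 s2]; have /andP[e0 epi] := eI.
have r20 : 0 < 2 * r by rewrite mulr_gt0.
have u1 : - ((pi - eta) / 2) < s / (2 * r).
  by rewrite ltr_pdivlMr//; lra.
have u2 : s / (2 * r) < (pi - eta) / 2.
  by rewrite ltr_pdivrMr//; lra.
by split; apply: cos_gt0_pihalf; apply/andP; split; lra.
Qed.

Definition arcv s := Num.sqrt (P s / M s).

Lemma arcv_gt0 s : s \in Itv -> 0 < arcv s.
Proof. by move=> /PM0[p m]; rewrite sqrtr_gt0 divr_gt0. Qed.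

Let arcv2 s : s \in Itv -> arcv s ^+ 2 = P s / M s.
Proof. by move=> /PM0[p m]; rewrite sqr_sqrtr// divr_ge0 ?ltW. Qed.

Let arcden s : s \in Itv -> bden eta (arcv s) = sin eta ^+ 2 / M s ^+ 2.
Proof.
move=> sI; have [p m] := PM0 sI; rewrite /bden.
have -> : arcv s ^+ 4 = (arcv s ^+ 2) ^+ 2 by rewrite -exprM.
rewrite (arcv2 sI); have mn0 : M s != 0 by rewrite gt_eqF.
suff H : P s ^+ 2 - 2 * cos eta * P s * M s + M s ^+ 2 = sin eta ^+ 2.
  by rewrite -H; field.
have [-> ->] : cos eta = cos (eta / 2) ^+ 2 - sin (eta / 2) ^+ 2 /\
    sin eta = 2 * sin (eta / 2) * cos (eta / 2).
  have E2 : eta = eta / 2 + eta / 2 by field.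
  by split; rewrite {1}E2 ?cosD ?sinD; ring.
rewrite /P /M cosB !cosD.
have hu := cos2Dsin2 (s / (2 * r)); have hv := cos2Dsin2 (eta / 2).
move: (cos (s / _)) (sin (s / _)) (cos (eta / 2)) (sin (eta / 2)) hu hv => cu su cv sv hu hv.
set p0 := cu * cv + su * sv; set m0 := cu * cv - su * sv.
transitivity ((p0 ^+ 2 + m0 ^+ 2) * (cv ^+ 2 + sv ^+ 2) - 2 * (cv ^+ 2 - sv ^+ 2) * p0 * m0).
  by rewrite hv; ring.
transitivity (4 * cv ^+ 2 * sv ^+ 2 * (cu ^+ 2 + su ^+ 2)); first by rewrite /p0 /m0; ring.
by rewrite hu; ring.
Qed.

Lemma arcpt_bpt s : s \in Itv -> arcpt D e s = bpt o e h eta (arcv s).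
Proof.
move=> sI; have [p m] := PM0 sI; have mn0 : M s != 0 by rewrite gt_eqF.
have sn0 : sin eta != 0 by rewrite gt_eqF.
have -> : bpt o e h eta (arcv s) =
    (o.1 + 2 * r * P s * M s * e.1 - r * (P s ^+ 2 - M s ^+ 2) / sin eta * e.2,
     o.2 + 2 * r * P s * M s * e.2 + r * (P s ^+ 2 - M s ^+ 2) / sin eta * e.1).
  rewrite /bpt (arcden sI) (_ : arcv s ^+ 4 = (arcv s ^+ 2) ^+ 2); last by rewrite -exprM.
  by rewrite (arcv2 sI) hE; congr pair; field; rewrite sn0 mn0.
have cD : center D = (o.1 + r * cos eta * e.1, o.2 + r * cos eta * e.2) by case: fr.
rewrite /arcpt cD /=.
have Es : s / r = s / (2 * r) + s / (2 * r) by field.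
have X1 : cos eta + cos (s / r) = 2 * P s * M s.
  have E2 : eta = eta / 2 + eta / 2 by field.
  rewrite Es {1}E2 /P /M cosB !cosD.
  have hu := cos2Dsin2 (s / (2 * r)); have hv := cos2Dsin2 (eta / 2).
  move: (cos (s / _)) (sin (s / _)) (cos (eta / 2)) (sin (eta / 2)) hu hv => cu su cv sv hu hv.
  transitivity ((cv ^+ 2 - sv ^+ 2) * (cu ^+ 2 + su ^+ 2) +
    (cu ^+ 2 - su ^+ 2) * (cv ^+ 2 + sv ^+ 2)); last by ring.
  by rewrite hu hv; ring.
have X2 : sin (s / r) = (P s ^+ 2 - M s ^+ 2) / sin eta.
  have E2 : eta = eta / 2 + eta / 2 by field.
  apply: (mulIf sn0); rewrite divfK// Es {1}E2 /P /M cosB !cosD !sinD.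
  by ring.
have X3 : cos (s / r) = 2 * P s * M s - cos eta by rewrite -X1; ring.
by rewrite X2 X3; congr pair; field.
Qed.

Lemma is_derive_arcv s : s \in Itv ->
  is_derive s (1 : R) arcv (bden eta (arcv s) / (4 * h * arcv s)).
Proof.
move=> sI; have [p m] := PM0 sI; have mn0 : M s != 0 by rewrite gt_eqF.
have sn0 : sin eta != 0 by rewrite gt_eqF.
have v0 := arcv_gt0 sI; have vn0 : arcv s != 0 by rewrite gt_eqF.
have dP : is_derive s (1 : R) P (- sin (s / (2 * r) - eta / 2) * (2 * r)^-1).
  have d1 : is_derive s (1 : R) (fun s => s / (2 * r) - eta / 2) ((2 * r)^-1).
    by apply: is_derive_eq; rewrite scaler0 add0r subr0 /GRing.scale/= mulr1.
  exact: (@is_derive1_comp _ cos (fun s => s / (2 * r) - eta / 2)).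
have dM : is_derive s (1 : R) M (- sin (s / (2 * r) + eta / 2) * (2 * r)^-1).
  have d1 : is_derive s (1 : R) (fun s => s / (2 * r) + eta / 2) ((2 * r)^-1).
    by apply: is_derive_eq; rewrite scaler0 add0r addr0 /GRing.scale/= mulr1.
  exact: (@is_derive1_comp _ cos (fun s => s / (2 * r) + eta / 2)).
have dQ : is_derive s (1 : R) (fun s => P s / M s) (sin eta / (2 * r * M s ^+ 2)).
  have dV := is_deriveV mn0 dM.
  apply: is_derive_eq; rewrite /GRing.scale/=.
  have -> : sin eta = sin (s / (2 * r) + eta / 2) * P s - cos (s / (2 * r) + eta / 2) * sin (s / (2 * r) - eta / 2).
    by rewrite /P -sinB; congr sin; field.
  by rewrite -/(M s); field; rewrite mn0.
have q0 : 0 < P s / M s by rewrite divr_gt0.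
have := @is_derive1_comp _ Num.sqrt (fun s => P s / M s) s _ _ (is_derive1_sqrt q0) dQ.
rewrite -[Num.sqrt (P s / M s)]/(arcv s) => d.
suff -> : bden eta (arcv s) / (4 * h * arcv s) =
    (2 * arcv s)^-1 * (sin eta / (2 * r * M s ^+ 2)) by exact: d.
by rewrite (arcden sI) hE; field; rewrite vn0 mn0 sn0 ?rn0.
Qed.

Lemma arc_FTC (A : set plane) (g : plane -> R) (f G : R -> R) (la lb : R) :
  measurable A -> measurable_fun A g ->
  (forall x, A x -> 0 <= g x) ->
  (forall s, arcdom D s -> A (arcpt D e s) -> s \in Itv) ->
  (forall v, 0 < v -> 0 <= f v) ->
  (forall v, 0 < v -> g (bpt o e h eta v) = f v) ->
  (forall v, 0 < v -> {for v, continuous f}) ->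
  (forall v : R, 0 < v -> is_derive v 1 G (f v * (4 * h * v / bden eta v))) ->
  (forall v, 0 < v -> la <= G v <= lb) ->
  (\int[arclen D e]_(x in A) (g x)%:E <= (lb - la)%:E)%E.
Proof.
move=> mA mg g0 AI f0 gf cf dG Gb.
have v0 := arcv_gt0.
have mEg : measurable_fun A (EFin \o g) by exact/measurable_EFinP.
have H := @ge0_integral_arclen R D e A (EFin \o g) mA mEg g0.
rewrite [leLHS]H.
have /andP[_ epi] := eI.
have cfv x : x \in Itv -> {for x, continuous (f \o arcv)}.
  move=> xI; apply: continuous_comp; last exact/cf/v0.
  exact: is_derive_continuous (is_derive_arcv xI).
apply: (@le_trans _ _ (\int[mu]_(s in [set` Itv]) (f (arcv s))%:E)%E).
  have -> : (\int[mu]_(s in arcdom D `&` arcpt D e @^-1` A) (EFin \o g) (arcpt D e s) =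
     \int[mu]_(s in arcdom D `&` arcpt D e @^-1` A) (f (arcv s))%:E)%E.
    apply: eq_integral => s; rewrite inE => -[sD As]; have sI := AI s sD As.
    by rewrite /= arcpt_bpt// gf// v0.
  apply: ge0_subset_integral => //.
  - apply: measurableI; first exact: measurable_arcdom.
    by rewrite -[X in measurable X]setTI; apply: measurable_arcpt.
  - apply/measurable_EFinP; apply: open_continuous_measurable_fun.
      exact: interval_open.
    by move=> x /[!inE] xI; exact: cfv.
  - by move=> s sI; rewrite lee_fin f0// v0.
  - by move=> s [sD As]; exact: AI.
apply: (@ge0_FTC_oo_le _ _ (G \o arcv)).
- by rewrite gtrN// mulr_gt0// subr_gt0.
- exact: cfv.
- by move=> s sI; rewrite f0// v0.
- move=> s sI.
  have := @is_derive1_comp _ G arcv s _ _ (dG _ (v0 _ sI)) (is_derive_arcv sI).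
  have bn0 : bden eta (arcv s) != 0 by rewrite gt_eqF// bden_gt0.
  have vn0 : arcv s != 0 by rewrite gt_eqF// v0.
  have hn0 : h != 0 by rewrite gt_eqF.
  have -> : f (arcv s) * (4 * h * arcv s / bden eta (arcv s)) *
    (bden eta (arcv s) / (4 * h * arcv s)) = f (arcv s) by field; rewrite bn0 vn0 hn0.
  exact.
- by move=> s sI; exact/Gb/v0.
Qed.

End ArcFTC.
End Bipolar.

Section Antiderivatives.
Context {R : realType}.
Implicit Types (s c t v p q : R).

Definition quad4 s c t v := v ^+ 4 - 2 * (c ^+ 2 - s ^+ 2) * t ^+ 2 * v ^+ 2 + t ^+ 4.

Definition atan_sum s c t v := atan ((v - c * t) / (s * t)) + atan ((v + c * t) / (s * t)).

Definition lnratio c t v :=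
  ln (v ^+ 2 - 2 * c * t * v + t ^+ 2) - ln (v ^+ 2 + 2 * c * t * v + t ^+ 2).

Lemma quad4E s c t v : s ^+ 2 + c ^+ 2 = 1 ->
  quad4 s c t v = (v ^+ 2 - 2 * c * t * v + t ^+ 2) * (v ^+ 2 + 2 * c * t * v + t ^+ 2).
Proof.
move=> sc; rewrite /quad4 (_ : s ^+ 2 = 1 - c ^+ 2); last by rewrite -sc; ring.
by ring.
Qed.

Lemma quad2_gt0 s c t v : s ^+ 2 + c ^+ 2 = 1 -> 0 < s -> 0 < t ->
  0 < v ^+ 2 - 2 * c * t * v + t ^+ 2 /\ 0 < v ^+ 2 + 2 * c * t * v + t ^+ 2.
Proof.
move=> sc s0 t0.
have -> : v ^+ 2 - 2 * c * t * v + t ^+ 2 = (v - c * t) ^+ 2 + (s * t) ^+ 2.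
  by rewrite exprMn (_ : s ^+ 2 = 1 - c ^+ 2); [ring|rewrite -sc; ring].
have -> : v ^+ 2 + 2 * c * t * v + t ^+ 2 = (v + c * t) ^+ 2 + (s * t) ^+ 2.
  by rewrite exprMn (_ : s ^+ 2 = 1 - c ^+ 2); [ring|rewrite -sc; ring].
by split; rewrite ltr_wpDl ?sqr_ge0// exprn_gt0// mulr_gt0.
Qed.

Lemma quad4_gt0 s c t v : s ^+ 2 + c ^+ 2 = 1 -> 0 < s -> 0 < t -> 0 < quad4 s c t v.
Proof.
by move=> sc s0 t0; rewrite quad4E//; have [? ?] := quad2_gt0 v sc s0 t0; rewrite mulr_gt0.
Qed.

Lemma is_derive_atan_sum s c t v : s ^+ 2 + c ^+ 2 = 1 -> 0 < s -> 0 < t ->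
  is_derive v (1 : R) (atan_sum s c t) (2 * s * t * (v ^+ 2 + t ^+ 2) / quad4 s c t v).
Proof.
move=> sc s0 t0; have [q1 q2] := quad2_gt0 v sc s0 t0.
have d1 (k : R) : is_derive v (1 : R) (fun v => (v + k) / (s * t)) ((s * t)^-1).
  by apply: is_derive_eq; rewrite /GRing.scale/=; ring.
have a1 (k : R) := @is_derive1_comp _ atan _ v _ _
   (is_derive1_atan ((v + k) / (s * t))) (d1 k).
have := @is_deriveD _ _ _ _ _ v 1 _ _ (a1 (- (c * t))) (a1 (c * t)).
have -> : 2 * s * t * (v ^+ 2 + t ^+ 2) / quad4 s c t v =
    (1 + ((v - c * t) / (s * t)) ^+ 2)^-1 / (s * t) +
    (1 + ((v + c * t) / (s * t)) ^+ 2)^-1 / (s * t); last by exact.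
have sn0 : s != 0 by rewrite gt_eqF.
have tn0 : t != 0 by rewrite gt_eqF.
rewrite quad4E//.
have -> : 1 + ((v - c * t) / (s * t)) ^+ 2 = (v ^+ 2 - 2 * c * t * v + t ^+ 2) / (s * t) ^+ 2.
  have -> : t ^+ 2 = (s ^+ 2 + c ^+ 2) * t ^+ 2 by rewrite sc mul1r.
  by field; rewrite sn0 tn0.
have -> : 1 + ((v + c * t) / (s * t)) ^+ 2 = (v ^+ 2 + 2 * c * t * v + t ^+ 2) / (s * t) ^+ 2.
  have -> : t ^+ 2 = (s ^+ 2 + c ^+ 2) * t ^+ 2 by rewrite sc mul1r.
  by field; rewrite sn0 tn0.
have n1 := lt0r_neq0 q1; have n2 := lt0r_neq0 q2.
by field; rewrite n1 n2 sn0 tn0.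
Qed.

Lemma is_derive_lnratio s c t v : s ^+ 2 + c ^+ 2 = 1 -> 0 < s -> 0 < t ->
  is_derive v (1 : R) (lnratio c t) (4 * c * t * (v ^+ 2 - t ^+ 2) / quad4 s c t v).
Proof.
move=> sc s0 t0; have [q1 q2] := quad2_gt0 v sc s0 t0.
have d1 (k : R) : is_derive v (1 : R) (fun v => v ^+ 2 + k * v + t ^+ 2) (2 * v + k).
  by apply: is_derive_eq; rewrite /GRing.scale/=; ring.
have q1' : 0 < v ^+ 2 + (- (2 * c * t)) * v + t ^+ 2 by rewrite mulNr.
have a1 := @is_derive1_comp _ (@ln R) _ v _ _ (is_derive1_ln q1') (d1 (- (2 * c * t))).
have a2 := @is_derive1_comp _ (@ln R) _ v _ _ (is_derive1_ln q2) (d1 (2 * c * t)).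
have := @is_deriveB _ _ _ _ _ v 1 _ _ a1 a2.
have -> : 4 * c * t * (v ^+ 2 - t ^+ 2) / quad4 s c t v =
  (v ^+ 2 + (- (2 * c * t)) * v + t ^+ 2)^-1 * (2 * v + - (2 * c * t)) -
  (v ^+ 2 + 2 * c * t * v + t ^+ 2)^-1 * (2 * v + 2 * c * t).
  have n1 := lt0r_neq0 q1'; have n2 := lt0r_neq0 q2.
  by rewrite quad4E// -mulNr; field; rewrite n1 n2.
rewrite [X in is_derive _ _ X _ -> _](_ : _ = lnratio c t)//.
apply/funext => w; rewrite /lnratio.
by rewrite -[LHS]/(ln (w ^+ 2 + - (2 * c * t) * w + t ^+ 2) - ln (w ^+ 2 + 2 * c * t * w + t ^+ 2)) mulNr.
Qed.

Lemma atan_sum_0 s c t : atan_sum s c t 0 = 0.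
Proof. by rewrite /atan_sum sub0r add0r mulNr atanN addNr. Qed.

Lemma lnratio_0 c t : lnratio c t 0 = 0.
Proof. by rewrite /lnratio !mulr0 subr0 addr0 subrr. Qed.

Lemma atan_sum_cvgy s c t : 0 < s -> 0 < t -> atan_sum s c t v @[v --> +oo] --> pi.
Proof.
move=> s0 t0; have st0 : 0 < s * t by rewrite mulr_gt0.
have h (k : R) : atan ((v + k) / (s * t)) @[v --> +oo] --> (pi / 2 : R).
  apply: (@cvg_comp _ _ _ (fun v : R => (v + k) / (s * t)) atan _ +oo); last exact: cvgy_atan.
  apply/cvgryPge => A; near=> v.
  rewrite ler_pdivlMr// -lerBlDr; near: v; apply: nbhs_pinfty_ge; exact: num_real.
have -> : pi = pi / 2 + pi / 2 :> R by field.
exact: cvgD (h (- (c * t))) (h (c * t)).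
Unshelve. all: by end_near. Qed.

Lemma lnratio_cvgy s c t : s ^+ 2 + c ^+ 2 = 1 -> 0 < s -> 0 < c -> 0 < t ->
  lnratio c t v @[v --> +oo] --> (0 : R).
Proof.
move=> sc s0 c0 t0.
have c1 : c <= 1 by nra.
apply: (@squeeze_cvgr _ _ _ _ (fun v => - (8 * c * t / v)) (fun=> 0)).
- near=> v.
  have v0 : 0 < v by near: v; apply: nbhs_pinfty_gt; exact: num_real.
  have v4 : 4 * t <= v by near: v; apply: nbhs_pinfty_ge; exact: num_real.
  have [q1 q2] := quad2_gt0 v sc s0 t0.
  have ct0 : 0 < c * t by rewrite mulr_gt0.
  rewrite /lnratio; apply/andP; split; last first.
    rewrite subr_le0 ler_ln ?posrE//.
    have ctv : 0 < c * t * v by rewrite mulr_gt0.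
    lra.
  rewrite -opprB lerN2 -ln_div ?posrE//.
  set a := _ / _; have a0 : 0 < a by rewrite divr_gt0.
  have : ln a <= a - 1.
    have := @expR_ge1Dx R (ln a); rewrite lnK ?posrE// => h; lra.
  move=> /le_trans; apply; rewrite /a lerBlDr ler_pdivrMr//.
  set q := v ^+ 2 - _ + _ in q1 *.
  have h1 : v ^+ 2 / 2 <= q.
    have k1 : 0 <= (1 - c) * (t * v) by rewrite mulr_ge0 ?subr_ge0// mulr_ge0 ?(ltW t0) ?(ltW v0).
    have k2 : 0 <= v * (v - 4 * t) by rewrite mulr_ge0 ?subr_ge0 ?(ltW v0).
    have k3 := sqr_ge0 t.
    have -> : q = v ^+ 2 / 2 + (v * (v - 4 * t)) / 2 + 2 * ((1 - c) * (t * v)) + t ^+ 2.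
      by rewrite /q; field.
    lra.
  have h2 : 4 * c * t * v <= 8 * c * t / v * q.
    have -> : 4 * c * t * v = 8 * c * t / v * (v ^+ 2 / 2) by field; rewrite gt_eqF.
    by rewrite ler_wpM2l// divr_ge0 ?(ltW v0)// -mulrA mulr_ge0// ltW.
  have -> : v ^+ 2 + 2 * c * t * v + t ^+ 2 = q + 4 * c * t * v by rewrite /q; ring.
  lra.
- rewrite -[X in _ --> X]oppr0; apply: cvgN.
  apply/cvgrPdist_le => /= eps eps0; near=> v.
  have v0 : 0 < v by near: v; apply: nbhs_pinfty_gt; exact: num_real.
  rewrite sub0r normrN ger0_norm; last by rewrite divr_ge0 ?mulr_ge0 ?(ltW c0) ?(ltW t0) ?(ltW v0).
  rewrite ler_pdivrMr// -ler_pdivrMl//; near: v; apply: nbhs_pinfty_ge; exact: num_real.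
- exact: cvg_cst.
Unshelve. all: by end_near. Qed.

Lemma ge0_derive_bounds (G f : R -> R) (lb : R) :
  (forall v : R, is_derive v 1 G (f v)) -> (forall v, 0 < v -> 0 <= f v) ->
  G v @[v --> +oo] --> lb -> forall v, 0 < v -> G 0 <= G v <= lb.
Proof.
move=> dG f0 Gl v v0.
have mono x y : 0 <= x -> x <= y -> G x <= G y.
  move=> x0; rewrite le_eqVlt => /orP[/eqP<-//|xy].
  have [|z] := @MVT R G f x y xy (fun z _ => dG z).
    by apply: continuous_subspaceT => z; exact: is_derive_continuous (dG z).
  rewrite in_itv/= => /andP[xz zy] E; rewrite -subr_ge0 E.
  by rewrite mulr_ge0 ?f0 ?subr_ge0 ?(ltW xy)//; lra.
rewrite mono ?(ltW v0)//=.
apply: (cvgr_to_ge Gl); near=> w; apply: mono; first exact: ltW.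
by near: w; apply: nbhs_pinfty_ge; exact: num_real.
Unshelve. all: by end_near. Qed.

Definition rat_prim s1 c1 t1 p1 q1 s2 c2 t2 p2 q2 v :=
  p1 / (2 * s1 * t1) * atan_sum s1 c1 t1 v + q1 / (4 * c1 * t1) * lnratio c1 t1 v +
  (p2 / (2 * s2 * t2) * atan_sum s2 c2 t2 v + q2 / (4 * c2 * t2) * lnratio c2 t2 v).

Lemma rat_primP s1 c1 t1 p1 q1 s2 c2 t2 p2 q2 (f : R -> R) :
  s1 ^+ 2 + c1 ^+ 2 = 1 -> 0 < s1 -> 0 < c1 -> 0 < t1 ->
  s2 ^+ 2 + c2 ^+ 2 = 1 -> 0 < s2 -> 0 < c2 -> 0 < t2 ->
  (forall v, f v = (p1 * (v ^+ 2 + t1 ^+ 2) + q1 * (v ^+ 2 - t1 ^+ 2)) / quad4 s1 c1 t1 v +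
   (p2 * (v ^+ 2 + t2 ^+ 2) + q2 * (v ^+ 2 - t2 ^+ 2)) / quad4 s2 c2 t2 v) ->
  (forall v, 0 < v -> 0 <= f v) ->
  let G := rat_prim s1 c1 t1 p1 q1 s2 c2 t2 p2 q2 in
  (forall v, is_derive v (1 : R) G (f v)) /\
  (forall v, 0 < v -> 0 <= G v <= p1 * pi / (2 * s1 * t1) + p2 * pi / (2 * s2 * t2)).
Proof.
move=> sc1 s10 c10 t10 sc2 s20 c20 t20 fE f0 G.
have dG v : is_derive v (1 : R) G (f v).
  have da1 := is_derive_atan_sum v sc1 s10 t10; have dl1 := is_derive_lnratio v sc1 s10 t10.
  have da2 := is_derive_atan_sum v sc2 s20 t20; have dl2 := is_derive_lnratio v sc2 s20 t20.
  have n1 := lt0r_neq0 (quad4_gt0 v sc1 s10 t10).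
  have n2 := lt0r_neq0 (quad4_gt0 v sc2 s20 t20).
  have [? ? ?] := And3 (lt0r_neq0 s10) (lt0r_neq0 c10) (lt0r_neq0 t10).
  have [? ? ?] := And3 (lt0r_neq0 s20) (lt0r_neq0 c20) (lt0r_neq0 t20).
  rewrite /G /rat_prim; apply: is_derive_eq; rewrite /GRing.scale/= fE.
  by field; do ?[apply/andP; split].
split => //.
have G0 : G 0 = 0 by rewrite /G /rat_prim !atan_sum_0 !lnratio_0 !mulr0 !addr0.
move=> v v0.
suff Gl : G w @[w --> +oo] --> p1 * pi / (2 * s1 * t1) + p2 * pi / (2 * s2 * t2).
  by have := ge0_derive_bounds dG f0 Gl v0; rewrite G0.
have -> : p1 * pi / (2 * s1 * t1) + p2 * pi / (2 * s2 * t2) =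
  p1 / (2 * s1 * t1) * pi + q1 / (4 * c1 * t1) * 0 +
  (p2 / (2 * s2 * t2) * pi + q2 / (4 * c2 * t2) * 0) by ring.
by apply: cvgD; apply: cvgD; (apply: cvgM; [exact: cvg_cst|]);
  do ?[exact: atan_sum_cvgy|exact: (@lnratio_cvgy s1)|exact: (@lnratio_cvgy s2)].
Qed.

End Antiderivatives.

Section RationalIntegrals.
Context {R : realType}.
Implicit Types (s c w v : R).

Definition has_prim_le (f : R -> R) (V : R) := exists G : R -> R,
  (forall v, is_derive v (1 : R) G (f v)) /\ (forall v, 0 < v -> 0 <= G v <= V).

Lemma prim_potential s c w : s ^+ 2 + c ^+ 2 = 1 -> 0 < s -> 0 < c -> 0 < w ->
  has_prim_le (fun v => 2 * s * c / pi * w ^+ 2 * (v ^+ 2 + 1) / quad4 s c w v)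
    (c * ((w + w^-1) / 2)).
Proof.
move=> sc s0 c0 w0; have pi0 := pi_gt0 R.
have [? ? ?] := And3 (lt0r_neq0 s0) (lt0r_neq0 c0) (lt0r_neq0 w0).
have pin := lt0r_neq0 pi0.
pose k := s * c / pi * w ^+ 2.
have H f := @rat_primP R s c w (k * (1 + w ^- 2)) (k * (1 - w ^- 2))
  s c w 0 0 f sc s0 c0 w0 sc s0 c0 w0.
have [||dG Gb] := H (fun v => 2 * s * c / pi * w ^+ 2 * (v ^+ 2 + 1) / quad4 s c w v).
- move=> v; have := lt0r_neq0 (quad4_gt0 v sc s0 w0) => ?.
  by rewrite /k; move: (pi : R) pin => P Pn; field; do ?[apply/andP; split].
- move=> v v0; rewrite divr_ge0 ?ltW ?quad4_gt0//.
  by rewrite !mulr_gt0 ?invr_gt0 ?exprn_gt0// ltr_wpDl ?sqr_ge0.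
exists (rat_prim s c w (k * (1 + w ^- 2)) (k * (1 - w ^- 2)) s c w 0 0); split => // v v0.
have /andP[-> /le_trans] := Gb v v0; apply.
rewrite /k le_eqVlt; apply/orP; left; apply/eqP.
by move: (pi : R) pin => P Pn; field; do ?[apply/andP; split].
Qed.

Section Flux.
Variables (s c s2 k w : R).
Hypotheses (sc : s ^+ 2 + c ^+ 2 = 1) (sk2 : s2 ^+ 2 + k ^+ 2 = 1).
Hypotheses (s0 : 0 < s) (c0 : 0 < c) (s20 : 0 < s2) (k0 : k != 0) (w0 : 0 < w) (w1 : w != 1).

Let x := c ^+ 2 - s ^+ 2.
Let y := s2 ^+ 2 - k ^+ 2.
Let T := w ^+ 2.
Let N := w ^+ 4 + 2 * (x * y + 4 * s * c * s2 * k) * T + 1.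
Let X := (w + w^-1) / 2.
Let C' := c * s2 - s * k.
Let S' := s * s2 + c * k.

Lemma prim_flux : 
  has_prim_le (fun v => 2 * s * c / pi * N * (v ^+ 2 * (v ^+ 2 + 1)) /
     (quad4 s c w v * quad4 s2 `|k| 1 v))
    (c * X + s * c * (2 * k * C' / (X + S') - y / s2)).
Proof.
have pi0 := pi_gt0 R; have pin := lt0r_neq0 pi0.
have [sn cn wn] := And3 (lt0r_neq0 s0) (lt0r_neq0 c0) (lt0r_neq0 w0).
have s2n := lt0r_neq0 s20.
have k20 : 0 < `|k| by rewrite normr_gt0.
have kk : `|k| ^+ 2 = k ^+ 2 by rewrite real_normK ?num_real.
have sk2' : s2 ^+ 2 + `|k| ^+ 2 = 1 by rewrite kk.
have T0 : 0 < T by rewrite exprn_gt0.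
have Tn := lt0r_neq0 T0.
have X1 : 1 < X.
  rewrite /X ltr_pdivlMr// mul1r -subr_gt0.
  have -> : w + w^-1 - 2 = (w - 1) ^+ 2 / w by field.
  by rewrite divr_gt0// exprn_even_gt0//= subr_eq0.
have SC : S' ^+ 2 + C' ^+ 2 = 1.
  have -> : S' ^+ 2 + C' ^+ 2 = (s ^+ 2 + c ^+ 2) * (s2 ^+ 2 + k ^+ 2) by rewrite /S' /C'; ring.
  by rewrite sc sk2 mulr1.
pose del := 4 * s * c * s2 * k.
have del2 : del ^+ 2 = (1 - x ^+ 2) * (1 - y ^+ 2).
  have -> : 1 - x ^+ 2 = 4 * s ^+ 2 * c ^+ 2.
    transitivity ((s ^+ 2 + c ^+ 2) ^+ 2 - x ^+ 2); first by rewrite sc expr1n.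
    by rewrite /x; ring.
  have -> : 1 - y ^+ 2 = 4 * s2 ^+ 2 * k ^+ 2.
    transitivity ((s2 ^+ 2 + k ^+ 2) ^+ 2 - y ^+ 2); first by rewrite sk2 expr1n.
    by rewrite /y; ring.
  by rewrite /del; ring.
pose N2 := T ^+ 2 + 2 * (x * y - del) * T + 1.
have NE : N = T ^+ 2 + 2 * (x * y + del) * T + 1 by rewrite /N /del /T; ring.
have xy' : x * y - del = C' ^+ 2 - S' ^+ 2 by rewrite /x /y /del /C' /S'; ring.
have TX : T + 1 = 2 * w * X by rewrite /T /X; field.
have N2E : N2 = 4 * T * (X - S') * (X + S').
  have -> : N2 = (T + 1) ^+ 2 - 2 * T * (1 - (x * y - del)) by rewrite /N2; ring.
  rewrite TX xy' (_ : 1 - (C' ^+ 2 - S' ^+ 2) = 2 * S' ^+ 2); last first.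
    by rewrite (_ : C' ^+ 2 = 1 - S' ^+ 2); [ring|rewrite -SC; ring].
  by rewrite /T; ring.
have bnd u v : u ^+ 2 + v ^+ 2 = 1 -> 0 < X - u /\ 0 < X + u.
  move=> uv; have u1 : `|u| <= 1.
    by rewrite -(@expr_le1 _ 2%N)// real_normK ?num_real// -uv lerDl sqr_ge0.
  by move: u1; rewrite ler_norml => /andP[u1 u2]; split; lra.
have [XS2 XS1] := bnd _ _ SC.
have XS1n := lt0r_neq0 XS1; have XS2n := lt0r_neq0 XS2.
have N20 : 0 < N2 by rewrite N2E !mulr_gt0.
pose S'' := s * s2 - c * k; pose C'' := c * s2 + s * k.
have SC2 : S'' ^+ 2 + C'' ^+ 2 = 1.
  have -> : S'' ^+ 2 + C'' ^+ 2 = (s ^+ 2 + c ^+ 2) * (s2 ^+ 2 + k ^+ 2) by rewrite /S'' /C''; ring.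
  by rewrite sc sk2 mulr1.
have N0 : 0 < N.
  have xy2 : x * y + del = C'' ^+ 2 - S'' ^+ 2 by rewrite /x /y /del /C'' /S''; ring.
  have -> : N = 4 * T * (X - S'') * (X + S'').
    have -> : N = (T + 1) ^+ 2 - 2 * T * (1 - (x * y + del)) by rewrite NE; ring.
    rewrite TX xy2 (_ : 1 - (C'' ^+ 2 - S'' ^+ 2) = 2 * S'' ^+ 2); last first.
      by rewrite (_ : C'' ^+ 2 = 1 - S'' ^+ 2); [ring|rewrite -SC2; ring].
    by rewrite /T; ring.
  by have [? ?] := bnd _ _ SC2; rewrite !mulr_gt0.
have Nn := lt0r_neq0 N0; have N2n := lt0r_neq0 N20.
pose n := 1 - T ^+ 2; pose m := 2 * (y + x * T).
have ResE : N * N2 = n ^+ 2 + 2 * x * T * m * n + T ^+ 2 * m ^+ 2.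
  have -> : N * N2 = (T ^+ 2 + 2 * x * y * T + 1) ^+ 2 - 4 * T ^+ 2 * del ^+ 2.
    by rewrite NE /N2; ring.
  by rewrite del2 /n /m; ring.
pose A1 := n * (1 + 2 * x * T) + m * T ^+ 2; pose B1 := T ^+ 2 * (m - n).
pose A2 := 2 * y * n - n - m; pose B2 := n - m.
have pf z : z * (z + 1) * (N * N2) =
    (A1 * z + B1) * (z ^+ 2 + 2 * y * z + 1) + (A2 * z + B2) * (z ^+ 2 - 2 * x * T * z + T ^+ 2).
  by rewrite ResE /A1 /B1 /A2 /B2 /n /m; ring.
pose K := 2 * s * c / pi / N2.
pose p1 := K * (A1 + B1 / T) / 2; pose q1 := K * (A1 - B1 / T) / 2.
pose p2 := K * (A2 + B2) / 2; pose q2 := K * (A2 - B2) / 2.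
have [||dG Gb] := @rat_primP R s c w p1 q1 s2 `|k| 1 p2 q2
  (fun v => 2 * s * c / pi * N * (v ^+ 2 * (v ^+ 2 + 1)) /
     (quad4 s c w v * quad4 s2 `|k| 1 v)) sc s0 c0 w0 sk2' s20 k20 ltr01.
- move=> v; have Q1n := lt0r_neq0 (quad4_gt0 v sc s0 w0).
  have Q2n := lt0r_neq0 (quad4_gt0 v sk2' s20 ltr01).
  have Q1E : quad4 s c w v = (v ^+ 2) ^+ 2 - 2 * x * T * v ^+ 2 + T ^+ 2.
    by rewrite /quad4 /x /T; ring.
  have Q2E : quad4 s2 `|k| 1 v = (v ^+ 2) ^+ 2 + 2 * y * v ^+ 2 + 1.
    by rewrite /quad4 kk /y; ring.
  have -> : p1 * (v ^+ 2 + w ^+ 2) + q1 * (v ^+ 2 - w ^+ 2) = K * (A1 * v ^+ 2 + B1).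
    by rewrite /p1 /q1 -/T; field.
  have -> : p2 * (v ^+ 2 + 1 ^+ 2) + q2 * (v ^+ 2 - 1 ^+ 2) = K * (A2 * v ^+ 2 + B2).
    by rewrite /p2 /q2; field.
  have := pf (v ^+ 2); rewrite -Q1E -Q2E.
  move: (quad4 s c w v) (quad4 s2 `|k| 1 v) Q1n Q2n {Q1E Q2E} => Q1 Q2 Q1n Q2n pfv.
  transitivity (K / (Q1 * Q2) * ((A1 * v ^+ 2 + B1) * Q2 + (A2 * v ^+ 2 + B2) * Q1)); last first.
    by field; rewrite Q1n Q2n.
  rewrite -pfv /K; move: (pi : R) pin => P Pn; field.
  by rewrite Q1n Q2n N2n Pn.
- move=> v v0; apply: divr_ge0; apply: ltW; last by rewrite mulr_gt0 ?quad4_gt0.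
  by rewrite !mulr_gt0 ?invr_gt0 ?exprn_gt0// ltr_wpDl ?sqr_ge0.
exists (rat_prim s c w p1 q1 s2 `|k| 1 p2 q2); split => // v v0.
have /andP[-> /le_trans] := Gb v v0; apply.
rewrite le_eqVlt; apply/orP; left; apply/eqP.
have P1 : A1 + B1 / T = 2 * w * X * (T * (4 * X ^+ 2 - 4 + 2 * x + 2 * y)).
  have E : 4 * X ^+ 2 * T = (T + 1) ^+ 2 by rewrite TX /T; ring.
  have -> : 2 * w * X * (T * (4 * X ^+ 2 - 4 + 2 * x + 2 * y)) =
    (T + 1) * (4 * X ^+ 2 * T - 4 * T + 2 * x * T + 2 * y * T) by rewrite TX; ring.
  by rewrite E /A1 /B1 /n /m; field.
have P2 : A2 + B2 = - 4 * T * (y * (2 * X ^+ 2 - 1) + x).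
  have E : 4 * X ^+ 2 * T = (T + 1) ^+ 2 by rewrite TX /T; ring.
  have -> : - 4 * T * (y * (2 * X ^+ 2 - 1) + x) = - 2 * y * (4 * X ^+ 2 * T) + 4 * y * T - 4 * x * T by ring.
  by rewrite E /A2 /B2 /n /m; ring.
have -> : p1 * pi / (2 * s * w) + p2 * pi / (2 * s2 * 1) =
    c * (X * (2 * X ^+ 2 - 2 + x + y) - s / s2 * (y * (2 * X ^+ 2 - 1) + x)) /
    (2 * (X - S') * (X + S')).
  rewrite /p1 /p2 P1 P2 /K N2E; move: (pi : R) pin => P Pn; field.
  by rewrite Pn XS1n XS2n Tn sn wn s2n.
have E1 : x + y - 1 - (x * y - del) = 4 * s * k * C'.
  transitivity (- (s ^+ 2 + c ^+ 2 - x) * (s2 ^+ 2 + k ^+ 2 - y) + del).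
    by rewrite sc sk2; ring.
  by rewrite /x /y /del /C'; ring.
have E2 : y * (x * y - del) - x = - 4 * s2 * k * S' * C'.
  transitivity (x * (y ^+ 2 - (s2 ^+ 2 + k ^+ 2) ^+ 2) - y * del).
    by rewrite sk2 expr1n; ring.
  transitivity (- 4 * s2 * k * (s * c * y + x * (s2 * k))); first by rewrite /x /y /del; ring.
  transitivity (- 4 * s2 * k * ((s ^+ 2 + c ^+ 2) * 0 + S' * C')); last by ring.
  by rewrite /x /y /S' /C'; ring.
have E3 : 2 * (X - S') * (X + S') = 2 * X ^+ 2 - 1 + (x * y - del).
  rewrite xy' (_ : C' ^+ 2 = 1 - S' ^+ 2); last by rewrite -SC; ring.
  by ring.
have den0 : 2 * (X - S') * (X + S') != 0 by rewrite !mulf_neq0.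
apply: (mulIf den0); rewrite divfK//.
have -> : (c * X + s * c * (2 * k * C' / (X + S') - y / s2)) * (2 * (X - S') * (X + S')) =
  c * X * (2 * (X - S') * (X + S')) + 4 * s * c * k * C' * (X - S') -
  s * c * y / s2 * (2 * (X - S') * (X + S')).
  by field; rewrite XS1n s2n.
rewrite E3.
transitivity (c * X * (2 * X ^+ 2 - 1 + (x * y - del)) + c * X * (x + y - 1 - (x * y - del))
  + s * c / s2 * (y * (x * y - del) - x) - s * c * y / s2 * (2 * X ^+ 2 - 1 + (x * y - del))).
  by ring.
by rewrite E1 E2; field.
Qed.

End Flux.
End RationalIntegrals.

Section FluxBounds.
Context {R : realType}.
Variables (s c s2 k w : R).
Hypotheses (sc : s ^+ 2 + c ^+ 2 = 1) (sk2 : s2 ^+ 2 + k ^+ 2 = 1).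
Hypotheses (s0 : 0 < s) (c0 : 0 < c) (s20 : 0 < s2) (w0 : 0 < w) (w1 : w != 1).
Let X := (w + w^-1) / 2.
Let C' := c * s2 - s * k.
Let S' := s * s2 + c * k.
Let y := s2 ^+ 2 - k ^+ 2.

Lemma chordX_gt1 : 1 < X.
Proof.
rewrite /X ltr_pdivlMr// mul1r -subr_gt0.
have -> : w + w^-1 - 2 = (w - 1) ^+ 2 / w by field; rewrite gt_eqF.
by rewrite divr_gt0// exprn_even_gt0//= subr_eq0.
Qed.

Let XS : 0 < X + S'.
Proof.
have SC : S' ^+ 2 + C' ^+ 2 = 1.
  have -> : S' ^+ 2 + C' ^+ 2 = (s ^+ 2 + c ^+ 2) * (s2 ^+ 2 + k ^+ 2) by rewrite /S' /C'; ring.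
  by rewrite sc sk2 mulr1.
have u1 : `|S'| <= 1.
  by rewrite -(@expr_le1 _ 2%N)// real_normK ?num_real// -SC lerDl sqr_ge0.
by have := chordX_gt1; move: u1; rewrite ler_norml => /andP[u1 u2]; lra.
Qed.

Lemma flux_le_far : k < 0 ->
  c * X + s * c * (2 * k * C' / (X + S') - y / s2) <= c * X - s * c * y / s2.
Proof.
move=> k0; have C'0 : 0 < C' by rewrite /C' subr_gt0 (@lt_trans _ _ 0)// ?mulr_gt0// nmulr_llt0.
have : s * c * (2 * k * C' / (X + S')) <= 0.
  rewrite mulr_ge0_le0 ?mulr_ge0 ?ltW//.
  by rewrite pmulr_llt0 ?invr_gt0// pmulr_llt0// pmulr_rlt0.
by rewrite mulrBr -[s * c * y / s2]mulrA; lra.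
Qed.

Lemma flux_le_near : 0 < k -> 0 <= s * s2 - c * k ->
  c * X + s * c * (2 * k * C' / (X + S') - y / s2) <=
  c * X + Num.max 0 (- (s * c * y / s2)).
Proof.
move=> k0 S''0; rewrite lerD2l le_max.
have sc0 : 0 < s * c by rewrite mulr_gt0.
have [C'0|C'0] := leP C' 0.
  apply/orP; right; rewrite mulrBr -[s * c * y / s2]mulrA.
  have : s * c * (2 * k * C' / (X + S')) <= 0.
    rewrite mulr_ge0_le0 ?(ltW sc0)// mulr_le0_ge0 ?invr_ge0 ?(ltW XS)//.
    by rewrite mulr_ge0_le0// mulr_ge0// ltW.
  by lra.
apply/orP; left; rewrite pmulr_rle0// subr_le0 ler_pdivrMr//.
rewrite [leRHS]mulrAC ler_pdivlMr//.
have y0 : 0 < y.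
  have -> : y = C' * (c * s2 + s * k) + (s * s2 + c * k) * (s * s2 - c * k).
    transitivity ((s ^+ 2 + c ^+ 2) * y); first by rewrite sc mul1r.
    by rewrite /y /C'; ring.
  rewrite ltr_wpDr// ?mulr_ge0// ?mulr_gt0// ?addr_gt0 ?mulr_gt0//.
  by rewrite ltW// addr_gt0 ?mulr_gt0.
have -> : 2 * k * C' * s2 = y * S' - (s * s2 - c * k).
  transitivity (y * S' - (s2 ^+ 2 + k ^+ 2) * (s * s2 - c * k)).
    by rewrite /y /S' /C'; ring.
  by rewrite sk2 mul1r.
have yX : 0 < y * X by rewrite mulr_gt0// (lt_trans ltr01)// chordX_gt1.
by rewrite (mulrDr y X S') [leLHS]addrC lerD2r (le_trans _ (ltW yX))// oppr_le0.
Qed.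

End FluxBounds.

Section MeasurableKernel.
Context {R : realType}.
Local Notation plane := (R * R)%type.

Lemma measurable_fun_ge0_inv d (T : measurableType d) (D : set T) (f : T -> R) :
  (forall x, 0 <= f x) -> measurable_fun D f -> measurable_fun D (fun x => (f x)^-1).
Proof.
move=> f0 mf.
have -> : (fun x => (f x)^-1) = (fun x => (f x) `^ (-1)).
  by apply/funext => x; rewrite powR_inv1.
by apply: (measurableT_comp (measurable_powR (-1))).
Qed.

Lemma measurable_sqrt : measurable_fun [set: R] (@Num.sqrt R).
Proof. by apply: continuous_measurable_fun; exact: sqrt_continuous. Qed.

Lemma measurable_edist2 :
  measurable_fun [set: plane * plane] (fun z => edist z.1 z.2).
Proof.
apply: (measurableT_comp measurable_sqrt).
have m1 : measurable_fun [set: plane * plane] (fun z => z.1.1 : R).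
  exact: (measurableT_comp measurable_fst measurable_fst).
have m2 : measurable_fun [set: plane * plane] (fun z => z.1.2 : R).
  exact: (measurableT_comp measurable_snd measurable_fst).
have m3 : measurable_fun [set: plane * plane] (fun z => z.2.1 : R).
  exact: (measurableT_comp measurable_fst measurable_snd).
have m4 : measurable_fun [set: plane * plane] (fun z => z.2.2 : R).
  exact: (measurableT_comp measurable_snd measurable_snd).
by apply: measurable_funD; apply: measurable_funX; apply: measurable_funB.
Qed.

Definition pker (D : disk R) (x y : plane) : R := (2 * pi)^-1 * poisson_kernel D x y.

Lemma pker_ge0 D x y : open_disk D x -> 0 <= pker D x y.
Proof.
have r0 := radius_gt0 D; move=> xD; apply: mulr_ge0.
  by rewrite invr_ge0 mulr_ge0// pi_ge0.
apply: divr_ge0; last by rewrite mulr_ge0 ?sqr_ge0 ?(ltW r0).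
by rewrite subr_ge0 ler_pXn2r ?nnegrE ?edist_ge0 ?(ltW r0)// ltW.
Qed.

Lemma measurable_pker D : measurable_fun [set: plane * plane] (fun z => pker D z.1 z.2).
Proof.
apply: measurable_funM => //; apply: measurable_funM.
  apply: measurable_funB => //; apply: measurable_funX.
  exact: (measurableT_comp (measurable_edist (center D)) measurable_fst).
apply: measurable_fun_ge0_inv.
  by move=> z; rewrite mulr_ge0 ?sqr_ge0// ltW// radius_gt0.
by apply: measurable_funM => //; apply: measurable_funX; exact: measurable_edist2.
Qed.

Definition chordX (o e : plane) (h : R) (x : plane) : R :=
  let a := edist x (o.1 - h * e.2, o.2 + h * e.1) in
  let b := edist x (o.1 + h * e.2, o.2 - h * e.1) in
  (a + b) / (2 * Num.sqrt (a * b)).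

Lemma chordX_ge0 o e h x : 0 <= chordX o e h x.
Proof. by rewrite /chordX divr_ge0 ?addr_ge0 ?mulr_ge0 ?edist_ge0 ?sqrtr_ge0. Qed.

Lemma measurable_chordX o e h : measurable_fun [set: plane] (chordX o e h).
Proof.
have md := @measurable_edist R.
apply: measurable_funM; first by apply: measurable_funD; exact: md.
apply: measurable_fun_ge0_inv; first by move=> z; rewrite mulr_ge0 ?sqrtr_ge0.
apply: measurable_funM => //; apply: (measurableT_comp measurable_sqrt).
by apply: measurable_funM; exact: md.
Qed.

Lemma chordXN o e h : chordX o (- e) h = chordX o e h.
Proof.
apply/funext => x; rewrite /chordX /= !mulrN !opprK.
by rewrite addrC [edist _ _ * _]mulrC.
Qed.

End MeasurableKernel.

Section BipolarGeometry.
Context {R : realType}.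
Local Notation plane := (R * R)%type.
Implicit Types (o e : plane) (h eta zeta v t : R).

Lemma edist_frame o e (X Y X' Y' : R) : e.1 ^+ 2 + e.2 ^+ 2 = 1 ->
  edist (o.1 + X * e.1 - Y * e.2, o.2 + X * e.2 + Y * e.1)
        (o.1 + X' * e.1 - Y' * e.2, o.2 + X' * e.2 + Y' * e.1) ^+ 2 =
  (X - X') ^+ 2 + (Y - Y') ^+ 2.
Proof.
move=> e1; rewrite edist_sqr /=.
transitivity (((X - X') ^+ 2 + (Y - Y') ^+ 2) * (e.1 ^+ 2 + e.2 ^+ 2)); first by ring.
by rewrite e1 mulr1.
Qed.

Lemma edist_bpt o e h eta zeta v t : e.1 ^+ 2 + e.2 ^+ 2 = 1 ->
  bden eta v != 0 -> bden zeta t != 0 ->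
  edist (bpt o e h eta v) (bpt o e h zeta t) ^+ 2 =
  4 * h ^+ 2 * (v ^+ 4 - 2 * cos (eta - zeta) * v ^+ 2 * t ^+ 2 + t ^+ 4) /
  (bden eta v * bden zeta t).
Proof.
move=> e1 n1 n2; rewrite /bpt edist_frame//.
have s1 := sin2cos2 eta; have s2 := sin2cos2 zeta; rewrite cosB.
move: n1 n2; rewrite /bden.
move: (cos eta) (sin eta) (cos zeta) (sin zeta) s1 s2 => C S C' S' s1 s2.
set N := v ^+ 4 - _ + 1; set N' := t ^+ 4 - _ + 1 => n1 n2.
transitivity (h ^+ 2 * ((4 * S ^+ 2 * v ^+ 4 + (v ^+ 4 - 1) ^+ 2) * N' ^+ 2
  + (4 * S' ^+ 2 * t ^+ 4 + (t ^+ 4 - 1) ^+ 2) * N ^+ 2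
  - 2 * (4 * S * S' * v ^+ 2 * t ^+ 2 + (v ^+ 4 - 1) * (t ^+ 4 - 1)) * N * N') / (N * N') ^+ 2).
  by field; rewrite n1 n2.
rewrite s1 s2 (_ : 4 * (1 - C ^+ 2) * v ^+ 4 + (v ^+ 4 - 1) ^+ 2 = N * (v ^+ 4 + 2 * C * v ^+ 2 + 1)); last by rewrite /N; ring.
rewrite (_ : 4 * (1 - C' ^+ 2) * t ^+ 4 + (t ^+ 4 - 1) ^+ 2 = N' * (t ^+ 4 + 2 * C' * t ^+ 2 + 1)); last by rewrite /N'; ring.
transitivity (h ^+ 2 * ((v ^+ 4 + 2 * C * v ^+ 2 + 1) * N' + (t ^+ 4 + 2 * C' * t ^+ 2 + 1) * N
  - 2 * (4 * S * S' * v ^+ 2 * t ^+ 2 + (v ^+ 4 - 1) * (t ^+ 4 - 1))) / (N * N')).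
  by field; rewrite n1 n2.
by congr (_ / _); rewrite /N /N'; ring.
Qed.

Lemma bptN o e h eta t : 0 < t ->
  bpt o (- e) h eta t = bpt o e h (- eta) t^-1.
Proof.
move=> t0; have tn := lt0r_neq0 t0.
have H : bden (- eta) t^-1 = bden eta t / t ^+ 4 by rewrite /bden cosN; field.
rewrite /bpt H sinN /=.
have [->|n] := eqVneq (bden eta t) 0; first by rewrite mul0r invr0 !mulr0 !mul0r !subr0 !addr0.
by congr pair; field; rewrite n tn.
Qed.

End BipolarGeometry.

Section KernelFormula.
Context {R : realType}.
Local Notation plane := (R * R)%type.
Variables (D : disk R) (o e : plane) (h chi : R).
Hypothesis fr : arc_frame D o e h chi.
Local Notation r := (radius D).
Let r0 : 0 < r := radius_gt0 D.
Let rn : r != 0. Proof. by rewrite gt_eqF. Qed.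
Let e1 : e.1 ^+ 2 + e.2 ^+ 2 = 1. Proof. by case: fr. Qed.
Let s0 : 0 < sin chi. Proof. by case: fr => _ /sin_gt0_pi. Qed.
Let hE : h = r * sin chi. Proof. by case: fr. Qed.
Let h0 : 0 < h. Proof. by rewrite hE mulr_gt0. Qed.
Let cE : center D = (o.1 + (r * cos chi) * e.1 - 0 * e.2, o.2 + (r * cos chi) * e.2 + 0 * e.1).
Proof. by case: fr => _ _ _ ->; rewrite !mul0r subr0 addr0. Qed.

Lemma arc_frameN : arc_frame D o (- e) h (pi - chi).
Proof.
case: fr => _ /andP[chi0 chipi] _ cD; split.
- by rewrite /= !sqrrN.
- by rewrite subr_gt0 chipi gtrBl.
- by rewrite hE sinB sinpi cospi; ring.
- by rewrite cD cosB sinpi cospi /=; congr pair; ring.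
Qed.

Lemma power_bpt zeta v : bden zeta v != 0 ->
  r ^+ 2 - edist (bpt o e h zeta v) (center D) ^+ 2 =
  4 * h ^+ 2 * v ^+ 2 * sin (zeta - chi) / (sin chi * bden zeta v).
Proof.
move=> n; rewrite cE /bpt edist_frame// sinB hE.
have sn : sin chi != 0 by rewrite gt_eqF.
have q1 := cos2sin2 chi; have q2 := sin2cos2 zeta.
move: n; rewrite /bden.
move: (cos chi) (sin chi) (cos zeta) (sin zeta) q1 q2 sn => C S Cz Sz q1 q2 sn.
set N := v ^+ 4 - _ + 1 => n.
have E : 4 * Sz ^+ 2 * v ^+ 4 + (v ^+ 4 - 1) ^+ 2 = N * (v ^+ 4 + 2 * Cz * v ^+ 2 + 1).
  by rewrite q2 /N; ring.
transitivity (r ^+ 2 * (1 - C ^+ 2) - r ^+ 2 * S ^+ 2 *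
   (4 * Sz ^+ 2 * v ^+ 4 + (v ^+ 4 - 1) ^+ 2) / N ^+ 2 + 4 * r ^+ 2 * S * C * Sz * v ^+ 2 / N).
  by field.
rewrite E q1 (_ : 1 - (1 - S ^+ 2) = S ^+ 2); last by ring.
transitivity (r ^+ 2 * S ^+ 2 * (N - (v ^+ 4 + 2 * Cz * v ^+ 2 + 1)) / N
   + 4 * r ^+ 2 * S * C * Sz * v ^+ 2 / N); first by field.
rewrite (_ : N - (v ^+ 4 + 2 * Cz * v ^+ 2 + 1) = - 4 * Cz * v ^+ 2); last by rewrite /N; ring.
by field; rewrite n sn.
Qed.

Lemma pker_bpt zeta v eta t : bden zeta v != 0 -> bden eta t != 0 ->
  v ^+ 4 - 2 * cos (zeta - eta) * v ^+ 2 * t ^+ 2 + t ^+ 4 != 0 ->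
  pker D (bpt o e h zeta v) (bpt o e h eta t) =
  v ^+ 2 * sin (zeta - chi) * bden eta t /
  (2 * pi * h * (v ^+ 4 - 2 * cos (zeta - eta) * v ^+ 2 * t ^+ 2 + t ^+ 4)).
Proof.
move=> n1 n2; rewrite /pker /poisson_kernel power_bpt// edist_bpt//.
have sn : sin chi != 0 by rewrite gt_eqF.
have pin : (pi : R) != 0 by rewrite gt_eqF ?pi_gt0.
set Q := v ^+ 4 - _ + _ => Qn.
rewrite hE; move: (bden zeta v) (bden eta t) (pi : R) pin n1 n2 => N1 N2 P Pn n1 n2.
by field; do ?[apply/andP; split].
Qed.

Lemma pker_bptN zeta v eta t : 0 < t -> bden zeta v != 0 -> bden eta t != 0 ->
  v ^+ 4 * t ^+ 4 - 2 * cos (zeta + eta) * v ^+ 2 * t ^+ 2 + 1 != 0 ->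
  pker D (bpt o e h zeta v) (bpt o (- e) h eta t) =
  v ^+ 2 * sin (zeta - chi) * bden eta t /
  (2 * pi * h * (v ^+ 4 * t ^+ 4 - 2 * cos (zeta + eta) * v ^+ 2 * t ^+ 2 + 1)).
Proof.
move=> t0 n1 n2; rewrite bptN//.
have tn := lt0r_neq0 t0.
have H : bden (- eta) t^-1 = bden eta t / t ^+ 4 by rewrite /bden cosN; field.
set Q := v ^+ 4 * _ - _ + _ => Qn.
have QE : v ^+ 4 - 2 * cos (zeta - - eta) * v ^+ 2 * t^-1 ^+ 2 + t^-1 ^+ 4 = Q / t ^+ 4.
  by rewrite /Q opprK; field.
have n4 : t ^+ 4 != 0 by rewrite expf_neq0.
rewrite pker_bpt// ?QE ?H ?mulf_neq0 ?invr_eq0//.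
have hn := lt0r_neq0 h0; have pin : (pi : R) != 0 by rewrite gt_eqF ?pi_gt0.
by move: (bden eta t) (pi : R) pin => N P Pn; field; do ?[apply/andP; split].
Qed.

End KernelFormula.

Section ChordBpt.
Context {R : realType}.
Local Notation plane := (R * R)%type.

Lemma chordX_bpt (o e : plane) (h eta v : R) : e.1 ^+ 2 + e.2 ^+ 2 = 1 -> 0 < h ->
  0 < eta < pi -> 0 < v -> chordX o e h (bpt o e h eta v) = (v + v^-1) / 2.
Proof.
move=> e1 h0 eI v0; have N0 := bden_gt0 v eI; have n := lt0r_neq0 N0.
have vn := lt0r_neq0 v0.
rewrite /chordX.
set X := 2 * h * sin eta * v ^+ 2 / bden eta v; set Y := h * (v ^+ 4 - 1) / bden eta v.
have pE : bpt o e h eta v = (o.1 + X * e.1 - Y * e.2, o.2 + X * e.2 + Y * e.1) by [].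
have XY : X ^+ 2 + Y ^+ 2 = h ^+ 2 * (v ^+ 4 + 2 * cos eta * v ^+ 2 + 1) / bden eta v.
  have E : 4 * sin eta ^+ 2 * v ^+ 4 + (v ^+ 4 - 1) ^+ 2 =
     bden eta v * (v ^+ 4 + 2 * cos eta * v ^+ 2 + 1) by rewrite sin2cos2 /bden; ring.
  transitivity (h ^+ 2 * (4 * sin eta ^+ 2 * v ^+ 4 + (v ^+ 4 - 1) ^+ 2) / bden eta v ^+ 2).
    by rewrite /X /Y; move: (bden eta v) n => N n; field.
  by rewrite E; move: (bden eta v) n => N n; field.
set a := edist _ _; set b := edist _ _.
have a2 : a ^+ 2 = 4 * h ^+ 2 / bden eta v.
  rewrite /a pE (_ : (o.1 - h * e.2, o.2 + h * e.1) = (o.1 + 0 * e.1 - h * e.2, o.2 + 0 * e.2 + h * e.1) :> plane); last first.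
    by rewrite !mul0r !addr0.
  rewrite edist_frame// subr0.
  rewrite (_ : X ^+ 2 + (Y - h) ^+ 2 = (X ^+ 2 + Y ^+ 2) - 2 * h * Y + h ^+ 2); last by ring.
  rewrite XY /Y (_ : v ^+ 4 + 2 * cos eta * v ^+ 2 + 1 = 2 * (v ^+ 4 + 1) - bden eta v); last by rewrite /bden; ring.
  by move: (bden eta v) n => N n; field.
have b2 : b ^+ 2 = 4 * h ^+ 2 * v ^+ 4 / bden eta v.
  rewrite /b pE (_ : (o.1 + h * e.2, o.2 - h * e.1) = (o.1 + 0 * e.1 - (- h) * e.2, o.2 + 0 * e.2 + (- h) * e.1) :> plane); last first.
    by rewrite !mul0r !addr0 !mulNr opprK.
  rewrite edist_frame// subr0.
  rewrite (_ : X ^+ 2 + (Y - - h) ^+ 2 = (X ^+ 2 + Y ^+ 2) + 2 * h * Y + h ^+ 2); last by ring.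
  rewrite XY /Y (_ : v ^+ 4 + 2 * cos eta * v ^+ 2 + 1 = 2 * (v ^+ 4 + 1) - bden eta v); last by rewrite /bden; ring.
  by move: (bden eta v) n => N n; field.
have a0 : 0 < a.
  rewrite lt_neqAle edist_ge0 andbT; apply/eqP => a0; move: a2; rewrite -a0 expr0n/=.
  by apply/eqP; rewrite lt_eqF// divr_gt0// mulr_gt0// exprn_gt0.
have -> : b = a * v ^+ 2.
  apply/eqP; rewrite -(@eqrXn2 _ 2%N) ?edist_ge0 ?mulr_ge0 ?(ltW a0) ?(ltW v0)//.
  by rewrite b2 exprMn a2 -exprM mulrAC.
rewrite (_ : Num.sqrt _ = a * v); last first.
  rewrite (_ : a * (a * v ^+ 2) = (a * v) ^+ 2); last by ring.
  by rewrite sqrtr_sqr gtr0_norm// mulr_gt0.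
by field; rewrite vn gt_eqF.
Qed.

End ChordBpt.

Section LensDef.
Context {R : realType}.
Local Notation plane := (R * R)%type.

Definition lens (D D' : disk R) (o e : plane) (h chi psi : R) :=
  [/\ arc_frame D o e h chi, arc_frame D' o (- e) h psi & chi + psi < pi].

Definition ext_open (D D' : disk R) : set plane := circle D `\` closed_disk D'.

Definition dotc (D : disk R) (e x : plane) :=
  (x.1 - (center D).1) * e.1 + (x.2 - (center D).2) * e.2.

Lemma int_arc_disk (D D' : disk R) x : int_arc D D' x -> open_disk D' x.
Proof. by rewrite int_arcE => -[]. Qed.

Lemma ext_openNint (D D' : disk R) x : ext_open D D' x -> ~ int_arc D D' x.
Proof. by rewrite int_arcE => -[_ xD] [_ /ltW]. Qed.

Lemma lensC D D' o e h chi psi : lens D D' o e h chi psi -> lens D' D o (- e) h psi chi.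
Proof. by move=> [f f' hs]; split; rewrite ?opprK// addrC. Qed.

Lemma measurable_int_arc (D D' : disk R) : measurable (int_arc D D').
Proof.
rewrite int_arcE; apply: measurableI; first exact: measurable_circle.
rewrite -[X in measurable X]setTI.
apply: (measurable_edist (center D') measurableT (_ : measurable `]-oo, radius D'[%classic)).
exact: measurable_itv.
Qed.

Lemma measurable_ext_open (D D' : disk R) : measurable (ext_open D D').
Proof.
apply: measurableD; first exact: measurable_circle.
rewrite -[X in measurable X]setTI.
apply: (measurable_edist (center D') measurableT (_ : measurable `]-oo, radius D']%classic)).
exact: measurable_itv.
Qed.

End LensDef.

Section Lens.
Context {R : realType}.
Local Notation plane := (R * R)%type.
Variables (D D' : disk R) (o e : plane) (h chi psi : R).
Hypothesis ls : lens D D' o e h chi psi.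
Local Notation r := (radius D).
Local Notation r' := (radius D').
Local Notation theta := (chi + psi).
Local Notation X := (chordX o e h).
Let frD : arc_frame D o e h chi. Proof. by case: ls. Qed.
Let frD' : arc_frame D' o (- e) h psi. Proof. by case: ls. Qed.
Let frD'i : arc_frame D' o e h (pi - psi).
Proof. by have := arc_frameN frD'; rewrite opprK. Qed.
Let e1 : e.1 ^+ 2 + e.2 ^+ 2 = 1. Proof. by case: frD. Qed.
Let cI : 0 < chi < pi. Proof. by case: frD. Qed.
Let pI : 0 < psi < pi. Proof. by case: frD'. Qed.
Let piI : 0 < pi - psi < pi. Proof. by case: frD'i. Qed.
Let ciI : 0 < pi - chi < pi. Proof. by case: (arc_frameN frD). Qed.
Let hr : h = r * sin chi. Proof. by case: frD. Qed.
Let hr' : h = r' * sin psi. Proof. by case: frD'. Qed.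
Let h0 : 0 < h. Proof. by rewrite hr mulr_gt0 ?radius_gt0// sin_gt0_pi. Qed.

Let s := sin (theta / 2).
Let c := cos (theta / 2).

Lemma lens_half : [/\ 0 < s, 0 < c & s ^+ 2 + c ^+ 2 = 1].
Proof.
have [_ _ hs] := ls; have := cI; have := pI; move=> /andP[p0 _] /andP[c0 _].
split; last by rewrite addrC cos2Dsin2.
  by apply: sin_gt0_pi; apply/andP; split; lra.
by apply: cos_gt0_pihalf; apply/andP; split; lra.
Qed.

Let dist_centers := r' * cos psi + r * cos chi.

Let dist_centers_gt0 : 0 < dist_centers.
Proof.
have [_ _ hs] := ls.
have sc0 : 0 < sin chi by exact: sin_gt0_pi.
have sp0 : 0 < sin psi by exact: sin_gt0_pi.
have : 0 < h * sin theta.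
  rewrite mulr_gt0// sin_gt0_pi// hs andbT.
  by have := cI; have := pI; move=> /andP[p0 _] /andP[c0 _]; rewrite addr_gt0.
have -> : h * sin theta = sin psi * sin chi * dist_centers.
  by rewrite sinD mulrDr {1}hr' {1}hr /dist_centers; ring.
by rewrite pmulr_rgt0// mulr_gt0.
Qed.

Lemma lens_power x : circle D' x ->
  edist x (center D) ^+ 2 - r ^+ 2 =
  2 * dist_centers * (r' * cos psi - dotc D' e x).
Proof.
rewrite circleE /= => xD'.
have : edist x (center D') ^+ 2 = r' ^+ 2 by rewrite xD'.
rewrite !edist_sqr /dotc.
have [_ _ _ cD] := frD; have [_ _ _ cD'] := frD'.
have E : r ^+ 2 - (r * cos chi) ^+ 2 = r' ^+ 2 - (r' * cos psi) ^+ 2.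
  transitivity (h ^+ 2); first by rewrite hr !exprMn cos2sin2; ring.
  by rewrite hr' !exprMn cos2sin2; ring.
move=> H.
set u1 := x.1 - (center D').1 in H *; set u2 := x.2 - (center D').2 in H *.
transitivity (u1 ^+ 2 + u2 ^+ 2 - 2 * dist_centers * (u1 * e.1 + u2 * e.2) +
   dist_centers ^+ 2 * (e.1 ^+ 2 + e.2 ^+ 2) - r ^+ 2).
  by rewrite /u1 /u2 cD cD' /dist_centers /=; ring.
rewrite H e1 (_ : r ^+ 2 = r' ^+ 2 - (r' * cos psi) ^+ 2 + (r * cos chi) ^+ 2); last first.
  by rewrite -E; ring.
by rewrite /dist_centers; ring.
Qed.

Lemma lens_corner x : circle D' x -> edist x (center D) = r -> dotc D' e x = r' * cos psi.
Proof.
move=> /lens_power E xr; move: E; rewrite xr subrr => /esym/eqP.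
by rewrite mulf_eq0 gt_eqF ?mulr_gt0//= subr_eq0 => /eqP.
Qed.

Let arcdom_itv (E : disk R) (eta sg : R) : 0 < eta < pi -> arcdom E sg ->
  - cos eta < cos (sg / radius E) ->
  sg \in `](- ((pi - eta) * radius E)), ((pi - eta) * radius E)[.
Proof.
move=> /andP[eta0 etapi] + hc; have r0 := radius_gt0 E.
rewrite /arcdom/= !in_itv/= => /andP[s1 s2].
set u := sg / radius E in hc.
have sE : sg = u * radius E by rewrite /u divfK// gt_eqF.
move: s1 s2; rewrite sE -!mulNr !(ler_pM2r r0, ltr_pM2r r0) => s1 s2.
rewrite -ltr_norml; have u1 : `|u| <= pi by rewrite ler_norml s1 ltW.
have : cos (pi - eta) < cos `|u|.
  by rewrite cos_norm cosB cospi sinpi mulN1r mul0r addr0.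
by rewrite ltr_cos ?in_itv/= ?normr_ge0 ?u1//; apply/andP; split; lra.
Qed.

Let dot_arcpt (E : disk R) (f : plane) sg : f.1 ^+ 2 + f.2 ^+ 2 = 1 ->
  dotc E f (arcpt E f sg) = radius E * cos (sg / radius E).
Proof.
move=> f1; rewrite /dotc /arcpt /=.
transitivity (radius E * cos (sg / radius E) * (f.1 ^+ 2 + f.2 ^+ 2)); first by ring.
by rewrite f1 mulr1.
Qed.

Let r'0 : 0 < r' := radius_gt0 D'.
Let r0 : 0 < r := radius_gt0 D.
Let e1N : (- e).1 ^+ 2 + (- e).2 ^+ 2 = 1. Proof. by rewrite /= !sqrrN. Qed.

Lemma int_arc_itv sg : arcdom D' sg -> int_arc D' D (arcpt D' e sg) ->
  sg \in `](- ((pi - (pi - psi)) * r')), ((pi - (pi - psi)) * r')[.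
Proof.
move=> sD; rewrite int_arcE => -[xD' xD]; apply: arcdom_itv => //.
have := lens_power xD'; rewrite (dot_arcpt _ _ e1) => E.
have : edist (arcpt D' e sg) (center D) ^+ 2 - r ^+ 2 < 0.
  by rewrite subr_lt0 ltr_pXn2r ?nnegrE ?edist_ge0 ?(ltW r0).
rewrite E pmulr_rlt0 ?mulr_gt0// subr_lt0 ltr_pM2l// => h1.
by rewrite cosB cospi sinpi mulN1r mul0r addr0 opprK.
Qed.

Lemma ext_open_itv sg : arcdom D' sg -> ext_open D' D (arcpt D' (- e) sg) ->
  sg \in `](- ((pi - psi) * r')), ((pi - psi) * r')[.
Proof.
move=> sD [xD' /negP]; rewrite -ltNge => xD; apply: arcdom_itv => //.
have := lens_power xD'; have := dot_arcpt D' sg e1N.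
rewrite (_ : dotc D' (- e) _ = - dotc D' e (arcpt D' (- e) sg)); last first.
  by rewrite /dotc /= !mulrN -opprD.
move=> /eqP; rewrite eqr_oppLR => /eqP -> E.
have : 0 < edist (arcpt D' (- e) sg) (center D) ^+ 2 - r ^+ 2.
  by rewrite subr_gt0 ltr_pXn2r ?nnegrE ?edist_ge0 ?(ltW r0).
rewrite E pmulr_rgt0 ?mulr_gt0// opprK -mulrDr pmulr_rgt0// => h1.
by lra.
Qed.

Lemma int_arc_bpt x : int_arc D' D x -> exists2 v, 0 < v & x = bpt o e h (pi - psi) v.
Proof.
move=> xI; have xD' : circle D' x by case: xI.
have [sg sD sx] := arcpt_surj e1 xD'.
have sI := int_arc_itv sD (_ : int_arc D' D (arcpt D' e sg)).
exists (arcv D' (pi - psi) sg).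
  by apply: (arcv_gt0 frD'i); apply: sI; rewrite sx.
by rewrite -sx (arcpt_bpt frD'i)//; apply: sI; rewrite sx.
Qed.

Lemma ext_open_bpt x : ext_open D' D x -> exists2 v, 0 < v & x = bpt o (- e) h psi v.
Proof.
move=> xI; have xD' : circle D' x by case: xI.
have [sg sD sx] := arcpt_surj e1N xD'.
have sI := ext_open_itv sD (_ : ext_open D' D (arcpt D' (- e) sg)).
exists (arcv D' psi sg).
  by apply: (arcv_gt0 frD'); apply: sI; rewrite sx.
by rewrite -sx (arcpt_bpt frD')//; apply: sI; rewrite sx.
Qed.


End Lens.

Section LensIntegrals.
Context {R : realType}.
Local Notation plane := (R * R)%type.
Variables (D D' : disk R) (o e : plane) (h chi psi : R).
Hypothesis ls : lens D D' o e h chi psi.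
Local Notation r := (radius D).
Local Notation r' := (radius D').
Local Notation theta := (chi + psi).
Local Notation X := (chordX o e h).
Let frD : arc_frame D o e h chi. Proof. by case: ls. Qed.
Let frD' : arc_frame D' o (- e) h psi. Proof. by case: ls. Qed.
Let frD'i : arc_frame D' o e h (pi - psi).
Proof. by have := arc_frameN frD'; rewrite opprK. Qed.
Let frDi : arc_frame D o (- e) h (pi - chi). Proof. exact: arc_frameN. Qed.
Let e1 : e.1 ^+ 2 + e.2 ^+ 2 = 1. Proof. by case: frD. Qed.
Let e1N : (- e).1 ^+ 2 + (- e).2 ^+ 2 = 1. Proof. by rewrite /= !sqrrN. Qed.
Let cI : 0 < chi < pi. Proof. by case: frD. Qed.
Let pI : 0 < psi < pi. Proof. by case: frD'. Qed.
Let piI : 0 < pi - psi < pi. Proof. by case: frD'i. Qed.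
Let ciI : 0 < pi - chi < pi. Proof. by case: frDi. Qed.
Let r0 : 0 < r := radius_gt0 D.
Let h0 : 0 < h.
Proof. by case: frD => _ cI' -> _; rewrite mulr_gt0// sin_gt0_pi. Qed.
Let pin : (pi : R) != 0. Proof. by rewrite gt_eqF ?pi_gt0. Qed.
Let hn : h != 0. Proof. by rewrite gt_eqF. Qed.

Let s := sin (theta / 2).
Let c := cos (theta / 2).

Let psi_half : [/\ 0 < cos (psi / 2), 0 < sin (psi / 2) &
  cos (psi / 2) ^+ 2 + sin (psi / 2) ^+ 2 = 1].
Proof.
have := pI; move=> /andP[p0 p1].
split; last by rewrite cos2Dsin2.
  by apply: cos_gt0_pihalf; apply/andP; split; lra.
by apply: sin_gt0_pi; apply/andP; split; lra.
Qed.

Let sin_double (x : R) : sin x = 2 * sin (x / 2) * cos (x / 2).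
Proof. by rewrite {1}(_ : x = x / 2 + x / 2) ?sinD; [ring|field]. Qed.

Let cos_double (x : R) : cos x = cos (x / 2) ^+ 2 - sin (x / 2) ^+ 2.
Proof. by rewrite {1}(_ : x = x / 2 + x / 2) ?cosD; [ring|field]. Qed.

Let quad_cont (A B C v : R) :
  {for v, continuous (fun v : R => A * v ^+ 4 - B * v ^+ 2 + C)}.
Proof.
apply: (@is_derive_continuous _ _ _ (4 * A * v ^+ 3 - 2 * B * v)).
by apply: is_derive_eq; rewrite /GRing.scale/=; ring.
Qed.

Let integrand_cont (k B : R) (N Q : R -> R) (v : R) : v != 0 -> B * Q v != 0 ->
  {for v, continuous N} -> {for v, continuous Q} ->
  {for v, continuous (fun v : R => k * N v / (B * Q v) * ((v + v^-1) / 2))}.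
Proof.
move=> v0 q0 cN cQ.
apply: (@cvgM _ _ _ _ (fun v => k * N v / (B * Q v)) (fun v => (v + v^-1) / 2)).
  apply: (@cvgM _ _ _ _ (fun v => k * N v) (fun v => (B * Q v)^-1)).
    by apply: cvgM; [exact: cvg_cst|exact: cN].
  by apply: cvgV => //; apply: cvgM; [exact: cvg_cst|exact: cQ].
apply: cvgM; last exact: cvg_cst.
by apply: cvgD; [exact: cvg_id|apply: cvgV => //; exact: cvg_id].
Qed.

Let sin_lens : sin (pi - psi - chi) = 2 * s * c.
Proof.
rewrite (_ : pi - psi - chi = pi - theta); last by ring.
by rewrite sinB sinpi cospi mul0r sub0r mulN1r opprK sin_double.
Qed.

Let cos_lens : cos (pi - psi - chi) = s ^+ 2 - c ^+ 2.
Proof.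
rewrite (_ : pi - psi - chi = pi - theta); last by ring.
by rewrite cosB sinpi cospi mul0r addr0 mulN1r cos_double opprB.
Qed.

Let X_bpt eta v : 0 < eta < pi -> 0 < v -> X (bpt o e h eta v) = (v + v^-1) / 2.
Proof. exact: chordX_bpt. Qed.

Let X_bptN eta v : 0 < eta < pi -> 0 < v -> X (bpt o (- e) h eta v) = (v + v^-1) / 2.
Proof. by move=> eI v0; rewrite -chordXN; apply: chordX_bpt. Qed.

Let X_ge0 x := chordX_ge0 o e h x.

Let measurable_pker1 y (A : set plane) :
  measurable_fun A (fun x => pker D x y * X x).
Proof.
apply: (@measurable_funS _ _ _ _ setT) => //.
apply: measurable_funM; last exact: measurable_chordX.
exact: (measurable_fun_pair1 y (measurable_pker D)).
Qed.

Let measurable_pker2 x (A : set plane) :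
  measurable_fun A (fun y => pker D x y * X y).
Proof.
apply: (@measurable_funS _ _ _ _ setT) => //.
apply: measurable_funM; last exact: measurable_chordX.
exact: (measurable_fun_pair2 x (measurable_pker D)).
Qed.

Lemma potential_ext x : int_arc D' D x ->
  (\int[arclen D e]_(y in ext_open D D') (pker D x y * X y)%:E <= (s * X x)%:E)%E.
Proof.
move=> xI; have [v v0 xE] := int_arc_bpt ls xI.
have xD : open_disk D x by move: xI; rewrite int_arcE => -[].
have [s0 c0 sc] := lens_half ls; have cs : c ^+ 2 + s ^+ 2 = 1 by rewrite addrC.
have nx := lt0r_neq0 (bden_gt0 v piI); have vn := lt0r_neq0 v0.
rewrite {2}xE X_bpt//.
have [G [dG Gb]] := prim_potential cs c0 s0 v0.
pose Q t := v ^+ 4 - 2 * cos (pi - psi - chi) * v ^+ 2 * t ^+ 2 + t ^+ 4.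
have QE t : Q t = quad4 c s v t by rewrite /Q cos_lens /quad4; ring.
have Q0 t : 0 < Q t by rewrite QE quad4_gt0.
pose f t := v ^+ 2 * sin (pi - psi - chi) * bden chi t / (2 * pi * h * Q t) * ((t + t^-1) / 2).
have -> : s * ((v + v^-1) / 2) = s * ((v + v^-1) / 2) - 0 by rewrite subr0.
have gf t : 0 < t -> pker D x (bpt o e h chi t) * X (bpt o e h chi t) = f t.
  move=> t0; rewrite X_bpt// xE (pker_bpt frD)//; last exact: lt0r_neq0 (Q0 t).
  exact: lt0r_neq0 (bden_gt0 t cI).
have lsC := lensC ls.
have itv := ext_open_itv lsC; rewrite opprK in itv.
apply: (arc_FTC frD (f := f) (G := G)) => //.
- exact: measurable_ext_open.
- by move=> y _; rewrite mulr_ge0 ?pker_ge0.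
- by move=> t t0; rewrite -gf// mulr_ge0 ?pker_ge0.
- move=> t t0; apply: integrand_cont; rewrite ?lt0r_neq0//.
  + by rewrite !mulr_gt0// pi_gt0.
  + have := @quad_cont 1 (2 * cos chi) 1 t; rewrite [X in {for _, continuous X}](_ : _ = bden chi)//.
    by apply/funext => u; rewrite /bden mul1r.
  + have := @quad_cont 1 (2 * cos (pi - psi - chi) * v ^+ 2) (v ^+ 4) t.
    rewrite [X in {for _, continuous X}](_ : _ = Q)//.
    by apply/funext => u; rewrite /Q; ring.
- move=> t t0; have -> // : f t * (4 * h * t / bden chi t) =
    2 * c * s / pi * v ^+ 2 * (t ^+ 2 + 1) / quad4 c s v t.
  have Qn := lt0r_neq0 (Q0 t); have tn := lt0r_neq0 t0.
  have bn := lt0r_neq0 (bden_gt0 t cI).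
  rewrite -QE /f sin_lens; move: (Q t) (bden chi t) (pi : R) pin Qn bn => q b P Pn Qn bn.
  by field; do ?[apply/andP; split].
Qed.


Let cos_lensN : cos (pi - psi + (pi - chi)) = c ^+ 2 - s ^+ 2.
Proof.
rewrite (_ : pi - psi + (pi - chi) = pi *+ 2 - theta); last by ring.
by rewrite cosB sin2pi cos2pi mul0r addr0 mul1r cos_double.
Qed.

Lemma potential_int x : int_arc D' D x ->
  (\int[arclen D (- e)%R]_(y in int_arc D D') (pker D x y * X y)%:E <= (c * X x)%:E)%E.
Proof.
move=> xI; have [v v0 xE] := int_arc_bpt ls xI.
have xD : open_disk D x by move: xI; rewrite int_arcE => -[].
have [s0 c0 sc] := lens_half ls.
have nx := lt0r_neq0 (bden_gt0 v piI); have vn := lt0r_neq0 v0.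
have w0 : 0 < v^-1 by rewrite invr_gt0.
rewrite {2}xE X_bpt//.
have [G [dG Gb]] := prim_potential sc s0 c0 w0.
pose Q t := v ^+ 4 * t ^+ 4 - 2 * cos (pi - psi + (pi - chi)) * v ^+ 2 * t ^+ 2 + 1.
have QE t : Q t = v ^+ 4 * quad4 s c v^-1 t.
  by rewrite /Q cos_lensN /quad4; field.
have Q0 t : 0 < Q t by rewrite QE mulr_gt0 ?quad4_gt0 ?exprn_gt0.
pose f t := v ^+ 2 * sin (pi - psi - chi) * bden (pi - chi) t / (2 * pi * h * Q t) * ((t + t^-1) / 2).
have -> : c * ((v + v^-1) / 2) = c * ((v^-1 + v^-1^-1) / 2) - 0.
  by rewrite subr0 invrK [v + _]addrC.
have gf t : 0 < t -> pker D x (bpt o (- e) h (pi - chi) t) * X (bpt o (- e) h (pi - chi) t) = f t.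
  move=> t0; rewrite X_bptN// xE (pker_bptN frD)//; last exact: lt0r_neq0 (Q0 t).
  exact: lt0r_neq0 (bden_gt0 t ciI).
have itv := int_arc_itv (lensC ls).
apply: (arc_FTC frDi (f := f) (G := G)) => //.
- exact: measurable_int_arc.
- by move=> y _; rewrite mulr_ge0 ?pker_ge0.
- by move=> t t0; rewrite -gf// mulr_ge0 ?pker_ge0.
- move=> t t0; apply: integrand_cont; rewrite ?lt0r_neq0//.
  + by rewrite !mulr_gt0// pi_gt0.
  + have := @quad_cont 1 (2 * cos (pi - chi)) 1 t.
    rewrite [X in {for _, continuous X}](_ : _ = bden (pi - chi))//.
    by apply/funext => u; rewrite /bden mul1r.
  + have := @quad_cont (v ^+ 4) (2 * cos (pi - psi + (pi - chi)) * v ^+ 2) 1 t.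
    by rewrite [X in {for _, continuous X}](_ : _ = Q).
- move=> t t0; have -> // : f t * (4 * h * t / bden (pi - chi) t) =
    2 * s * c / pi * v^-1 ^+ 2 * (t ^+ 2 + 1) / quad4 s c v^-1 t.
  have qn := lt0r_neq0 (quad4_gt0 t sc s0 w0); have tn := lt0r_neq0 t0.
  have bn := lt0r_neq0 (bden_gt0 t ciI).
  rewrite /f QE sin_lens; move: (quad4 s c v^-1 t) (bden (pi - chi) t) (pi : R) pin qn bn => q b P Pn qn bn.
  by field; do ?[apply/andP; split].
Qed.

Let bden_psi v : bden (pi - psi) v = quad4 (cos (psi / 2)) (sin (psi / 2)) 1 v.
Proof.
by rewrite /bden cosB cospi sinpi cos_double /quad4; ring.
Qed.

Let cos_chi : cos chi = (c ^+ 2 - s ^+ 2) * (cos (psi / 2) ^+ 2 - sin (psi / 2) ^+ 2)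
   + 4 * s * c * cos (psi / 2) * sin (psi / 2).
Proof.
rewrite {1}(_ : chi = theta - psi); last by ring.
by rewrite cosB (cos_double theta) (cos_double psi) (sin_double theta) (sin_double psi) -/s -/c; ring.
Qed.

Let X_neq1 (v : R) : 0 < v -> (v + v^-1) / 2 != 1 -> v != 1.
Proof.
by move=> v0; apply: contra => /eqP ->; rewrite invr1 divff.
Qed.

Lemma flux_ext y : ext_open D D' y -> X y != 1 ->
  (\int[arclen D' e]_(x in int_arc D' D) (pker D x y * X x)%:E <=
   (s * X y - s * c * cos psi / cos (psi / 2))%:E)%E.
Proof.
move=> yE' X1; have [t t0 yE] := ext_open_bpt (lensC ls) yE'; rewrite opprK in yE.
have [s0 c0 sc] := lens_half ls; have cs : c ^+ 2 + s ^+ 2 = 1 by rewrite addrC.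
have [s20 k0 sk2] := psi_half.
have ny := lt0r_neq0 (bden_gt0 t cI); have tn := lt0r_neq0 t0.
have Xy : X y = (t + t^-1) / 2 by rewrite yE X_bpt.
have t1 : t != 1 by apply: X_neq1 => //; rewrite -Xy.
have kn : - sin (psi / 2) < 0 by rewrite oppr_lt0.
have sk2' : cos (psi / 2) ^+ 2 + (- sin (psi / 2)) ^+ 2 = 1 by rewrite sqrrN.
have [G [dG Gb]] := prim_flux cs sk2' c0 s0 s20 (ltr0_neq0 kn) t0 t1.
have le := flux_le_far cs sk2' c0 s0 s20 t0 t1 kn.
apply: (@le_trans _ _ (s * ((t + t^-1) / 2) + c * s * (2 * - sin (psi / 2) *
   (s * cos (psi / 2) - c * - sin (psi / 2)) /
   ((t + t^-1) / 2 + (c * cos (psi / 2) + s * - sin (psi / 2))) -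
   (cos (psi / 2) ^+ 2 - (- sin (psi / 2)) ^+ 2) / cos (psi / 2)))%:E); last first.
  rewrite lee_fin (le_trans le)// Xy (cos_double psi) sqrrN [c * s]mulrC.
  exact: lexx.
pose Q v := v ^+ 4 - 2 * cos (pi - psi - chi) * v ^+ 2 * t ^+ 2 + t ^+ 4.
have QE v : Q v = quad4 c s t v by rewrite /Q cos_lens /quad4; ring.
have Q0 v : 0 < Q v by rewrite QE quad4_gt0.
pose f v := (sin (pi - psi - chi) * bden chi t) * v ^+ 2 / (2 * pi * h * Q v) * ((v + v^-1) / 2).
rewrite -[X in (_ <= X%:E)%E]subr0.
have gf v : 0 < v -> pker D (bpt o e h (pi - psi) v) y * X (bpt o e h (pi - psi) v) = f v.
  move=> v0; rewrite X_bpt// yE (pker_bpt frD)//; last exact: lt0r_neq0 (Q0 v).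
    by rewrite /f; congr (_ / _ * _); rewrite -mulrA mulrC.
  exact: lt0r_neq0 (bden_gt0 v piI).
have itv := int_arc_itv ls.
have pos v : 0 < v -> 0 <= f v.
  move=> v0; apply: mulr_ge0; last by apply: divr_ge0 => //; apply/ltW; rewrite addr_gt0 ?invr_gt0.
  apply/ltW; apply: divr_gt0; last by rewrite !mulr_gt0 ?pi_gt0.
  by rewrite sin_lens !mulr_gt0 ?exprn_gt0 ?bden_gt0.
apply: (arc_FTC frD'i (f := f) (G := G)) => //.
- exact: measurable_int_arc.
- by move=> x; rewrite int_arcE => -[_ xD]; rewrite mulr_ge0 ?pker_ge0.
- move=> v v0; apply: (@integrand_cont _ _ (fun v => v ^+ 2)); rewrite ?lt0r_neq0//.
  + by rewrite !mulr_gt0// pi_gt0.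
  + exact: exprn_continuous.
  + have := @quad_cont 1 (2 * cos (pi - psi - chi) * t ^+ 2) (t ^+ 4) v.
    rewrite [X in {for _, continuous X}](_ : _ = Q)//.
    by apply/funext => u; rewrite /Q; ring.
- move=> v v0.
  suff -> : f v * (4 * h * v / bden (pi - psi) v) = 2 * c * s / pi *
    (t ^+ 4 + 2 * ((s ^+ 2 - c ^+ 2) * (cos (psi / 2) ^+ 2 - (- sin (psi / 2)) ^+ 2) +
      4 * c * s * cos (psi / 2) * - sin (psi / 2)) * t ^+ 2 + 1) *
    (v ^+ 2 * (v ^+ 2 + 1)) / (quad4 c s t v * quad4 (cos (psi / 2)) `|- sin (psi / 2)| 1 v) by exact: dG.
  have -> : t ^+ 4 + 2 * ((s ^+ 2 - c ^+ 2) * (cos (psi / 2) ^+ 2 - (- sin (psi / 2)) ^+ 2) +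
      4 * c * s * cos (psi / 2) * - sin (psi / 2)) * t ^+ 2 + 1 = bden chi t.
    by rewrite /bden cos_chi; ring.
  rewrite normrN (gtr0_norm k0) -bden_psi -QE.
  have Qn := lt0r_neq0 (Q0 v); have vn := lt0r_neq0 v0.
  have bn := lt0r_neq0 (bden_gt0 v piI).
  rewrite /f sin_lens; move: (Q v) (bden (pi - psi) v) (bden chi t) (pi : R) pin Qn bn ny
    => q b b' P Pn qn bn b'n.
  by field; do ?[apply/andP; split].
Qed.

Lemma flux_int y : int_arc D D' y -> X y != 1 ->
  (\int[arclen D' e]_(x in int_arc D' D) (pker D x y * X x)%:E <=
   (c * X y + Num.max 0 (- (s * c * cos psi / cos (psi / 2))))%:E)%E.
Proof.
move=> yE' X1; have [t t0 yE] := int_arc_bpt (lensC ls) yE'.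
have [s0 c0 sc] := lens_half ls.
have [s20 k0 sk2] := psi_half.
have ny := lt0r_neq0 (bden_gt0 t ciI); have tn := lt0r_neq0 t0.
have Xy : X y = (t^-1 + t^-1^-1) / 2 by rewrite yE X_bptN// invrK [t + _]addrC.
have w0 : 0 < t^-1 by rewrite invr_gt0.
have w1 : t^-1 != 1 by apply: X_neq1 => //; rewrite -Xy.
have [G [dG Gb]] := prim_flux sc sk2 s0 c0 s20 (lt0r_neq0 k0) w0 w1.
have S''0 : 0 <= s * cos (psi / 2) - c * sin (psi / 2).
  rewrite -sinB (_ : _ - _ = chi / 2); last by field.
  by apply/ltW/sin_gt0_pi; have := cI; move=> /andP[? ?]; apply/andP; split; lra.
have le := flux_le_near sc sk2 s0 c0 s20 w0 w1 k0 S''0.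
rewrite Xy (cos_double psi); set V := (X in X <= _) in le.
apply: (@le_trans _ _ V%:E); last by rewrite lee_fin.
pose Q v := v ^+ 4 * t ^+ 4 - 2 * cos (pi - psi + (pi - chi)) * v ^+ 2 * t ^+ 2 + 1.
have QE v : Q v = t ^+ 4 * quad4 s c t^-1 v.
  by rewrite /Q cos_lensN /quad4; field.
have Q0 v : 0 < Q v by rewrite QE mulr_gt0 ?quad4_gt0 ?exprn_gt0.
pose f v := (sin (pi - psi - chi) * bden (pi - chi) t) * v ^+ 2 / (2 * pi * h * Q v) * ((v + v^-1) / 2).
rewrite -[X in (_ <= X%:E)%E]subr0.
have gf v : 0 < v -> pker D (bpt o e h (pi - psi) v) y * X (bpt o e h (pi - psi) v) = f v.
  move=> v0; rewrite X_bpt// yE (pker_bptN frD)//; last exact: lt0r_neq0 (Q0 v).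
    by rewrite /f; congr (_ / _ * _); rewrite -mulrA mulrC.
  exact: lt0r_neq0 (bden_gt0 v piI).
have itv := int_arc_itv ls.
have pos v : 0 < v -> 0 <= f v.
  move=> v0; apply: mulr_ge0; last by apply: divr_ge0 => //; apply/ltW; rewrite addr_gt0 ?invr_gt0.
  apply/ltW; apply: divr_gt0; last by rewrite !mulr_gt0 ?pi_gt0.
  by rewrite sin_lens !mulr_gt0 ?exprn_gt0 ?bden_gt0.
apply: (arc_FTC frD'i (f := f) (G := G)) => //.
- exact: measurable_int_arc.
- by move=> x; rewrite int_arcE => -[_ xD]; rewrite mulr_ge0 ?pker_ge0.
- move=> v v0; apply: (@integrand_cont _ _ (fun v => v ^+ 2)); rewrite ?lt0r_neq0//.
  + by rewrite !mulr_gt0// pi_gt0.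
  + exact: exprn_continuous.
  + have := @quad_cont (t ^+ 4) (2 * cos (pi - psi + (pi - chi)) * t ^+ 2) 1 v.
    rewrite [X in {for _, continuous X}](_ : _ = Q)//.
    by apply/funext => u; rewrite /Q; ring.
- move=> v v0.
  suff -> : f v * (4 * h * v / bden (pi - psi) v) = 2 * s * c / pi *
    (t^-1 ^+ 4 + 2 * ((c ^+ 2 - s ^+ 2) * (cos (psi / 2) ^+ 2 - sin (psi / 2) ^+ 2) +
      4 * s * c * cos (psi / 2) * sin (psi / 2)) * t^-1 ^+ 2 + 1) *
    (v ^+ 2 * (v ^+ 2 + 1)) / (quad4 s c t^-1 v * quad4 (cos (psi / 2)) `|sin (psi / 2)| 1 v) by exact: dG.
  have -> : t^-1 ^+ 4 + 2 * ((c ^+ 2 - s ^+ 2) * (cos (psi / 2) ^+ 2 - sin (psi / 2) ^+ 2) +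
      4 * s * c * cos (psi / 2) * sin (psi / 2)) * t^-1 ^+ 2 + 1 = bden (pi - chi) t / t ^+ 4.
    by rewrite /bden cosB cospi sinpi cos_chi; field.
  rewrite (gtr0_norm k0) -bden_psi.
  have qn := lt0r_neq0 (quad4_gt0 v sc s0 w0); have vn := lt0r_neq0 v0.
  have bn := lt0r_neq0 (bden_gt0 v piI).
  rewrite /f QE sin_lens; move: (quad4 s c t^-1 v) (bden (pi - psi) v) (bden (pi - chi) t)
    (pi : R) pin qn bn ny => q b b' P Pn qn bn b'n.
  by field; do ?[apply/andP; split].
Qed.

End LensIntegrals.

Section LensExists.
Context {R : realType}.
Local Notation plane := (R * R)%type.

Lemma lens_exists (D1 D2 : disk R) :
  open_disk D1 `&` open_disk D2 !=set0 ->
  ~ (open_disk D1 `<=` open_disk D2) -> ~ (open_disk D2 `<=` open_disk D1) ->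
  exists o e h chi psi, lens D2 D1 o e h chi psi.
Proof.
move=> [z [zD1 zD2]] h12 h21.
pose r1 := radius D1; pose r2 := radius D2; pose c1 := center D1; pose c2 := center D2.
have r10 : 0 < r1 := radius_gt0 D1; have r20 : 0 < r2 := radius_gt0 D2.
pose d := edist c2 c1.
have d12 : d < r1 + r2.
  apply: (le_lt_trans (edist_triangle c2 z c1)).
  by rewrite edistC addrC ltrD.
have d1 : r2 - r1 < d.
  rewrite ltNge; apply/negP => dle; apply: h12 => x; rewrite /open_disk/= -/c1 -/c2 -/r1 -/r2 => xD.
  have := edist_triangle x c1 c2; rewrite [edist c1 c2]edistC -/d; lra.
have d2 : r1 - r2 < d.
  rewrite ltNge; apply/negP => dle; apply: h21 => x; rewrite /open_disk/= -/c1 -/c2 -/r1 -/r2 => xD.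
  have := edist_triangle x c2 c1; rewrite -/d; lra.
have d0 : 0 < d by have [?|?] := leP r1 r2; lra.
have dn := lt0r_neq0 d0; have [r1n r2n] := (lt0r_neq0 r10, lt0r_neq0 r20).
pose e : plane := ((c2.1 - c1.1) / d, (c2.2 - c1.2) / d).
have e1 : e.1 ^+ 2 + e.2 ^+ 2 = 1.
  rewrite /e/= !expr_div_n -mulrDl -edist_sqr -/d divff// expf_neq0//.
pose m1 := (d ^+ 2 + r1 ^+ 2 - r2 ^+ 2) / (2 * d); pose m2 := d - m1.
have dd : (r1 - r2) ^+ 2 < d ^+ 2.
  rewrite -subr_gt0 subr_sqr mulr_gt0//; lra.
have dd' : d ^+ 2 < (r1 + r2) ^+ 2 by rewrite ltr_pXn2r ?nnegrE ?(ltW d0)// addr_ge0 ?ltW.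
have d20 : 0 < 2 * d by rewrite mulr_gt0.
have m2E : m2 = (d ^+ 2 + r2 ^+ 2 - r1 ^+ 2) / (2 * d) by rewrite /m2 /m1; field.
have b1 : -1 < m1 / r1 < 1.
  rewrite ltr_pdivlMr// ltr_pdivrMr// mul1r mulN1r /m1 ltr_pdivlMr// ltr_pdivrMr//.
  have k1 : 0 < (d - (r2 - r1)) * (d + r1 + r2) by apply: mulr_gt0; lra.
  have k2 : 0 < (r1 + r2 - d) * (r2 + d - r1) by apply: mulr_gt0; lra.
  by apply/andP; split; nra.
have b2 : -1 < m2 / r2 < 1.
  rewrite m2E ltr_pdivlMr// ltr_pdivrMr// mul1r mulN1r ltr_pdivlMr// ltr_pdivrMr//.
  have k1 : 0 < (d - (r1 - r2)) * (d + r1 + r2) by apply: mulr_gt0; lra.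
  have k2 : 0 < (r1 + r2 - d) * (r1 + d - r2) by apply: mulr_gt0; lra.
  by apply/andP; split; nra.
have b1' : -1 <= m1 / r1 <= 1 by case/andP: b1 => ? ?; rewrite !ltW.
have b2' : -1 <= m2 / r2 <= 1 by case/andP: b2 => ? ?; rewrite !ltW.
pose psi := acos (m1 / r1); pose chi := acos (m2 / r2).
have cp : cos psi = m1 / r1 by rewrite acosK// in_itv.
have cc : cos chi = m2 / r2 by rewrite acosK// in_itv.
have pI : 0 < psi < pi.
  by case/andP: b1 => ? ?; rewrite acos_gt0 ?acos_ltpi//; apply/andP; split=> //; exact: ltW.
have cI : 0 < chi < pi.
  by case/andP: b2 => ? ?; rewrite acos_gt0 ?acos_ltpi//; apply/andP; split=> //; exact: ltW.
pose h := r1 * sin psi.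
exists (c1.1 + m1 * e.1, c1.2 + m1 * e.2), e, h, chi, psi; split.
- split => //.
    have sp0 : 0 < sin psi by exact: sin_gt0_pi.
    have sc0 : 0 < sin chi by exact: sin_gt0_pi.
    apply/eqP; rewrite /h -(@eqrXn2 _ 2%N) ?mulr_ge0 ?ltW// !exprMn !sin2cos2 cp cc.
    by apply/eqP; rewrite -/r2 m2E /m1; field; do ?[apply/andP; split].
  rewrite cc -/r2 [r2 * _]mulrC divfK// /m2 /e -/c2; case: (c2) (c1) => a b [a' b'] /=.
  by congr pair; field.
- split => //=; first by rewrite !sqrrN.
  rewrite cp -/r1 [r1 * _]mulrC divfK// -/c1; case: (c1) => a b /=.
  by congr pair; ring.
- rewrite -ltrBrDr -ltr_cos ?in_itv/=; last 2 first.
  + by case/andP: cI => ? ?; rewrite !ltW.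
  + by case/andP: pI => ? ?; apply/andP; split; lra.
  rewrite cosB cospi sinpi mul0r addr0 mulN1r cp cc m2E /m1.
  rewrite -subr_gt0 opprK.
  have -> : (d ^+ 2 + r2 ^+ 2 - r1 ^+ 2) / (2 * d) / r2 + (d ^+ 2 + r1 ^+ 2 - r2 ^+ 2) / (2 * d) / r1 =
    (r1 + r2) * (d ^+ 2 - (r1 - r2) ^+ 2) / (2 * d * r1 * r2) by field; do ?[apply/andP; split].
  apply: divr_gt0; first by apply: mulr_gt0; [exact: addr_gt0 | rewrite subr_gt0].
  by rewrite !mulr_gt0.
Qed.

End LensExists.

Section NullSets.
Context {R : realType}.
Local Notation plane := (R * R)%type.
Variables (D : disk R) (e : plane).
Hypothesis e1 : e.1 ^+ 2 + e.2 ^+ 2 = 1.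

Lemma measurable_dotc : measurable_fun setT (dotc D e).
Proof. by apply: measurable_funD; apply: measurable_funM => //; apply: measurable_funB. Qed.

Lemma arclen_line k : arclen D e [set x | dotc D e x = k] = 0%E.
Proof.
have r0 := radius_gt0 D; have rn := lt0r_neq0 r0.
rewrite arclenE; set A := _ `&` _.
pose a := radius D * acos (k / radius D).
have sub : A `<=` [set a; - a].
  move=> s [sD]; rewrite /preimage/= /dotc /arcpt /= => E.
  have {}E : k / radius D = cos (s / radius D).
    rewrite -E; set C := cos _; set S := sin _.
    transitivity (C * (e.1 ^+ 2 + e.2 ^+ 2)); last by rewrite e1 mulr1.
    by field.
  move: sD; rewrite /arcdom/= in_itv/= -mulNr -ler_pdivlMr// -ltr_pdivrMr// => /andP[s1 s2].
  have := @cosK R `|s / radius D|; rewrite in_itv/= normr_ge0 ler_norml s1 ltW// => /(_ isT).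
  rewrite cos_norm -E => aE; rewrite /a aE.
  by have [h|h] := ger0P (s / radius D); [left|right]; rewrite /= ?mulrN ?opprK mulrC divfK.
apply/eqP; rewrite eq_le measure_ge0 andbT.
have fin : finite_set [set a; - a] by rewrite finite_setU; split; exact: finite_set1.
rewrite -(@countable_lebesgue_measure0 R [set a; - a]); last exact: finite_set_countable.
apply: le_measure; rewrite ?inE//; last first.
  by apply: measurableU; exact: measurable_set1.
apply: measurableI; first exact: measurable_arcdom.
rewrite -[X in measurable X]setTI; apply: measurable_arcpt => //.
rewrite -[X in measurable X]setTI.
exact: (measurable_dotc measurableT (measurable_set1 k)).
Qed.

Lemma arclen_set1 (p : plane) : arclen D e [set p] = 0%E.
Proof.
apply/eqP; rewrite eq_le measure_ge0 andbT -(arclen_line (dotc D e p)).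
apply: le_measure; rewrite ?inE//; last by move=> _ ->.
- rewrite (_ : [set p] = [set p.1] `*` [set p.2]).
    by apply: measurableX; exact: measurable_set1.
  by apply/seteqP; split => [_ ->//|[a b] /= [-> ->]]; case: p.
- rewrite -[X in measurable X]setTI.
  exact: (measurable_dotc measurableT (measurable_set1 (dotc D e p))).
Qed.

End NullSets.

Section SchurConstants.
Context {R : realType}.
Implicit Types s c E chi psi : R.

Lemma schur_gap s c E : 0 < s -> 0 < c -> s ^+ 2 + c ^+ 2 = 1 -> 0 <= E ->
  E = 0 \/ E <= s * (1 - 2 * c ^+ 2) ->
  (2 * c) * (2 * c + E) < (2 - s * (s + E) / 2) * (2 - s * s / 2).
Proof.
move=> s0 c0 sc E0 EB.
have sq : s ^+ 2 = 1 - c ^+ 2 by lra.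
have c1 : c ^+ 2 < 1 by rewrite -subr_gt0 -sq exprn_gt0.
rewrite -subr_gt0.
have -> : (2 - s * (s + E) / 2) * (2 - s * s / 2) - 2 * c * (2 * c + E) =
  (s * (s * (9 - c ^+ 2)) - E * (8 * c + s * (3 + c ^+ 2))) / 4.
  have -> : s * (s + E) = 1 - c ^+ 2 + s * E by rewrite mulrDr -expr2 sq.
  rewrite -expr2 sq.
  have -> : s * (s * (9 - c ^+ 2)) = (1 - c ^+ 2) * (9 - c ^+ 2) by rewrite mulrA -expr2 sq.
  by field.
rewrite divr_gt0// subr_gt0.
have sB : 0 < s * (9 - c ^+ 2) by rewrite mulr_gt0//; lra.
case: EB => [->|EB]; first by rewrite mul0r mulr_gt0.
have k0 : 0 < 8 * c + s * (3 + c ^+ 2) by rewrite addr_gt0 ?mulr_gt0 ?ltr_wpDr ?sqr_ge0.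
apply: (le_lt_trans (ler_wpM2r (ltW k0) EB)); rewrite -mulrA ltr_pM2l//.
have c2 : 0 <= 1 - 2 * c ^+ 2 by rewrite -(pmulr_rge0 _ s0); exact: le_trans EB.
have s7 : 7 / 10 <= s.
  rewrite -(@ler_pXn2r _ 2%N) ?nnegrE ?(ltW s0)// sq expr2; lra.
have h1 : 8 * c * (1 - 2 * c ^+ 2) < 42 / 10.
  have : 0 <= (c - 2 / 5) ^+ 2 * (c + 4 / 5) by rewrite mulr_ge0 ?sqr_ge0// addr_ge0// ltW.
  have -> : (c - 2 / 5) ^+ 2 * (c + 4 / 5) = c ^+ 3 - 12 / 25 * c + 16 / 125 by field.
  have -> : 8 * c * (1 - 2 * c ^+ 2) = 8 * c - 16 * c ^+ 3 by ring.
  have cl1 : c < 1 by rewrite -(@ltr_pXn2r _ 2%N) ?nnegrE ?ltW// expr1n.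
  lra.
have h2 : 42 / 10 <= s * (6 + (4 * c ^+ 2 + 2 * c ^+ 4)).
  have : 0 <= 4 * c ^+ 2 + 2 * c ^+ 4 by rewrite addr_ge0 ?mulr_ge0 ?exprn_ge0 ?ltW.
  nra.
have -> : (1 - 2 * c ^+ 2) * (8 * c + s * (3 + c ^+ 2)) = 8 * c * (1 - 2 * c ^+ 2) +
  (s * (9 - c ^+ 2) - s * (6 + (4 * c ^+ 2 + 2 * c ^+ 4))) by ring.
lra.
Qed.

Lemma strict_ratio (n : nat) (a b : nat -> R) :
  (forall i, 0 < b i) -> (forall i, (i < n)%N -> a i < b i) ->
  exists2 l : R, 0 < l < 1 & forall i, (i < n)%N -> a i <= l * b i.
Proof.
move=> b0; elim: n => [_|n ih ab]; first by exists (1 / 2) => //; apply/andP; split; lra.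
have [//|l /andP[l0 l1] lab] := ih; first by move=> i ni; apply: ab; exact: ltnW.
exists (Num.max l (a n / b n)).
  by rewrite lt_max l0 gt_max l1 ltr_pdivrMr// mul1r ab.
move=> i; rewrite ltnS leq_eqVlt => /predU1P[->|ni].
  by rewrite -ler_pdivrMr// le_max lexx orbT.
by apply: (le_trans (lab i ni)); rewrite ler_pM2r// le_max lexx.
Qed.

Lemma schur_constants s c E1 E2 : 0 < s -> 0 < c -> s ^+ 2 + c ^+ 2 = 1 ->
  0 <= E1 -> 0 <= E2 ->
  (2 * c + E1) * (2 * c + E2) < (2 - s * (s + E2) / 2) * (2 - s * (s + E1) / 2) ->
  0 < 2 - s * (s + E2) / 2 -> 0 < 2 - s * (s + E1) / 2 ->
  exists a1 b1 a2 b2 l : R,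
  [/\ [/\ 0 < a1, 0 < b1, 0 < a2 & 0 < b2], 0 < l < 1,
      (a2 * (2 * c + E1) + s * b2 <= 2 * l * a1) /\ (a2 * (s + E1) <= 2 * l * b1) &
      (a1 * (2 * c + E2) + s * b1 <= 2 * l * a2) /\ (a1 * (s + E2) <= 2 * l * b2)].
Proof.
move=> s0 c0 sc E10 E20 gap; set B := 2 - _ => B0; set C := 2 - _ => C0.
have A10 : 0 < 2 * c + E1 by rewrite ltr_wpDr// mulr_gt0.
have A20 : 0 < 2 * c + E2 by rewrite ltr_wpDr// mulr_gt0.
have s1 : s <= 1.
  rewrite -(@ler_pXn2r _ 2%N) ?nnegrE ?(ltW s0)// expr1n; have := sqr_ge0 c; lra.
have lu : (2 * c + E2) / C < B / (2 * c + E1).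
  by rewrite ltr_pdivrMr// mulrAC ltr_pdivlMr// [ltLHS]mulrC.
have [l1 l2] := midf_lt lu; set a := (_ + _) / 2 in l1 l2.
have a0 : 0 < a by apply: lt_trans l1; rewrite divr_gt0.
rewrite ltr_pdivrMr// in l1; rewrite ltr_pdivlMr// in l2.
pose d := Num.min (B - a * (2 * c + E1)) (a * C - (2 * c + E2)) / 2.
have d0 : 0 < d by rewrite divr_gt0// lt_min !subr_gt0 l1 l2.
have dl : d < B - a * (2 * c + E1).
  by rewrite ltr_pdivrMr// gt_min; apply/orP; left; lra.
have dr : d < a * C - (2 * c + E2).
  by rewrite ltr_pdivrMr// gt_min; apply/orP; right; lra.
have sd : s * d <= d by rewrite ger_pMl.
pose b1 := a * (s + E1) / 2 + d; pose b2 := (s + E2) / 2 + d.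
have sE1 : 0 < s + E1 by rewrite ltr_wpDr.
have sE2 : 0 < s + E2 by rewrite ltr_wpDr.
have b10 : 0 < b1 by rewrite addr_gt0// divr_gt0// mulr_gt0.
have b20 : 0 < b2 by rewrite addr_gt0// divr_gt0.
pose L := fun i => nth 0 [:: a * (2 * c + E1) + s * b2; a * (s + E1); 1 * (2 * c + E2) + s * b1; 1 * (s + E2)] i.
pose M := fun i => nth 2 [:: 2; 2 * b1; 2 * a; 2 * b2] i.
have [||l l01 LM] := @strict_ratio 4 L M.
- by case=> [|[|[|[|i]]]]; rewrite /M/= ?nth_default// mulr_gt0.
- case=> [|[|[|[|i]]]] //= _; rewrite /M /L/=.
  + have : s * b2 = s * (s + E2) / 2 + s * d by rewrite /b2; ring.
    by move: dl; rewrite /B; lra.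
  + by rewrite /b1; lra.
  + have : s * b1 = a * (s * (s + E1) / 2) + s * d by rewrite /b1; ring.
    by move: dr; rewrite /C mulrBr; lra.
  + by rewrite /b2; lra.
exists 1, b1, a, b2, l; split=> //.
- by split; [have := LM 0%N isT | have := LM 1%N isT]; rewrite /L /M/=; lra.
- by split; [have := LM 2%N isT | have := LM 3%N isT]; rewrite /L /M/=; lra.
Qed.

Definition flux_excess s c psi : R := Num.max 0 (- (s * c * cos psi / cos (psi / 2))).

Lemma flux_excess_le s c chi psi : 0 < s -> 0 < c -> 0 < chi -> 0 < psi ->
  chi + psi < pi -> c = cos ((chi + psi) / 2) ->
  flux_excess s c psi = 0 \/ flux_excess s c psi <= s * (1 - 2 * c ^+ 2) /\ pi / 2 < psi.
Proof.
move=> s0 c0 chi0 psi0 cp cE; rewrite /flux_excess.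
have C0 : 0 < cos (psi / 2) by apply: cos_gt0_pihalf; apply/andP; split; lra.
have [pl|pg] := leP psi (pi / 2).
  left; apply/max_idPl; rewrite oppr_le0 divr_ge0 ?(ltW C0)// mulr_ge0 ?mulr_ge0 ?(ltW s0) ?(ltW c0)//.
  have [->|pn] := eqVneq psi (pi / 2); first by rewrite cos_pihalf.
  by apply/ltW; apply: cos_gt0_pihalf; apply/andP; split; [lra | rewrite lt_neqAle pn pl].
right; split=> //; rewrite ge_max.
have cC : c <= cos (psi / 2).
  rewrite cE leNgt; apply/negP; rewrite ltr_cos ?in_itv/=; [lra|..]; apply/andP; split; lra.
set C := cos (psi / 2) in C0 cC *.
have pE : cos psi = 2 * C ^+ 2 - 1.
  have {1}-> : psi = psi / 2 + psi / 2 by lra.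
  by rewrite cosD -!expr2 sin2cos2 -/C; ring.
have cneg : cos psi < 0.
  have -> : psi = pi - (pi - psi) by rewrite opprB addrC subrK.
  rewrite cosB cospi sinpi mul0r addr0 mulN1r oppr_lt0.
  by apply: cos_gt0_pihalf; apply/andP; split; lra.
have cc : c ^+ 2 <= C ^+ 2 by rewrite ler_pXn2r ?nnegrE ?(ltW c0) ?(ltW C0).
apply/andP; split; first by rewrite mulr_ge0// ?ltW//; lra.
rewrite -mulNr ler_pdivrMr// -mulrA -mulNr -(mulrA s) mulNr -mulrN ler_pM2l//.
rewrite pE -subr_ge0.
have -> : (1 - 2 * c ^+ 2) * C - - (c * (2 * C ^+ 2 - 1)) = (C - c) * (1 + 2 * c * C) by ring.
by rewrite mulr_ge0 ?subr_ge0// addr_ge0// !mulr_ge0// ltW.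
Qed.

Lemma flux_excess_ge0 s c psi : 0 <= flux_excess s c psi.
Proof. by rewrite le_max lexx. Qed.

Lemma lens_constants chi psi : 0 < chi -> 0 < psi -> chi + psi < pi ->
  let s := sin ((chi + psi) / 2) in let c := cos ((chi + psi) / 2) in
  exists a1 b1 a2 b2 l : R,
  [/\ [/\ 0 < a1, 0 < b1, 0 < a2 & 0 < b2], 0 < l < 1,
      (a2 * (2 * c + flux_excess s c chi) + s * b2 <= 2 * l * a1) /\
      (a2 * (s + flux_excess s c chi) <= 2 * l * b1) &
      (a1 * (2 * c + flux_excess s c psi) + s * b1 <= 2 * l * a2) /\
      (a1 * (s + flux_excess s c psi) <= 2 * l * b2)].
Proof.
move=> chi0 psi0 cp s c.
have s0 : 0 < s by apply: sin_gt0_pi; apply/andP; split; lra.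
have c0 : 0 < c by apply: cos_gt0_pihalf; apply/andP; split; lra.
have sc : s ^+ 2 + c ^+ 2 = 1 by rewrite addrC cos2Dsin2.
have e1 := @flux_excess_le s c psi chi s0 c0 psi0 chi0.
have e2 := @flux_excess_le s c chi psi s0 c0 chi0 psi0 cp erefl.
have {}e1 := e1 (etrans (congr1 (fun z => z < pi) (addrC psi chi)) cp) (congr1 (fun z => cos (z / 2)) (addrC chi psi)).
have E10 := flux_excess_ge0 s c chi; have E20 := flux_excess_ge0 s c psi.
have pos E : E = 0 \/ E <= s * (1 - 2 * c ^+ 2) -> 0 < 2 - s * (s + E) / 2.
  have sq : s ^+ 2 <= 1 by have := sqr_ge0 c; lra.
  case=> [->|EB]; first by rewrite addr0 -expr2; lra.
  have EB2 : s * E <= s ^+ 2 * (1 - 2 * c ^+ 2) by rewrite expr2 -mulrA ler_pM2l.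
  have := mulr_ge0 (sqr_ge0 s) (sqr_ge0 c); rewrite mulrDr -expr2; lra.
apply: schur_constants => //.
- case: e1 => [->|[e1 h1]].
    rewrite !addr0; apply: schur_gap => //; by case: e2 => [|[]]; [left|right].
  case: e2 => [->|[_ h2]]; last lra.
  by rewrite !addr0 mulrC [ltRHS]mulrC; apply: schur_gap => //; right.
- by apply: pos; case: e2 => [|[]]; [left|right].
- by apply: pos; case: e1 => [|[]]; [left|right].
Qed.

End SchurConstants.

Section CircleMeas.
Context {R : realType}.
Local Notation plane := (R * R)%type.

Definition cmeas (D : disk R) : {finite_measure set plane -> \bar R} :=
  arclen D ((1 : R), (0 : R)).

Lemma unit10 : ((1 : R), (0 : R)).1 ^+ 2 + ((1 : R), (0 : R)).2 ^+ 2 = 1.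
Proof. by rewrite /= expr1n expr0n addr0. Qed.

Lemma integral_cmeas D e (A : set plane) (f : plane -> \bar R) :
  e.1 ^+ 2 + e.2 ^+ 2 = 1 -> A `<=` circle D ->
  (\int[arclen D e]_(x in A) f x = \int[cmeas D]_(x in A) f x)%E.
Proof.
move=> e1 AD; rewrite -(integral_hausdorff1 e1)//.
exact: (@integral_hausdorff1 R D _ unit10).
Qed.

Lemma cmeas_arclen D e (B : set plane) : e.1 ^+ 2 + e.2 ^+ 2 = 1 ->
  measurable B -> B `<=` circle D -> cmeas D B = arclen D e B.
Proof.
move=> e1 mB BD; rewrite -(hausdorff1_arclen e1)//.
by apply/esym; exact: (hausdorff1_arclen unit10).
Qed.

Definition tker (D D' : disk R) (x y : plane) : R :=
  \1_(int_arc D' D) x * pker D x y.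

Lemma tker_in D D' x y : int_arc D' D x -> tker D D' x y = pker D x y.
Proof. by move=> xI; rewrite /tker indicE mem_set// mul1r. Qed.

Lemma tker_out D D' x y : ~ int_arc D' D x -> tker D D' x y = 0.
Proof. by move=> xI; rewrite /tker indicE memNset// mul0r. Qed.

Lemma tker_ge0 D D' x y : 0 <= tker D D' x y.
Proof.
have [xI|xI] := pselect (int_arc D' D x); last by rewrite tker_out.
by rewrite tker_in// pker_ge0//; exact: (int_arc_disk xI).
Qed.

Lemma measurable_tker D D' :
  measurable_fun [set: plane * plane] (fun z => tker D D' z.1 z.2).
Proof.
apply: measurable_funM; last exact: measurable_pker.
apply: (measurableT_comp (f := \1_(int_arc D' D) : plane -> R)) => //.
by apply: measurable_indic; exact: measurable_int_arc.
Qed.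

Lemma measurable_tkerl D D' y : measurable_fun [set: plane] (fun x => tker D D' x y).
Proof. exact: measurable_fun_pair1 (measurable_tker D D'). Qed.

Lemma measurable_tkerr D D' x : measurable_fun [set: plane] (tker D D' x).
Proof. exact: measurable_fun_pair2 (measurable_tker D D'). Qed.

Lemma measurable_corner (D D' : disk R) :
  measurable (circle D `&` [set y | edist y (center D') = radius D']).
Proof.
apply: measurableI; first exact: measurable_circle.
rewrite -[X in measurable X]setTI.
exact: (measurable_edist (center D') measurableT (measurable_set1 (radius D'))).
Qed.

Lemma corner_null D D' o e h chi psi : lens D D' o e h chi psi ->
  cmeas D' (circle D' `&` [set y | edist y (center D) = radius D]) = 0%E.
Proof.
move=> ls; have e1 : e.1 ^+ 2 + e.2 ^+ 2 = 1 by case: ls => -[].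
have mB := measurable_corner D' D.
rewrite (cmeas_arclen e1)//.
apply/eqP; rewrite eq_le measure_ge0 andbT -(arclen_line D' e1 (radius D' * cos psi)).
apply: le_measure; rewrite ?inE//.
  rewrite -[X in measurable X]setTI.
  exact: (measurable_dotc D' e measurableT (measurable_set1 _)).
by move=> y [yD' yD]; exact: (lens_corner ls yD' yD).
Qed.

End CircleMeas.

Section SchurTest.
Context {R : realType}.
Local Notation plane := (R * R)%type.

Definition test_fun (D D' : disk R) o e h (a b : R) (x : plane) : R :=
  (b + (a - b) * \1_(int_arc D D') x) * chordX o e h x.

Lemma measurable_test_fun D D' o e h a b :
  measurable_fun [set: plane] (test_fun D D' o e h a b).
Proof.
apply: measurable_funM; last exact: measurable_chordX.
apply: measurable_funD => //; apply: measurable_funM => //.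
by apply: measurable_indic; exact: measurable_int_arc.
Qed.

Lemma test_fun_int (D D' : disk R) o e h a b x : int_arc D D' x ->
  test_fun D D' o e h a b x = a * chordX o e h x.
Proof. by move=> xI; rewrite /test_fun indicE mem_set// mulr1 addrC subrK. Qed.

Lemma test_fun_ext (D D' : disk R) o e h a b x : ~ int_arc D D' x ->
  test_fun D D' o e h a b x = b * chordX o e h x.
Proof. by move=> xI; rewrite /test_fun indicE memNset// mulr0 addr0. Qed.

Lemma test_fun_ge0 (D D' : disk R) o e h a b x : 0 <= a -> 0 <= b ->
  0 <= test_fun D D' o e h a b x.
Proof.
move=> a0 b0; have [xI|xI] := pselect (int_arc D D' x).
  by rewrite test_fun_int// mulr_ge0 ?chordX_ge0.
by rewrite test_fun_ext// mulr_ge0 ?chordX_ge0.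
Qed.

Variables (D D' : disk R) (o e : plane) (h chi psi : R).
Hypothesis ls : lens D D' o e h chi psi.
Local Notation X := (chordX o e h).
Let s := sin ((chi + psi) / 2).
Let c := cos ((chi + psi) / 2).
Let frD : arc_frame D o e h chi. Proof. by case: ls. Qed.
Let frD' : arc_frame D' o (- e) h psi. Proof. by case: ls. Qed.
Let e1 : e.1 ^+ 2 + e.2 ^+ 2 = 1. Proof. by case: frD. Qed.
Let e1N : (- e).1 ^+ 2 + (- e).2 ^+ 2 = 1. Proof. by rewrite /= !sqrrN. Qed.
Let cI : 0 < chi < pi. Proof. by case: frD. Qed.
Let pI : 0 < psi < pi. Proof. by case: frD'. Qed.
Let piI : 0 < pi - psi < pi.
Proof. by case/andP: pI => ? ?; apply/andP; split; lra. Qed.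
Let h0 : 0 < h.
Proof. by case: frD => _ cI' -> _; rewrite mulr_gt0 ?radius_gt0// sin_gt0_pi. Qed.

Lemma chordX_arc x : int_arc D' D x \/ ext_open D' D x ->
  1 <= X x /\ (X x = 1 -> x = bpt o e h (pi - psi) 1 \/ x = bpt o (- e) h psi 1).
Proof.
have ge (v : R) : 0 < v -> 1 <= (v + v^-1) / 2 /\ ((v + v^-1) / 2 = 1 -> v = 1).
  move=> v0; have vn := lt0r_neq0 v0.
  have E : (v + v^-1) / 2 - 1 = (v - 1) ^+ 2 / (2 * v) by field.
  split; first by rewrite -subr_ge0 E divr_ge0 ?sqr_ge0// mulr_ge0// ltW.
  move/eqP; rewrite -subr_eq0 E mulf_eq0 invr_eq0 (gt_eqF (_ : 0 < 2 * v)) ?mulr_gt0// orbF.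
  by rewrite sqrf_eq0 subr_eq0 => /eqP.
case=> [/(int_arc_bpt ls) [v v0 ->]|/(ext_open_bpt ls) [v v0 ->]].
  rewrite chordX_bpt//; have [g1 g2] := ge v v0; split=> // /g2 ->; by left.
rewrite -chordXN chordX_bpt//; have [g1 g2] := ge v v0; split=> // /g2 ->; by right.
Qed.

Let intZ (k : R) (f : plane -> R) (A : set plane) :
  measurable A -> measurable_fun A f -> 0 <= k -> (forall y, A y -> 0 <= f y) ->
  (\int[cmeas D]_(y in A) (k * f y)%:E = k%:E * \int[cmeas D]_(y in A) (f y)%:E)%E.
Proof.
move=> mA mf k0 f0.
under eq_integral do rewrite EFinM.
rewrite ge0_integralZl_EFin//.
exact/measurable_EFinP.
Qed.

Let intZD (k : R) (f g : plane -> R) (A : set plane) :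
  measurable A -> measurable_fun A f -> measurable_fun A g -> 0 <= k ->
  (forall y, A y -> 0 <= f y) -> (forall y, A y -> 0 <= g y) ->
  (\int[cmeas D]_(y in A) (k * (f y + g y))%:E =
   k%:E * (\int[cmeas D]_(y in A) (f y)%:E + \int[cmeas D]_(y in A) (g y)%:E))%E.
Proof.
move=> mA mf mg k0 f0 g0.
rewrite intZ//; [|exact: measurable_funD|by move=> y yA; rewrite addr_ge0 ?f0 ?g0].
congr (_ * _)%E; under eq_integral do rewrite EFinD.
by rewrite ge0_integralD//; exact/measurable_EFinP.
Qed.

Let X0 x := chordX_ge0 o e h x.

Let mkX x A : measurable A -> measurable_fun A (fun y => pker D x y * X y).
Proof.
move=> mA; apply: (measurable_funS measurableT) => //.
apply: measurable_funM; last exact: measurable_chordX.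
exact: measurable_fun_pair2 (measurable_pker D).
Qed.

Let mkX' x A : measurable A -> measurable_fun A (fun y => pker D' y x * X y).
Proof.
move=> mA; apply: (measurable_funS measurableT) => //.
apply: measurable_funM; last exact: measurable_chordX.
exact: measurable_fun_pair1 (measurable_pker D').
Qed.

Lemma circle_split (f : plane -> \bar R) :
  measurable_fun [set: plane] f ->
  (forall y, 0 <= f y)%E ->
  (\int[cmeas D]_(y in circle D) f y = \int[cmeas D]_(y in int_arc D D') f y +
    \int[cmeas D]_(y in ext_open D D') f y)%E.
Proof.
move=> mf f0; have null := corner_null (lensC ls); have mN := measurable_corner D D'.
rewrite (ge0_negligible_integral mN (measurable_circle D) (measurable_funTS mf) _ null)//.
rewrite -ge0_integral_setU//.
- congr integral; rewrite int_arcE /ext_open; apply/seteqP; split => y.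
    case=> yD yN; have [l|l] := ltP (edist y (center D')) (radius D'); first by left.
    right; split=> // l'; apply: yN; split=> //=; apply/eqP; rewrite eq_le l andbT; exact: l'.
  case=> -[yD l]; split=> // -[_ /= E]; first by move: l; rewrite /open_disk/= E ltxx.
  by apply: l; rewrite /closed_disk/= E.
- exact: measurable_int_arc.
- exact: measurable_ext_open.
- exact: measurable_funTS.
- by apply/disj_setPS => y [yI /ext_openNint].
Qed.

Variables (a b a' b' l : R).
Hypotheses (a0 : 0 < a) (b0 : 0 < b) (a'0 : 0 < a') (b'0 : 0 < b').
Let E := flux_excess s c chi.
Hypothesis int_le : a * (2 * c + E) + s * b <= 2 * l * a'.
Hypothesis ext_le : a * (s + E) <= 2 * l * b'.

Let lens_half_eq : (psi + chi) / 2 = (chi + psi) / 2. Proof. by rewrite addrC. Qed.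

Lemma schur_test x : int_arc D' D x \/ ext_open D' D x -> X x != 1 ->
  (\int[cmeas D]_(y in circle D)
     ((tker D D' x y + tker D' D y x) * test_fun D D' o e h a b y)%:E <=
   (2 * l * test_fun D' D o e h a' b' x)%:E)%E.
Proof.
move=> xarc x1; have [X1 _] := chordX_arc xarc.
have [s0 c0 _] := lens_half ls; rewrite -/s -/c in s0 c0.
have E0 : 0 <= E := flux_excess_ge0 _ _ _.
have ls' := lensC ls.
have mI := measurable_int_arc D D'; have mE := measurable_ext_open D D'.
have fl y : int_arc D D' y -> 0 <= pker D' y x * X y.
  by move=> yI; rewrite mulr_ge0// (pker_ge0 _ (int_arc_disk yI)).
rewrite circle_split; last 2 first.
- apply/measurable_EFinP; apply: measurable_funM; last exact: measurable_test_fun.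
  by apply: measurable_funD; [exact: measurable_tkerr | exact: measurable_tkerl].
- by move=> y; rewrite lee_fin mulr_ge0 ?addr_ge0 ?tker_ge0 ?test_fun_ge0 ?(ltW a0) ?(ltW b0).
case: xarc => xI.
- have pk y : 0 <= pker D x y * X y by rewrite mulr_ge0// (pker_ge0 _ (int_arc_disk xI)).
  rewrite test_fun_int//.
  have fi := flux_int ls'; rewrite chordXN lens_half_eq -/s -/c -/(flux_excess s c chi) -/E in fi.
  have {}fi := fi _ xI x1.
  have pint := potential_int ls xI; have pext := potential_ext ls xI.
  rewrite -/c in pint; rewrite -/s in pext.
  rewrite (integral_cmeas _ e1N) in pint; last by rewrite int_arcE => ? [].
  rewrite (integral_cmeas _ e1N) in fi; last by rewrite int_arcE => ? [].
  rewrite (integral_cmeas _ e1) in pext; last by move=> ? [].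
  rewrite [X in (X + _)%E](_ : _ = \int[cmeas D]_(y in int_arc D D')
     (a * (pker D x y * X y + pker D' y x * X y))%:E)%E; last first.
    apply: eq_integral => y /set_mem yI; congr EFin.
    by rewrite test_fun_int// !tker_in//; ring.
  rewrite [X in (_ + X)%E](_ : _ = \int[cmeas D]_(y in ext_open D D')
     (b * (pker D x y * X y))%:E)%E; last first.
    apply: eq_integral => y /set_mem yI; congr EFin; have yN := ext_openNint yI.
    by rewrite test_fun_ext// tker_in// tker_out//; ring.
  rewrite intZD ?intZ ?(ltW a0) ?(ltW b0)//; [|exact: mkX|exact: mkX|exact: mkX'].
  apply: (@le_trans _ _ (a%:E * ((c * X x)%:E + (c * X x + E)%:E) + b%:E * (s * X x)%:E)%E).
    by apply: leeD; rewrite lee_pmul2l ?lte_fin//; apply: leeD.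
  rewrite -!EFinD lee_fin.
  have : E <= E * X x by rewrite ler_peMr.
  move=> EX; have {}EX : a * E <= a * (E * X x) by rewrite ler_pM2l.
  have : (a * (2 * c + E) + s * b) * X x <= 2 * l * a' * X x by rewrite ler_wpM2r.
  rewrite !mulrDr !mulrDl; lra.
have xN := ext_openNint xI.
rewrite test_fun_ext//.
have fi := flux_ext ls'; rewrite chordXN lens_half_eq -/s -/c in fi.
have {}fi := fi _ xI x1.
rewrite (integral_cmeas _ e1N) in fi; last by rewrite int_arcE => ? [].
rewrite [X in (X + _)%E](_ : _ = \int[cmeas D]_(y in int_arc D D')
   (a * (pker D' y x * X y))%:E)%E; last first.
  apply: eq_integral => y /set_mem yI; congr EFin.
  by rewrite test_fun_int// tker_out// tker_in//; ring.
rewrite [X in (_ + X)%E](_ : _ = 0)%E ?adde0; last first.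
  apply: integral0_eq => y yI; have yN := ext_openNint yI.
  by rewrite !tker_out// addr0 mul0r.
rewrite intZ ?(ltW a0)//; last exact: mkX'.
apply: (@le_trans _ _ (a%:E * (s * X x + E)%:E)%E).
  rewrite lee_pmul2l ?lte_fin//; apply: (le_trans fi); rewrite lee_fin lerD2l.
  by rewrite /E /flux_excess le_max lexx orbT.
rewrite -EFinM lee_fin.
have : E <= E * X x by rewrite ler_peMr.
move=> EX; have {}EX : a * E <= a * (E * X x) by rewrite ler_pM2l.
have : (a * (s + E)) * X x <= 2 * l * b' * X x by rewrite ler_wpM2r.
rewrite !mulrDr !mulrDl; lra.
Qed.

End SchurTest.

Section SchurAe.
Context {R : realType}.
Local Notation plane := (R * R)%type.

Lemma schur_test_ae (D D' : disk R) o e h chi psi (a b a' b' l : R) :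
  lens D D' o e h chi psi ->
  let s := sin ((chi + psi) / 2) in let c := cos ((chi + psi) / 2) in
  0 < a -> 0 < b -> 0 < a' -> 0 < b' ->
  a * (2 * c + flux_excess s c chi) + s * b <= 2 * l * a' ->
  a * (s + flux_excess s c chi) <= 2 * l * b' ->
  {ae cmeas D', forall x, circle D' x ->
  (\int[cmeas D]_(y in circle D)
     ((tker D D' x y + tker D' D y x) * test_fun D D' o e h a b y)%:E <=
   (2 * l * test_fun D' D o e h a' b' x)%:E)%E /\
  0 < test_fun D' D o e h a' b' x}.
Proof.
move=> ls s c a0 b0 a'0 b'0 H1 H2.
have ls' := lensC ls.
have e1 : (- e).1 ^+ 2 + (- e).2 ^+ 2 = 1 by case: ls' => -[].
pose p := bpt o e h (pi - psi) 1; pose q := bpt o (- e) h psi 1.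
pose N := circle D' `&` [set y | edist y (center D) = radius D].
have mN : measurable N := measurable_corner D' D.
have m1 (z : plane) : measurable [set z].
  rewrite (_ : [set z] = [set z.1] `*` [set z.2]).
    by apply: measurableX; exact: measurable_set1.
  by apply/seteqP; split => [_ ->//|[? ?] /= [-> ->]]; case: z.
have null1 (z : plane) : cmeas D' [set z] = 0%E := arclen_set1 D' unit10 z.
exists (N `|` ([set p] `|` [set q])); split.
- by apply: measurableU => //; exact: measurableU.
- have n2 : cmeas D' ([set p] `|` [set q]) = 0%E.
    by rewrite (measureU0 (m1 p) (m1 q)) ?null1//; exact: null1.
  rewrite (measureU0 mN (measurableU _ _ (m1 p) (m1 q)) n2).
  exact: (corner_null ls).
move=> x /=; apply: contra_notP => /not_orP[xN /not_orP[xp xq]] xC.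
have xarc : int_arc D' D x \/ ext_open D' D x.
  have [l'|l'] := ltP (edist x (center D)) (radius D); first by left; rewrite int_arcE.
  right; split=> // l2; apply: xN; split=> //=; apply/eqP; rewrite eq_le l' andbT; exact: l2.
have [X1 Xe] := chordX_arc ls xarc.
split.
  apply: (schur_test ls) => //; apply/eqP => /Xe; by case.
case: xarc => xI; first by rewrite test_fun_int// mulr_gt0// (lt_le_trans ltr01).
by rewrite (test_fun_ext _ _ _ _ _ (ext_openNint xI)) mulr_gt0// (lt_le_trans ltr01).
Qed.

End SchurAe.

Section RealL2.
Context d (T : measurableType d) (R : realType) (m : {measure set T -> \bar R}).
Variable C : set T.
Hypothesis mC : measurable C.
Implicit Types f g : T -> R.

Definition sqint f := measurable_fun C f /\ (\int[m]_(x in C) (f x ^+ 2)%:E < +oo)%E.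

Definition ip2 f g : R := \int[m]_(x in C) (f x * g x).

Lemma sqint_mul f g : sqint f -> sqint g ->
  m.-integrable C (EFin \o (fun x => f x * g x)).
Proof.
move=> [mf f2] [mg g2].
have mf2 : measurable_fun C (fun x => (f x ^+ 2)%:E) by exact/measurable_EFinP/measurable_funX.
have mg2 : measurable_fun C (fun x => (g x ^+ 2)%:E) by exact/measurable_EFinP/measurable_funX.
apply: (@le_integrable _ _ _ m C mC _ (fun x => (f x ^+ 2)%:E + (g x ^+ 2)%:E)%E).
- by apply/measurable_EFinP; exact: measurable_funM.
- move=> x _ /=; rewrite lee_fin [leRHS]ger0_norm ?addr_ge0 ?sqr_ge0// normrM.
  rewrite -[f x ^+ 2]real_normK ?num_real// -[g x ^+ 2]real_normK ?num_real//.
  have := sqr_ge0 (`|f x| - `|g x|); have := normr_ge0 (f x); have := normr_ge0 (g x).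
  by rewrite sqrrB => h1 h2; have := mulr_ge0 h1 h2; lra.
apply: integrableD => //; apply/integrableP; split=> //.
- by under eq_integral do rewrite gee0_abs ?lee_fin ?sqr_ge0//.
- by under eq_integral do rewrite gee0_abs ?lee_fin ?sqr_ge0//.
Qed.

Lemma sqint_integrable f : measurable_fun C f ->
  m.-integrable C (EFin \o (fun x => f x ^+ 2)) <-> sqint f.
Proof.
move=> mf; split.
  move=> /integrableP[_]; under eq_integral do rewrite gee0_abs ?lee_fin ?sqr_ge0//.
  by split.
by move=> fi; apply: eq_integrable (sqint_mul fi fi) => // x _; rewrite /= expr2.
Qed.

Lemma sqint_lin (a : R) f g : sqint f -> sqint g -> sqint (fun x => a * f x + g x).
Proof.
move=> fi gi; have mf := fi.1; have mg := gi.1.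
have mh : measurable_fun C (fun x => a * f x + g x).
  by apply: measurable_funD => //; apply: measurable_funM.
apply/sqint_integrable => //.
apply: (@le_integrable _ _ _ m C mC _
  (EFin \o (fun x => 2 * a ^+ 2 * f x ^+ 2 + 2 * g x ^+ 2))).
- by apply/measurable_EFinP; exact: measurable_funX.
- move=> x _ /=; rewrite lee_fin [leLHS]ger0_norm ?sqr_ge0//.
  have h1 : 0 <= 2 * a ^+ 2 * f x ^+ 2 by rewrite -mulrA -exprMn pmulr_rge0 ?sqr_ge0.
  have h2 : 0 <= 2 * g x ^+ 2 by rewrite pmulr_rge0 ?sqr_ge0.
  rewrite ger0_norm ?addr_ge0//.
  by have := sqr_ge0 (a * f x - g x); rewrite sqrrB sqrrD exprMn; lra.
have fi2 : m.-integrable C (EFin \o (fun x => f x ^+ 2)) by exact/sqint_integrable.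
have gi2 : m.-integrable C (EFin \o (fun x => g x ^+ 2)) by exact/sqint_integrable.
have := integrableD mC (integrableZl mC (2 * a ^+ 2) fi2) (integrableZl mC 2 gi2).
by apply: eq_integrable => // x _.
Qed.

Lemma ip2C f g : ip2 f g = ip2 g f.
Proof. by apply: eq_Rintegral => x _; rewrite mulrC. Qed.

Lemma ip2_lin (a : R) f g k : sqint f -> sqint g -> sqint k ->
  ip2 (fun x => a * f x + g x) k = a * ip2 f k + ip2 g k.
Proof.
move=> fi gi ki; have fk := sqint_mul fi ki; have gk := sqint_mul gi ki.
rewrite /ip2 -RintegralZl// -RintegralD//.
  by apply: eq_Rintegral => x _; rewrite mulrDl mulrA.
by apply: eq_integrable (integrableZl mC a fk) => // x _.
Qed.

Lemma ip2_ge0 f : 0 <= ip2 f f.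
Proof. by apply: Rintegral_ge0 => x _; rewrite -expr2 sqr_ge0. Qed.

Lemma ip2E f : sqint f -> (ip2 f f)%:E = (\int[m]_(x in C) (f x ^+ 2)%:E)%E.
Proof.
move=> fi; rewrite /ip2 /Rintegral fineK.
  by apply: eq_integral => x _; rewrite expr2.
exact: integrable_fin_num (sqint_mul fi fi).
Qed.

Lemma ip2_eq0 f : sqint f -> ip2 f f = 0 <-> {ae m, forall x, C x -> f x = 0}.
Proof.
move=> fi.
have mf2 : measurable_fun C (fun x => (f x ^+ 2)%:E).
  exact/measurable_EFinP/measurable_funX/(fi.1).
have E := ae_eq_integral_abs m mC mf2.
have I : (\int[m]_(x in C) `|(f x ^+ 2)%:E| = (ip2 f f)%:E)%E.
  by rewrite ip2E//; apply: eq_integral => x _; rewrite gee0_abs// lee_fin sqr_ge0.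
rewrite I in E; split.
  move=> f0; rewrite f0 in E; have := E.1 erefl.
  apply: filterS => x h xC; have := h xC => -[/eqP]; by rewrite sqrf_eq0 => /eqP.
move=> f0; apply: EFin_inj; apply/E.
by apply: filterS f0 => x h xC; rewrite h// expr0n.
Qed.

End RealL2.

Section GeometricCauchy.
Context {R : realType}.

Lemma geometric_increments (t : R) (u : R ^nat) n j : 0 < t < 1 ->
  (u (n + j)%N - u n) ^+ 2 <=
  t ^+ n / (1 - t) * \sum_(n <= k < n + j) (u k.+1 - u k) ^+ 2 / t ^+ k.
Proof.
move=> /andP[t0 t1]; have s0 : 0 < 1 - t by rewrite subr_gt0.
have tn := lt0r_neq0 t0; have sn := lt0r_neq0 s0.
elim: j n => [|j ih] n.
  by rewrite addn0 subrr expr0n/= big_geq// mulr0.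
rewrite big_ltn ?addnS ?ltnS ?leq_addr// -addSn.
set S := \sum_(_ <= _ < _) _.
have := ih n.+1; rewrite addSn -/S => {}ih.
set a := u n.+1 - u n; set b := u (n + j).+1 - u n.+1 in ih.
have -> : u (n + j).+1 - u n = a + b by rewrite /a /b; ring.
have tk := expf_neq0 n tn.
have -> : t ^+ n / (1 - t) * (a ^+ 2 / t ^+ n + S) =
  a ^+ 2 / (1 - t) + t ^+ n.+1 / (1 - t) * S / t by rewrite [t ^+ n.+1]exprS; move: (t ^+ n) tk => w wn; field; do ?[apply/andP; split].
apply: (@le_trans _ _ (a ^+ 2 / (1 - t) + b ^+ 2 / t)); last by rewrite lerD2l ler_pM2r ?invr_gt0.
rewrite -subr_ge0.
have -> : a ^+ 2 / (1 - t) + b ^+ 2 / t - (a + b) ^+ 2 = (t * a - (1 - t) * b) ^+ 2 / (t * (1 - t)).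
  by field; do ?[apply/andP; split].
by rewrite divr_ge0 ?sqr_ge0// mulr_ge0 ?(ltW t0) ?(ltW s0).
Qed.

Lemma geometric_cauchy_cvg (t G : R) (u : R ^nat) : 0 < t < 1 ->
  (forall n m, (n <= m)%N -> (u m - u n) ^+ 2 <= t ^+ n / (1 - t) * G) ->
  cvgn u /\ forall n, (limn u - u n) ^+ 2 <= t ^+ n / (1 - t) * G.
Proof.
move=> /andP[t0 t1] H; have s0 : 0 < 1 - t by rewrite subr_gt0.
have cu : cvgn u.
  apply/cauchy_cvgP; apply: cauchy_exP => e e0.
  have : (fun n => t ^+ n / (1 - t) * G) @ \oo --> (0 : R).
    rewrite (_ : 0 = 0 / (1 - t) * G); last by rewrite !mul0r.
    apply: cvgMr_tmp; apply: cvgMr_tmp; apply: cvg_expr; by rewrite gtr0_norm.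
  move=> /cvgr_lt /(_ (e ^+ 2)); rewrite exprn_gt0// => /(_ isT) [n _ Hn].
  exists (u n); exists n => //= m nm; rewrite /ball/= distrC.
  rewrite -(@ltr_pXn2r _ 2%N) ?nnegrE ?(ltW e0)// real_normK ?num_real//.
  by apply: le_lt_trans (H n m nm) _; exact: Hn n (leqnn n).
split=> // n.
have c : (fun m => (u m - u n) ^+ 2) @ \oo --> (limn u - u n) ^+ 2.
  have b : (fun m => u m - u n) @ \oo --> limn u - u n by apply: cvgB => //; exact: cvg_cst.
  by rewrite expr2; under eq_fun do rewrite expr2; exact: cvgM.
apply: (cvgr_to_le c); exists n => //= m nm; exact: H.
Qed.

Lemma geometric_sum_le (x : R) n : 0 <= x < 1 -> \sum_(0 <= k < n) x ^+ k <= (1 - x)^-1.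
Proof.
move=> /andP[x0 x1]; have s0 : 0 < 1 - x by rewrite subr_gt0.
rewrite big_mkord -[leRHS]mul1r ler_pdivlMr// mulrC -opprB mulNr -subrX1 opprB.
by rewrite gerBl exprn_ge0.
Qed.

End GeometricCauchy.

Section Completeness.
Context d (T : measurableType d) (R : realType) (m : {measure set T -> \bar R}).
Variable C : set T.
Hypothesis mC : measurable C.

Lemma sqint_complete (u : nat -> T -> R) (K q : R) : 0 <= K -> 0 <= q < 1 ->
  (forall n, sqint m C (u n)) ->
  (forall n, (\int[m]_(x in C) ((u n.+1 x - u n x) ^+ 2)%:E <= (K * q ^+ n)%:E)%E) ->
  exists (f : T -> R) (K' t : R), [/\ sqint m C f, 0 < t < 1 &
    forall n, ip2 m C (fun x => f x - u n x) (fun x => f x - u n x) <= K' * t ^+ n].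
Proof.
move=> K0 /andP[q0 q1] ui uK.
pose t := (1 + q) / 2.
have t0 : 0 < t by rewrite /t; lra.
have qt : q < t by rewrite /t; lra.
have t1 : t < 1 by rewrite /t; lra.
have t01 : 0 < t < 1 by rewrite t0.
have s0 : 0 < 1 - t by rewrite subr_gt0.
have mu n : measurable_fun C (u n) := (ui n).1.
pose g k x : R := (u k.+1 x - u k x) ^+ 2 / t ^+ k.
have g0 k x : 0 <= g k x by rewrite /g divr_ge0 ?sqr_ge0// exprn_ge0// ltW.
have mg k : measurable_fun C (EFin \o g k).
  apply/measurable_EFinP; apply: measurable_funM => //.
  by apply: measurable_funX; apply: measurable_funB.
pose G x := (\sum_(0 <= k <oo) (g k x)%:E)%E.
have G0 x : (0 <= G x)%E by apply: nneseries_ge0 => k _ _; rewrite lee_fin.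
have mG : measurable_fun C G.
  by apply: ge0_emeasurable_sum => k; [move=> x _; rewrite lee_fin | move=> _; exact: mg].
have IG : (\int[m]_(x in C) G x < +oo)%E.
  rewrite integral_nneseries//; last by move=> k x _; rewrite lee_fin.
  apply: (@le_lt_trans _ _ (K / (1 - q / t))%:E); last exact: ltry.
  apply: lime_le; first by apply: is_cvg_nneseries => k _ _; apply: integral_ge0 => x _; rewrite lee_fin.
  apply: nearW => n.
  apply: (@le_trans _ _ (\sum_(0 <= k < n) (K * (q / t) ^+ k)%:E)%E).
    apply: lee_sum => k _.
    rewrite [leLHS](_ : _ = (t ^+ k)^-1%:E * \int[m]_(x in C) ((u k.+1 x - u k x) ^+ 2)%:E)%E.
      have -> : K * (q / t) ^+ k = (t ^+ k)^-1 * (K * q ^+ k).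
        by rewrite exprMn exprVn mulrA mulrC.
      rewrite EFinM lee_pmul2l ?lte_fin ?invr_gt0 ?exprn_gt0//.
    rewrite -ge0_integralZl_EFin//.
    - by apply: eq_integral => x _; rewrite -EFinM mulrC.
    - by move=> x _; rewrite lee_fin sqr_ge0.
    - by apply/measurable_EFinP/measurable_funX/measurable_funB.
    - by rewrite invr_ge0 exprn_ge0// ltW.
  rewrite sumEFin lee_fin -mulr_sumr ler_wpM2l// geometric_sum_le//.
  by rewrite divr_ge0 ?(ltW t0)//= ltr_pdivrMr// mul1r.
have partial x : (G x < +oo)%E -> forall n p, (n <= p)%N ->
    (u p x - u n x) ^+ 2 <= t ^+ n / (1 - t) * fine (G x).
  move=> Gx n p np; rewrite -(subnKC np).
  apply: (le_trans (@geometric_increments R t (u^~ x) n (p - n) _)); first by rewrite t0 t1.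
  rewrite ler_wpM2l ?divr_ge0 ?exprn_ge0 ?(ltW t0) ?(ltW s0)//.
  rewrite -lee_fin fineK ?ge0_fin_numE// -sumEFin subnKC//.
  apply: (@le_trans _ _ (\sum_(0 <= k < p) (g k x)%:E)%E).
    rewrite (@big_cat_nat _ _ _ n 0 p)//= leeDr// sume_ge0// => k _.
    by rewrite lee_fin.
  by apply: nneseries_lim_ge => k _ _; rewrite lee_fin.
pose f x := if (G x < +oo)%E then limn (u^~ x) else 0.
have key x n : (((f x - u n x) ^+ 2)%:E <= (t ^+ n / (1 - t))%:E * G x)%E.
  have c0 : 0 < t ^+ n / (1 - t) by rewrite divr_gt0 ?exprn_gt0.
  rewrite /f; case: ifPn => Gx.
    have [_ /(_ n) h] := @geometric_cauchy_cvg R t (fine (G x)) (u^~ x) t01 (partial x Gx).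
    by rewrite -[G x]fineK ?ge0_fin_numE// -EFinM lee_fin.
  move: Gx; rewrite -leNgt leye_eq => /eqP ->.
  by rewrite gt0_muley ?lte_fin// leey.
have mf : measurable_fun C f.
  apply: (@measurable_fun_cvg _ _ _ C (fun n x => if (G x < +oo)%E then u n x else 0)).
    move=> n; apply: measurable_fun_if => //.
    - by apply: measurable_fun_lte.
    - by apply: (measurable_funS mC) (mu n) => x [].
  move=> x xC; rewrite /f; case: ifPn => Gx; last exact: cvg_cst.
  by have [] := @geometric_cauchy_cvg R t (fine (G x)) (u^~ x) t01 (partial x Gx).
have Ifn n : (\int[m]_(x in C) ((f x - u n x) ^+ 2)%:E <=
    (t ^+ n / (1 - t))%:E * \int[m]_(x in C) G x)%E.
  rewrite -ge0_integralZl_EFin//; last by rewrite divr_ge0 ?exprn_ge0 ?(ltW t0) ?(ltW s0).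
  apply: ge0_le_integral => //.
  - by move=> x _; rewrite lee_fin sqr_ge0.
  - by apply/measurable_EFinP/measurable_funX/measurable_funB.
  - exact: measurable_funeM.
have GE : (\int[m]_(x in C) G x = (fine (\int[m]_(x in C) G x))%:E)%E.
  by rewrite fineK// ge0_fin_numE// integral_ge0.
have fui n : sqint m C (fun x => f x - u n x).
  split; first exact: measurable_funB.
  by apply: le_lt_trans (Ifn n) _; rewrite GE -EFinM ltry.
exists f, ((1 - t)^-1 * fine (\int[m]_(x in C) G x)%E), t; split=> //.
  rewrite (_ : f = fun x => 1 * (f x - u 0%N x) + u 0%N x); first exact: sqint_lin.
  by apply/funext => x; rewrite mul1r subrK.
move=> n; rewrite -lee_fin ip2E//; apply: le_trans (Ifn n) _.
by rewrite GE lee_fin [leRHS]mulrC mulrA.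
Qed.

End Completeness.

Section ProductMeasurable.
Context d1 d2 (T1 : measurableType d1) (T2 : measurableType d2) (R : realType).

Lemma measurable_fun_fst (f : T1 -> R) : measurable_fun [set: T1] f ->
  measurable_fun [set: T1 * T2] (fun z => f z.1).
Proof. by move=> mf; exact: measurableT_comp mf _. Qed.

Lemma measurable_fun_snd (f : T2 -> R) : measurable_fun [set: T2] f ->
  measurable_fun [set: T1 * T2] (fun z => f z.2).
Proof. by move=> mf; exact: measurableT_comp mf _. Qed.

End ProductMeasurable.

Section SchurMarginal.
Context d1 d2 (T1 : measurableType d1) (T2 : measurableType d2) (R : realType).
Variables (m1 : {finite_measure set T1 -> \bar R}) (m2 : {finite_measure set T2 -> \bar R}).
Variables (K : T1 -> T2 -> R) (h1 : T1 -> R) (h2 : T2 -> R) (l : R).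
Hypothesis mK : measurable_fun [set: T1 * T2] (fun z => K z.1 z.2).
Hypothesis K0 : forall x y, 0 <= K x y.
Hypotheses (mh1 : measurable_fun [set: T1] h1) (mh2 : measurable_fun [set: T2] h2).
Hypotheses (h1_ge0 : forall x, 0 <= h1 x) (h2_ge0 : forall x, 0 <= h2 x).
Hypothesis l0 : 0 < l.
Hypothesis H1 : {ae m1, forall x, 0 < h1 x /\
  (\int[m2]_y (K x y * h2 y)%:E <= (2 * l * h1 x)%:E)%E}.

Lemma schur_marginal (a : T1 -> R) : measurable_fun [set: T1] a ->
  (\int[m1]_x \int[m2]_y (a x ^+ 2 / h1 x * (K x y * h2 y))%:E <=
   (2 * l)%:E * \int[m1]_x (a x ^+ 2)%:E)%E.
Proof.
move=> ma.
have l20 : 0 <= 2 * l by rewrite mulr_ge0// ltW.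
have q0 x : 0 <= a x ^+ 2 / h1 x by rewrite divr_ge0 ?sqr_ge0.
rewrite -ge0_integralZl_EFin//; [|by move=> x _; rewrite lee_fin sqr_ge0|
  by apply/measurable_EFinP; exact: measurable_funX].
apply: ae_ge0_le_integral => //.
- by move=> x _; apply: integral_ge0 => y _; rewrite lee_fin mulr_ge0// mulr_ge0.
- apply: (@measurable_fun_fubini_tonelli_F _ _ _ _ _ m2 (fun z => (a z.1 ^+ 2 / h1 z.1 * (K z.1 z.2 * h2 z.2))%:E)).
    apply/measurable_EFinP; apply: measurable_funM; last first.
      by apply: measurable_funM => //; exact: measurable_fun_snd.
    apply: measurable_funM; first by apply: measurable_funX; exact: measurable_fun_fst.
    by apply: measurable_fun_ge0_inv => [x|]; [exact: h1_ge0 | exact: measurable_fun_fst].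
  by move=> z; rewrite lee_fin mulr_ge0// mulr_ge0.
- by move=> x _; rewrite -EFinM lee_fin mulr_ge0 ?sqr_ge0.
- by apply: measurable_funeM; apply/measurable_EFinP; exact: measurable_funX.
apply: filterS H1 => x [h0 hx] _.
under eq_integral do rewrite EFinM.
rewrite ge0_integralZl_EFin//; last 2 first.
- by move=> y _; rewrite lee_fin mulr_ge0.
- by apply/measurable_EFinP/measurable_funM => //; exact: measurable_fun_pair2 mK.
apply: (@le_trans _ _ ((a x ^+ 2 / h1 x)%:E * (2 * l * h1 x)%:E)%E).
  by apply: lee_wpmul2l => //; rewrite lee_fin.
rewrite -!EFinM lee_fin le_eqVlt; apply/orP; left; apply/eqP.
by have := lt0r_neq0 h0 => hn; field.
Qed.

End SchurMarginal.

Section SchurForm.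
Context d1 d2 (T1 : measurableType d1) (T2 : measurableType d2) (R : realType).
Variables (m1 : {finite_measure set T1 -> \bar R}) (m2 : {finite_measure set T2 -> \bar R}).
Variables (K : T1 -> T2 -> R) (h1 : T1 -> R) (h2 : T2 -> R) (l : R).
Hypothesis mK : measurable_fun [set: T1 * T2] (fun z => K z.1 z.2).
Hypothesis K0 : forall x y, 0 <= K x y.
Hypotheses (mh1 : measurable_fun [set: T1] h1) (mh2 : measurable_fun [set: T2] h2).
Hypotheses (h1_ge0 : forall x, 0 <= h1 x) (h2_ge0 : forall x, 0 <= h2 x).
Hypotheses (l0 : 0 < l) (l1 : l < 1).
Hypothesis H1 : {ae m1, forall x, 0 < h1 x /\
  (\int[m2]_y (K x y * h2 y)%:E <= (2 * l * h1 x)%:E)%E}.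
Hypothesis H2 : {ae m2, forall y, 0 < h2 y /\
  (\int[m1]_x (K x y * h1 x)%:E <= (2 * l * h2 y)%:E)%E}.

Lemma schur_form (a : T1 -> R) (b : T2 -> R) :
  measurable_fun [set: T1] a -> measurable_fun [set: T2] b ->
  (forall x, 0 <= a x) -> (forall y, 0 <= b y) ->
  (\int[m1]_x \int[m2]_y (K x y * a x * b y)%:E <=
   l%:E * (\int[m1]_x (a x ^+ 2)%:E + \int[m2]_y (b y ^+ 2)%:E))%E.
Proof.
move=> ma mb a0 b0.
pose P z : R := a z.1 ^+ 2 / h1 z.1 * (K z.1 z.2 * h2 z.2).
pose Q z : R := b z.2 ^+ 2 / h2 z.2 * (K z.1 z.2 * h1 z.1).
pose F z : R := K z.1 z.2 * a z.1 * b z.2.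
have P0 z : 0 <= P z by rewrite mulr_ge0 ?divr_ge0 ?sqr_ge0// mulr_ge0.
have Q0 z : 0 <= Q z by rewrite mulr_ge0 ?divr_ge0 ?sqr_ge0// mulr_ge0.
have F0 z : 0 <= F z by rewrite !mulr_ge0.
have mP : measurable_fun setT (EFin \o P).
  apply/measurable_EFinP; apply: measurable_funM; last first.
    by apply: measurable_funM => //; exact: measurable_fun_snd.
  apply: measurable_funM; first by apply: measurable_funX; exact: measurable_fun_fst.
  by apply: measurable_fun_ge0_inv => [x|]; [exact: h1_ge0 | exact: measurable_fun_fst].
have mQ : measurable_fun setT (EFin \o Q).
  apply/measurable_EFinP; apply: measurable_funM; last first.
    by apply: measurable_funM => //; exact: measurable_fun_fst.
  apply: measurable_funM; first by apply: measurable_funX; exact: measurable_fun_snd.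
  by apply: measurable_fun_ge0_inv => [x|]; [exact: h2_ge0 | exact: measurable_fun_snd].
have mF : measurable_fun setT (EFin \o F).
  apply/measurable_EFinP; apply: measurable_funM; last exact: measurable_fun_snd.
  by apply: measurable_funM => //; exact: measurable_fun_fst.
have mPQ : measurable_fun setT (fun z => (P z)%:E + (Q z)%:E)%E by exact: emeasurable_funD.
have PQ0 z : (0 <= (P z)%:E + (Q z)%:E)%E by rewrite adde_ge0 ?lee_fin.
have mPx x : measurable_fun setT (fun y => (P (x, y))%:E) := measurable_fun_pair2 x mP.
have mQx x : measurable_fun setT (fun y => (Q (x, y))%:E) := measurable_fun_pair2 x mQ.
have mFx x : measurable_fun setT (fun y => (F (x, y))%:E) := measurable_fun_pair2 x mF.
have FPQ : (2%:E * \int[m1]_x \int[m2]_y (F (x, y))%:E <=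
    \int[m1]_x \int[m2]_y ((P (x, y))%:E + (Q (x, y))%:E))%E.
  rewrite -ge0_integralZl_EFin//; last 2 first.
  - by move=> x _; apply: integral_ge0 => y _; rewrite lee_fin.
  - by apply: (@measurable_fun_fubini_tonelli_F _ _ _ _ _ m2 _ mF) => z; rewrite lee_fin.
  apply: ae_ge0_le_integral => //.
  - by move=> x _; rewrite mule_ge0 ?lee_fin// integral_ge0// => y _; rewrite lee_fin.
  - apply: measurable_funeM; apply: (@measurable_fun_fubini_tonelli_F _ _ _ _ _ m2 _ mF) => z.
    by rewrite lee_fin.
  - by move=> x _; apply: integral_ge0 => y _.
  - exact: (@measurable_fun_fubini_tonelli_F _ _ _ _ _ m2 _ mPQ).
  apply: filterS H1 => x [hx _] _.
  rewrite -ge0_integralZl_EFin//; last by move=> y _; rewrite lee_fin.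
  apply: ae_ge0_le_integral => //.
  - by move=> y _; rewrite -EFinM lee_fin mulr_ge0.
  - exact: measurable_funeM.
  - exact: emeasurable_funD.
  apply: filterS H2 => y [hy _] _.
  rewrite -EFinM -EFinD lee_fin /F /P /Q /= -subr_ge0.
  have [hxn hyn] := (lt0r_neq0 hx, lt0r_neq0 hy).
  set k := K x y; set u := a x; set v := b y; set p := h1 x in hx hxn *; set q := h2 y in hy hyn *.
  have -> : u ^+ 2 / p * (k * q) + v ^+ 2 / q * (k * p) - 2 * (k * u * v) =
    k * ((u * q - v * p) ^+ 2 / (p * q)) by field; do ?[apply/andP; split].
  by rewrite mulr_ge0 ?K0// divr_ge0 ?sqr_ge0// mulr_ge0// ltW.
have S : (\int[m1]_x \int[m2]_y ((P (x, y))%:E + (Q (x, y))%:E) =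
   \int[m1]_x \int[m2]_y (P (x, y))%:E + \int[m2]_y \int[m1]_x (Q (x, y))%:E)%E.
  rewrite -(@fubini_tonelli _ _ _ _ _ m1 m2 _ mQ) => [|z]; last by rewrite lee_fin.
  rewrite -ge0_integralD//.
  - apply: eq_integral => x _; rewrite ge0_integralD// => y _; by rewrite lee_fin.
  - by move=> x _; apply: integral_ge0 => y _; rewrite lee_fin.
  - by apply: (@measurable_fun_fubini_tonelli_F _ _ _ _ _ m2 _ mP) => z; rewrite lee_fin.
  - by move=> x _; apply: integral_ge0 => y _; rewrite lee_fin.
  - by apply: (@measurable_fun_fubini_tonelli_F _ _ _ _ _ m2 _ mQ) => z; rewrite lee_fin.
have hP := schur_marginal mK K0 mh1 mh2 h1_ge0 h2_ge0 l0 H1 ma.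
have mK' : measurable_fun [set: T2 * T1] (fun z => K z.2 z.1).
  by apply: (measurableT_comp mK (@measurable_swap _ _ _ _)).
have hQ := @schur_marginal _ _ _ _ _ m2 m1 (fun y x => K x y) h2 h1 l mK' (fun y x => K0 x y)
  mh2 mh1 h2_ge0 h1_ge0 l0 H2 b mb.
rewrite S in FPQ; have := le_trans FPQ (leeD hP hQ).
rewrite -ge0_muleDr//; last 2 first.
- by apply: integral_ge0 => x _; rewrite lee_fin sqr_ge0.
- by apply: integral_ge0 => x _; rewrite lee_fin sqr_ge0.
by rewrite EFinM -muleA lee_pmul2l.
Qed.

Lemma schur_bound (f : T1 -> R) (b : T2 -> R) :
  measurable_fun [set: T1] f -> measurable_fun [set: T2] b -> (forall y, 0 <= b y) ->
  (forall x, (`|f x|%:E <= \int[m2]_y (K x y * b y)%:E)%E) ->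
  (\int[m1]_x (f x ^+ 2)%:E <= (l / (1 - l))%:E * \int[m2]_y (b y ^+ 2)%:E)%E.
Proof.
move=> mf mb b0 fI.
pose a n x : R := Num.min `|f x| n%:R.
have a0 n x : 0 <= a n x by rewrite le_min normr_ge0 ler0n.
have ma n : measurable_fun setT (a n) by apply: measurable_minr => //; exact: measurableT_comp.
have ma2 n : measurable_fun setT (EFin \o (fun x => a n x ^+ 2)).
  by apply/measurable_EFinP; exact: measurable_funX.
have bnd n : (\int[m1]_x (a n x ^+ 2)%:E <= (l / (1 - l))%:E * \int[m2]_y (b y ^+ 2)%:E)%E.
  have fin : (\int[m1]_x (a n x ^+ 2)%:E < +oo)%E.
    apply: (@le_lt_trans _ _ (\int[m1]_x (cst (n%:R ^+ 2)%:E x))%E).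
      apply: ge0_le_integral => //.
      - by move=> x _; rewrite lee_fin sqr_ge0.
      - exact: ma2.
      - by move=> x _ /=; rewrite lee_fin ler_pXn2r ?nnegrE ?ler0n// ge_min lexx orbT.
    by rewrite integral_cst// ltey_eq fin_numM ?fin_num_measure.
  have E := schur_form (ma n) mb (a0 n) b0.
  have L : (\int[m1]_x (a n x ^+ 2)%:E <= \int[m1]_x \int[m2]_y (K x y * a n x * b y)%:E)%E.
    apply: ge0_le_integral => //.
    - by move=> x _; rewrite lee_fin sqr_ge0.
    - exact: ma2.
    - apply: (@measurable_fun_fubini_tonelli_F _ _ _ _ _ m2 (fun z => (K z.1 z.2 * a n z.1 * b z.2)%:E)).
        apply/measurable_EFinP; apply: measurable_funM; last exact: measurable_fun_snd.
        by apply: measurable_funM => //; exact: measurable_fun_fst.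
      by move=> z; rewrite lee_fin !mulr_ge0.
    move=> x _; under eq_integral do rewrite mulrAC mulrC EFinM.
    rewrite ge0_integralZl_EFin//; last 2 first.
    - by move=> y _; rewrite lee_fin mulr_ge0.
    - by apply/measurable_EFinP/measurable_funM => //; exact: measurable_fun_pair2 mK.
    rewrite expr2 EFinM; apply: lee_wpmul2l; rewrite ?lee_fin//.
    by apply: le_trans (fI x); rewrite lee_fin ge_min lexx.
  have {L E} := le_trans L E.
  have A0 : (0 <= \int[m1]_x (a n x ^+ 2)%:E)%E.
    by apply: integral_ge0 => x _; rewrite lee_fin sqr_ge0.
  have B0 : (0 <= \int[m2]_y (b y ^+ 2)%:E)%E.
    by apply: integral_ge0 => x _; rewrite lee_fin sqr_ge0.
  have c0 : 0 < l / (1 - l) by rewrite divr_gt0// subr_gt0.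
  case: (\int[m2]_y (b y ^+ 2)%:E)%E B0 => [B| |]// B0; last by rewrite gt0_muley ?leey ?lte_fin.
  have Af : (\int[m1]_x (a n x ^+ 2)%:E)%E \is a fin_num by rewrite ge0_fin_numE.
  rewrite -(fineK Af); set A := fine _.
  rewrite -EFinD -!EFinM !lee_fin => h.
  by rewrite mulrAC ler_pdivlMr ?subr_gt0//; lra.
have c : (\int[m1]_x (a n x ^+ 2)%:E)%E @[n --> \oo] --> (\int[m1]_x (f x ^+ 2)%:E)%E.
  have := @cvg_monotone_convergence _ _ _ m1 setT measurableT (fun n x => (a n x ^+ 2)%:E) ma2.
  rewrite (_ : (\int[m1]_x (f x ^+ 2)%:E = \int[m1]_x limn (fun n => (a n x ^+ 2)%:E))%E).
    apply.
    - by move=> n x _; rewrite lee_fin sqr_ge0.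
    - move=> x _ n k nk; rewrite lee_fin ler_pXn2r ?nnegrE//.
      by rewrite /a le_min !ge_min lexx/= ler_nat nk orbT.
  apply: eq_integral => x _; apply/esym/cvg_lim => //.
  apply: cvg_near_cst; near=> n.
  rewrite /a min_l ?real_normK ?num_real//.
  by near: n; exact: nbhs_infty_ger.
by apply: (cvge_to_le c); exact: nearW.
Unshelve. all: by end_near. Qed.

End SchurForm.

Section Setup.
Context {R : realType}.
Local Notation plane := (R * R)%type.

Lemma cmeas_circleC (D : disk R) : cmeas D (~` circle D) = 0%E.
Proof. by have := @arclen_circleC R D (1, 0); apply; exact: unit10. Qed.

Lemma ge0_integral_circle (D : disk R) (f : plane -> \bar R) :
  measurable_fun [set: plane] f -> (forall y, 0 <= f y)%E ->
  (\int[cmeas D]_y f y = \int[cmeas D]_(y in circle D) f y)%E.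
Proof.
move=> mf f0; have mC := measurable_circle D.
rewrite (ge0_negligible_integral (measurableC mC) measurableT mf _ (cmeas_circleC D))//.
by rewrite setTD setCK.
Qed.

Lemma ae_circle (D : disk R) (P : plane -> Prop) :
  {ae cmeas D, forall x, circle D x -> P x} -> {ae cmeas D, forall x, P x}.
Proof.
move=> H; have hC : {ae cmeas D, forall x, circle D x}.
  by exists (~` circle D); split => //; [exact: measurableC (measurable_circle D)|exact: cmeas_circleC].
by apply: filterS2 H hC => x; apply.
Qed.

Definition sker (D1 D2 : disk R) (x y : plane) : R := tker D2 D1 x y + tker D1 D2 y x.

Lemma sker_ge0 D1 D2 x y : 0 <= sker D1 D2 x y.
Proof. by rewrite addr_ge0 ?tker_ge0. Qed.

Lemma measurable_sker D1 D2 :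
  measurable_fun [set: plane * plane] (fun z => sker D1 D2 z.1 z.2).
Proof.
apply: measurable_funD; first exact: measurable_tker.
exact: (measurableT_comp (measurable_tker D1 D2) (@measurable_swap _ _ _ _)).
Qed.

Definition schur_data (D1 D2 : disk R) (h1 h2 : plane -> R) (l : R) :=
  [/\ measurable_fun [set: plane] h1 /\ measurable_fun [set: plane] h2,
      (forall x, 0 <= h1 x) /\ (forall x, 0 <= h2 x),
      0 < l < 1,
      {ae cmeas D1, forall x, 0 < h1 x /\
        (\int[cmeas D2]_y (sker D1 D2 x y * h2 y)%:E <= (2 * l * h1 x)%:E)%E} &
      {ae cmeas D2, forall y, 0 < h2 y /\
        (\int[cmeas D1]_x (sker D1 D2 x y * h1 x)%:E <= (2 * l * h2 y)%:E)%E}].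

Lemma schur_data_exists (D1 D2 : disk R) :
  open_disk D1 `&` open_disk D2 !=set0 ->
  ~ (open_disk D1 `<=` open_disk D2) -> ~ (open_disk D2 `<=` open_disk D1) ->
  exists h1 h2 l, schur_data D1 D2 h1 h2 l.
Proof.
move=> hc h12 h21; have [ctr [e [h [chi [psi ls]]]]] := lens_exists hc h12 h21.
case: (ls) => -[_ /andP[chi0 _] _ _] [_ /andP[psi0 _] _ _] cp.
have [a1 [b1 [a2 [b2 [l [[a10 b10 a20 b20] l01 [c1 c1'] [c2 c2']]]]]]] :=
  lens_constants chi0 psi0 cp.
have ls' := lensC ls.
have A1 := schur_test_ae ls a20 b20 a10 b10 c1 c1'.
have th : psi + chi = chi + psi by rewrite addrC.
have A2 := @schur_test_ae R D1 D2 ctr (- e) h psi chi a1 b1 a2 b2 l ls'; rewrite th in A2.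
have {}A2 := A2 a10 b10 a20 b20 c2 c2'.
have tN E E' a b : @test_fun R E E' ctr (- e) h a b = test_fun E E' ctr e h a b.
  by apply/funext => x; rewrite /test_fun chordXN.
rewrite !tN in A2.
exists (test_fun D1 D2 ctr e h a1 b1), (test_fun D2 D1 ctr e h a2 b2), l.
have t10 x : 0 <= test_fun D1 D2 ctr e h a1 b1 x by rewrite test_fun_ge0 ?(ltW a10) ?(ltW b10).
have t20 x : 0 <= test_fun D2 D1 ctr e h a2 b2 x by rewrite test_fun_ge0 ?(ltW a20) ?(ltW b20).
have m1 := measurable_test_fun D1 D2 ctr e h a1 b1.
have m2 := measurable_test_fun D2 D1 ctr e h a2 b2.
split => //.
- apply: ae_circle; apply: filterS A1 => x H xC; have [Hx h0] := H xC; split => //.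
  rewrite ge0_integral_circle//.
    apply/measurable_EFinP/measurable_funM => //.
    exact: measurable_fun_pair2 (measurable_sker D1 D2).
  by move=> y; rewrite lee_fin mulr_ge0 ?sker_ge0.
- apply: ae_circle; apply: filterS A2 => x H xC; have [Hx h0] := H xC; split => //.
  rewrite ge0_integral_circle//.
  + by under eq_integral do rewrite /sker addrC.
  + apply/measurable_EFinP/measurable_funM => //.
    exact: measurable_fun_pair1 (measurable_sker D1 D2).
  + by move=> y; rewrite lee_fin mulr_ge0 ?sker_ge0.
Qed.

End Setup.

Section RealTransfer.
Context {R : realType}.
Local Notation plane := (R * R)%type.

Definition l2c (D : disk R) (f : plane -> R) := sqint (cmeas D) (circle D) f.

Definition rtrans (D D' : disk R) (f : plane -> R) (x : plane) : R :=
  \int[cmeas D]_(y in circle D) (tker D D' x y * f y).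

Lemma tker_bounded (D D' : disk R) x : exists2 M, 0 <= M &
  forall y, circle D y -> tker D D' x y <= M.
Proof.
have [xI|xI] := pselect (int_arc D' D x); last first.
  by exists 0 => // y _; rewrite tker_out.
have xD : edist x (center D) < radius D by move: xI; rewrite int_arcE => -[].
have r0 := radius_gt0 D.
pose dl := radius D - edist x (center D).
have d0 : 0 < dl by rewrite subr_gt0.
exists ((2 * pi)^-1 * (radius D ^+ 2 / (radius D * dl ^+ 2))).
  apply: mulr_ge0; first by rewrite invr_ge0 mulr_ge0 ?pi_ge0.
  by rewrite divr_ge0 ?sqr_ge0// mulr_ge0 ?sqr_ge0 ?(ltW r0).
move=> y; rewrite circleE /= => yC.
rewrite tker_in// /pker ler_wpM2l ?invr_ge0 ?mulr_ge0 ?pi_ge0//.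
have dxy : dl <= edist x y.
  by have := edist_triangle y x (center D); rewrite yC [edist y x]edistC /dl; lra.
rewrite /poisson_kernel; apply: ler_pM.
- by rewrite subr_ge0 ler_pXn2r ?nnegrE ?edist_ge0 ?(ltW r0)// (ltW xD).
- by rewrite invr_ge0 mulr_ge0 ?sqr_ge0 ?(ltW r0).
- by rewrite gerBl sqr_ge0.
have e0 : 0 < edist x y by exact: lt_le_trans dxy.
rewrite lef_pV2 ?posrE ?mulr_gt0 ?exprn_gt0//.
by rewrite ler_pM2l// ler_pXn2r ?nnegrE ?edist_ge0 ?(ltW d0).
Qed.

Lemma l2c_cst (D : disk R) (k : R) : l2c D (cst k).
Proof.
split=> //.
rewrite (_ : \int[_]_(x in _) _ = \int[cmeas D]_(x in circle D) cst (k ^+ 2)%:E x)%E//.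
rewrite integral_cst//; last exact: measurable_circle.
by rewrite ltey_eq fin_numM ?fin_num_measure//; exact: measurable_circle.
Qed.

Lemma tker_l2c D D' x : l2c D (tker D D' x).
Proof.
have mC := measurable_circle D; have [M M0 HM] := tker_bounded D D' x.
have mt : measurable_fun (circle D) (tker D D' x).
  by apply: measurable_funTS; exact: measurable_tkerr.
split=> //; apply: le_lt_trans (l2c_cst D M).2; apply: ge0_le_integral => //.
- by move=> y _; rewrite lee_fin sqr_ge0.
- by apply/measurable_EFinP/measurable_funX.
- by apply/measurable_EFinP/measurable_funX; exact: measurable_cst.
- by move=> y yC; rewrite lee_fin ler_pXn2r ?nnegrE ?tker_ge0// HM.
Qed.

Lemma rtrans_lin (D D' : disk R) (a : R) f g x : l2c D f -> l2c D g ->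
  rtrans D D' (fun y => a * f y + g y) x = a * rtrans D D' f x + rtrans D D' g x.
Proof.
move=> fi gi; have mC := measurable_circle D; have ti := tker_l2c D D' x.
have h k : rtrans D D' k x = ip2 (cmeas D) (circle D) k (tker D D' x).
  by rewrite ip2C.
by rewrite !h ip2_lin.
Qed.

Lemma l2c_norm D f : l2c D f -> l2c D (fun y => `|f y|).
Proof.
move=> [mf fi]; split; first exact: measurableT_comp.
by under eq_integral do rewrite real_normK ?num_real//.
Qed.

Lemma rtrans_ge0E D D' f x : l2c D f -> (forall y, 0 <= f y) ->
  (rtrans D D' f x)%:E = (\int[cmeas D]_y (tker D D' x y * (f \_ (circle D)) y)%:E)%E.
Proof.
move=> fi f0; have mC := measurable_circle D.
rewrite /rtrans /Rintegral fineK; last first.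
  by apply: integrable_fin_num => //; exact: (sqint_mul mC (tker_l2c D D' x) fi).
rewrite integral_mkcond; apply: eq_integral => y _; rewrite /patch.
by case: ifP => // _; rewrite mulr0.
Qed.

Lemma measurable_patch_l2c D f : l2c D f -> measurable_fun [set: plane] (f \_ (circle D)).
Proof. by move=> [mf _]; apply/(measurable_restrictT _ (measurable_circle D)). Qed.

Lemma patch_ge0 D (f : plane -> R) y : (forall y, 0 <= f y) -> 0 <= (f \_ (circle D)) y.
Proof. by move=> f0; rewrite /patch; case: ifP. Qed.

Lemma measurable_rtrans_ge0 D D' f : l2c D f -> (forall y, 0 <= f y) ->
  measurable_fun [set: plane] (rtrans D D' f).
Proof.
move=> fi f0; apply/measurable_EFinP.
rewrite (_ : EFin \o _ = fun x => \int[cmeas D]_y (tker D D' x y * (f \_ (circle D)) y)%:E)%E; last first.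
  by apply/funext => x; exact: rtrans_ge0E.
apply: (@measurable_fun_fubini_tonelli_F _ _ _ _ _ (cmeas D) (fun z => (tker D D' z.1 z.2 * (f \_ (circle D)) z.2)%:E)).
  apply/measurable_EFinP/measurable_funM; first exact: measurable_tker.
  by apply: measurableT_comp => //; exact: measurable_patch_l2c.
by move=> z; rewrite lee_fin mulr_ge0 ?tker_ge0 ?patch_ge0.
Qed.

Lemma measurable_rtrans D D' f : l2c D f -> measurable_fun [set: plane] (rtrans D D' f).
Proof.
move=> fi; have ni := l2c_norm fi; have mC := measurable_circle D.
have pi_ := sqint_lin mC 1 ni fi.
rewrite (_ : rtrans D D' f = fun x => rtrans D D' (fun y => 1 * `|f y| + f y) x - rtrans D D' (fun y => `|f y|) x).
  apply: measurable_funB; apply: measurable_rtrans_ge0 => // y.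
  by rewrite mul1r; have := ler_norm (- f y); rewrite normrN; lra.
by apply/funext => x; rewrite rtrans_lin// mul1r addrC addKr.
Qed.

Lemma rtrans_norm D D' f x : l2c D f -> `|rtrans D D' f x| <= rtrans D D' (fun y => `|f y|) x.
Proof.
move=> fi; have mC := measurable_circle D; have ti := tker_l2c D D' x.
apply: (le_trans (le_normr_Rintegral mC (sqint_mul mC ti fi))).
rewrite le_eqVlt; apply/orP; left; apply/eqP; apply: eq_Rintegral => y _.
by rewrite normrM ger0_norm ?tker_ge0.
Qed.

End RealTransfer.

Section TransferBounds.
Context {R : realType}.
Local Notation plane := (R * R)%type.
Local Notation ip D := (ip2 (cmeas D) (circle D)).
Implicit Types (D : disk R) (f g : plane -> R).

Lemma schur_dataC D1 D2 h1 h2 l : schur_data D1 D2 h1 h2 l -> schur_data D2 D1 h2 h1 l.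
Proof.
have E x y : sker D2 D1 y x = sker D1 D2 x y by rewrite /sker addrC.
move=> [[m1 m2] [h10 h20] l01 H1 H2].
split; [exact: (conj m2 m1) | exact: (conj h20 h10) | exact: l01 | |].
- by apply: filterS H2 => x [? ?]; split=> //; under eq_integral do rewrite E.
- by apply: filterS H1 => x [? ?]; split=> //; under eq_integral do rewrite E.
Qed.

Lemma integral_patch_sqr D f :
  (\int[cmeas D]_y ((f \_ (circle D)) y ^+ 2)%:E = \int[cmeas D]_(y in circle D) (f y ^+ 2)%:E)%E.
Proof.
rewrite [RHS]integral_mkcond; apply: eq_integral => y _; rewrite /patch.
by case: ifP => // _; rewrite expr0n.
Qed.

Lemma ip_norm D f : ip D (fun x => `|f x|) (fun x => `|f x|) = ip D f f.
Proof. by apply: eq_Rintegral => x _; rewrite -normrM ger0_norm// -expr2 sqr_ge0. Qed.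

Lemma rtrans_bound D1 D2 h1 h2 l f : schur_data D1 D2 h1 h2 l -> l2c D2 f ->
  l2c D1 (rtrans D2 D1 f) /\
  ip D1 (rtrans D2 D1 f) (rtrans D2 D1 f) <= l / (1 - l) * ip D2 f f.
Proof.
move=> [[m1 m2] [h10 h20] /andP[l0 l1] H1 H2] fi.
have ni := l2c_norm fi; have mC := measurable_circle D1.
have mT := @measurable_rtrans R D2 D1 f fi.
have B : (\int[cmeas D1]_x (rtrans D2 D1 f x ^+ 2)%:E <= (l / (1 - l) * ip D2 f f)%:E)%E.
  have := @schur_bound _ _ _ _ R (cmeas D1) (cmeas D2) (sker D1 D2) h1 h2 l
    (measurable_sker D1 D2) (sker_ge0 D1 D2) m1 m2 h10 h20 l0 l1 H1 H2
    (rtrans D2 D1 f) _ mT (measurable_patch_l2c ni).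
  rewrite integral_patch_sqr -(ip2E (measurable_circle D2) ni) -EFinM ip_norm.
  apply; first by move=> y; exact: patch_ge0.
  move=> x; apply: (@le_trans _ _ (rtrans D2 D1 (fun y => `|f y|) x)%:E).
    by rewrite lee_fin rtrans_norm.
  rewrite rtrans_ge0E//; apply: ge0_le_integral => //.
  - by move=> y _; rewrite lee_fin mulr_ge0 ?tker_ge0 ?patch_ge0.
  - apply/measurable_EFinP/measurable_funM; last exact: measurable_patch_l2c.
    exact: measurable_tkerr.
  - apply/measurable_EFinP/measurable_funM; last exact: measurable_patch_l2c.
    exact: measurable_fun_pair2 (measurable_sker D1 D2).
  - by move=> y _; rewrite lee_fin ler_wpM2r ?patch_ge0// lerDl tker_ge0.
have B1 : (\int[cmeas D1]_(x in circle D1) (rtrans D2 D1 f x ^+ 2)%:E <= (l / (1 - l) * ip D2 f f)%:E)%E.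
  rewrite -ge0_integral_circle//; first by apply/measurable_EFinP/measurable_funX.
  by move=> y; rewrite lee_fin sqr_ge0.
have Ti : l2c D1 (rtrans D2 D1 f).
  by split; [exact: measurable_funTS | apply: le_lt_trans B1 _; exact: ltry].
by split=> //; rewrite -lee_fin ip2E.
Qed.

Lemma ip_rtrans_le D1 D2 f1 f2 : l2c D1 f1 -> l2c D2 f2 -> l2c D1 (rtrans D2 D1 f2) ->
  ((ip D1 (rtrans D2 D1 f2) f1)%:E <= \int[cmeas D1]_x \int[cmeas D2]_y
    (tker D2 D1 x y * ((fun x => `|f1 x|) \_ (circle D1)) x *
       ((fun y => `|f2 y|) \_ (circle D2)) y)%:E)%E.
Proof.
move=> f1i f2i Ti; have mC := measurable_circle D1.
have [n1 n2 nT] := And3 (l2c_norm f1i) (l2c_norm f2i) (l2c_norm Ti).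
have [p1 p2] := (measurable_patch_l2c n1, measurable_patch_l2c n2).
have a0 x : 0 <= ((fun x => `|f1 x|) \_ (circle D1)) x by rewrite patch_ge0.
have b0 x : 0 <= ((fun x => `|f2 x|) \_ (circle D2)) x by rewrite patch_ge0.
have I1 := sqint_mul mC Ti f1i; have I2 := sqint_mul mC nT n1.
apply: (@le_trans _ _ (\int[cmeas D1]_(x in circle D1) (`|rtrans D2 D1 f2 x| * `|f1 x|)%:E)%E).
  rewrite -[leRHS]fineK; last exact: (integrable_fin_num mC I2).
  rewrite lee_fin; apply: le_Rintegral => // x _.
  by rewrite -normrM ler_norm.
rewrite integral_mkcond; apply: ge0_le_integral => //.
- by move=> x _; rewrite /patch; case: ifP => // _; rewrite lee_fin mulr_ge0.
- by apply/(measurable_restrictT _ mC); case/integrableP: I2.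
- apply: (@measurable_fun_fubini_tonelli_F _ _ _ _ _ (cmeas D2) (fun z => (tker D2 D1 z.1 z.2 *
    ((fun x => `|f1 x|) \_ (circle D1)) z.1 * ((fun y => `|f2 y|) \_ (circle D2)) z.2)%:E)).
    apply/measurable_EFinP/measurable_funM; last by apply: measurableT_comp.
    by apply: measurable_funM; [exact: measurable_tker | exact: measurableT_comp].
  by move=> z; rewrite lee_fin mulr_ge0 ?b0// mulr_ge0 ?tker_ge0 ?a0.
move=> x _; rewrite {1}/patch; case: ifPn => xC; last first.
  by apply: integral_ge0 => y _; rewrite lee_fin mulr_ge0 ?b0// mulr_ge0 ?tker_ge0 ?a0.
under eq_integral do rewrite mulrAC mulrC EFinM.
rewrite ge0_integralZl_EFin//; last 2 first.
- by move=> y _; rewrite lee_fin mulr_ge0 ?tker_ge0 ?b0.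
- by apply/measurable_EFinP/measurable_funM => //; exact: measurable_tkerr.
rewrite -rtrans_ge0E// -EFinM lee_fin mulrC /patch xC ler_wpM2l//.
exact: rtrans_norm.
Qed.

Lemma ip_rtrans_form D1 D2 h1 h2 l f1 f2 : schur_data D1 D2 h1 h2 l ->
  l2c D1 f1 -> l2c D2 f2 ->
  ip D1 (rtrans D2 D1 f2) f1 + ip D2 (rtrans D1 D2 f1) f2 <= l * (ip D1 f1 f1 + ip D2 f2 f2).
Proof.
move=> sd f1i f2i.
have [T1 _] := rtrans_bound sd f2i; have [T2 _] := rtrans_bound (schur_dataC sd) f1i.
case: sd => [[m1 m2] [h10 h20] /andP[l0 l1] H1 H2].
have [n1 n2] := (l2c_norm f1i, l2c_norm f2i).
have [p1 p2] := (measurable_patch_l2c n1, measurable_patch_l2c n2).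
have A1 := ip_rtrans_le f1i f2i T1; have A2 := ip_rtrans_le f2i f1i T2.
pose a := (fun x => `|f1 x|) \_ (circle D1); pose b := (fun x => `|f2 x|) \_ (circle D2).
rewrite -/a -/b in p1 p2 A1 A2.
have a0 x : 0 <= a x by rewrite patch_ge0.
have b0 x : 0 <= b x by rewrite patch_ge0.
have S := schur_form (measurable_sker D1 D2) (sker_ge0 D1 D2) m1 m2 h10 h20 l0 H1 H2 p1 p2 a0 b0.
pose F (z : plane * plane) := (tker D2 D1 z.1 z.2 * a z.1 * b z.2)%:E.
pose G (z : plane * plane) := (tker D1 D2 z.2 z.1 * b z.2 * a z.1)%:E.
have F0 z : (0 <= F z)%E by rewrite lee_fin mulr_ge0 ?b0// mulr_ge0 ?tker_ge0 ?a0.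
have G0 z : (0 <= G z)%E by rewrite lee_fin mulr_ge0 ?a0// mulr_ge0 ?tker_ge0 ?b0.
have ma : measurable_fun setT (fun z : plane * plane => a z.1) by exact: measurableT_comp.
have mb : measurable_fun setT (fun z : plane * plane => b z.2) by exact: measurableT_comp.
have mF : measurable_fun setT F.
  by apply/measurable_EFinP/measurable_funM => //; apply: measurable_funM => //; exact: measurable_tker.
have mG : measurable_fun setT G.
  apply/measurable_EFinP/measurable_funM => //; apply: measurable_funM => //.
  exact: (measurableT_comp (measurable_tker D1 D2) (@measurable_swap _ _ _ _)).
have {}A2 : ((ip D2 (rtrans D1 D2 f1) f2)%:E <= \int[cmeas D1]_x \int[cmeas D2]_y G (x, y))%E.
  by rewrite (@fubini_tonelli _ _ _ _ _ (cmeas D1) (cmeas D2) G mG G0).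
have SE : (\int[cmeas D1]_x \int[cmeas D2]_y (sker D1 D2 x y * a x * b y)%:E =
   \int[cmeas D1]_x \int[cmeas D2]_y F (x, y) + \int[cmeas D1]_x \int[cmeas D2]_y G (x, y))%E.
  have IF x : (0 <= \int[cmeas D2]_y F (x, y))%E by apply: integral_ge0 => y _; exact: F0.
  have IG x : (0 <= \int[cmeas D2]_y G (x, y))%E by apply: integral_ge0 => y _; exact: G0.
  have mIF := @measurable_fun_fubini_tonelli_F _ _ _ _ _ (cmeas D2) F mF F0.
  have mIG := @measurable_fun_fubini_tonelli_F _ _ _ _ _ (cmeas D2) G mG G0.
  rewrite -(ge0_integralD _ measurableT (fun x _ => IF x) mIF (fun x _ => IG x) mIG).
  apply: eq_integral => x _.
  have mFx := measurable_fun_pair2 x mF; have mGx := measurable_fun_pair2 x mG.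
  rewrite -(ge0_integralD _ measurableT (fun y _ => F0 (x, y)) mFx (fun y _ => G0 (x, y)) mGx).
  by apply: eq_integral => y _; rewrite /F /G /sker -EFinD; congr EFin => /=; ring.
rewrite SE in S; have {SE} := le_trans (leeD A1 A2) S.
rewrite /a /b !integral_patch_sqr -(ip2E (measurable_circle D1) n1) -(ip2E (measurable_circle D2) n2).
by rewrite !ip_norm -!EFinD -EFinM lee_fin.
Qed.

End TransferBounds.

Section SemiInner.
Context {R : realType} (V : lmodType R).
Variables (H : set V) (B : V -> V -> R).

Record semi_inner : Prop := SemiInner {
  dom0 : H 0;
  dom_lin : forall (a : R) u v, H u -> H v -> H (a *: u + v);
  formC : forall u v, B u v = B v u;
  form_lin : forall (a : R) u v w, H u -> H v -> H w -> B (a *: u + v) w = a * B u w + B v w;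
  form_ge0 : forall u, 0 <= B u u }.

Hypothesis si : semi_inner.

Lemma domZ a u : H u -> H (a *: u).
Proof. by move=> hu; rewrite -[_ *: _]addr0; apply: dom_lin => //; exact: dom0. Qed.

Lemma domN u : H u -> H (- u).
Proof. by move=> hu; rewrite -scaleN1r; exact: domZ. Qed.

Lemma domD u v : H u -> H v -> H (u + v).
Proof. by move=> hu hv; rewrite -[u]scale1r; exact: dom_lin. Qed.

Lemma domB u v : H u -> H v -> H (u - v).
Proof. by move=> hu hv; apply: domD => //; exact: domN. Qed.

Lemma form0l w : H w -> B 0 w = 0.
Proof.
move=> hw; have := form_lin si 1 (dom0 si) (dom0 si) hw.
by rewrite scale1r addr0 mul1r => /eqP; rewrite -subr_eq0 opprD addNKr oppr_eq0 => /eqP.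
Qed.

Lemma formZl a u w : H u -> H w -> B (a *: u) w = a * B u w.
Proof.
by move=> hu hw; rewrite -[a *: u]addr0 (form_lin si)// ?form0l ?addr0//; exact: dom0.
Qed.

Lemma formDl u v w : H u -> H v -> H w -> B (u + v) w = B u w + B v w.
Proof. by move=> hu hv hw; rewrite -[u]scale1r (form_lin si)// scale1r mul1r. Qed.

Lemma formBl u v w : H u -> H v -> H w -> B (u - v) w = B u w - B v w.
Proof.
move=> hu hv hw; rewrite formDl//; last exact: domN.
by rewrite -scaleN1r formZl// mulN1r.
Qed.

Lemma formDr u v w : H u -> H v -> H w -> B w (u + v) = B w u + B w v.
Proof. by move=> *; rewrite formC// formDl// ![B _ w](formC si). Qed.

Lemma formZr a u w : H u -> H w -> B w (a *: u) = a * B w u.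
Proof. by move=> *; rewrite (formC si) formZl// (formC si). Qed.

Lemma form_sqrD a u v : H u -> H v ->
  B (u + a *: v) (u + a *: v) = B u u + 2 * a * B u v + a ^+ 2 * B v v.
Proof.
move=> hu hv; have hav := domZ a hv; have hs := domD hu hav.
rewrite formDl// !formDr// !formZl// !formZr// (formC si v u); ring.
Qed.

Lemma form_null u v : H u -> H v -> B v v = 0 -> B u v = 0.
Proof.
move=> hu hv v0; apply/eqP; rewrite -[_ == _]negbK; apply/negP => uv.
have := form_ge0 si (u + (- (B u u + 1) / (2 * B u v)) *: v).
rewrite form_sqrD// v0 mulr0 addr0.
have -> : 2 * (- (B u u + 1) / (2 * B u v)) * B u v = - (B u u + 1) by field.
by lra.
Qed.

Lemma form_null_sub u v w : H u -> H v -> H w -> B (u - w) (u - w) = 0 ->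
  B (v - w) (v - w) = 0 -> B (u - v) (u - v) = 0.
Proof.
move=> hu hv hw un vn; have [huw hvw] := (domB hu hw, domB hv hw).
have -> : u - v = (u - w) - (v - w) by rewrite opprB addrA subrK.
have hd := domB huw hvw.
rewrite formBl// (formC si (u - w)) (formC si (v - w)).
by rewrite (form_null hd huw un) (form_null hd hvw vn) subrr.
Qed.

Lemma form_le2 u v : H u -> H v -> B (u + v) (u + v) <= 2 * B u u + 2 * B v v.
Proof.
move=> hu hv; have h1 := form_ge0 si (u + (-1) *: v); rewrite form_sqrD// in h1.
by have := form_sqrD 1 hu hv; rewrite scale1r => ->; lra.
Qed.

Definition null_closure (W : set V) : set V := [set u | H u /\ exists2 s, W s & B (u - s) (u - s) = 0].

Section Operator.
Variables (A : V -> V) (eps M : R).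

Record coercive_op : Prop := CoerciveOp {
  op_dom : forall u, H u -> H (A u);
  op_lin : forall (a : R) u v, H u -> H v -> A (a *: u + v) = a *: A u + A v;
  op_gap_gt0 : 0 < eps;
  op_coercive : forall u, H u -> eps * B u u <= B (A u) u;
  op_bounded : forall u, H u -> B (A u) (A u) <= M * B u u }.

Hypothesis co : coercive_op.

Lemma opB u v : H u -> H v -> A (u - v) = A u - A v.
Proof.
by move=> hu hv; rewrite addrC -scaleN1r (op_lin co)// scaleN1r addrC.
Qed.

Lemma op0 : A 0 = 0.
Proof. by have := opB (dom0 si) (dom0 si); rewrite !subrr. Qed.

Lemma opZ a u : H u -> A (a *: u) = a *: A u.
Proof.
by move=> hu; have := op_lin co a hu (dom0 si); rewrite op0 !addr0.
Qed.

Lemma op_null u : H u -> B (A u) u = 0 -> B u u = 0.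
Proof.
move=> hu h; have := op_coercive co hu; rewrite h pmulr_rle0 ?(op_gap_gt0 co)// => le0.
by apply/eqP; rewrite eq_le le0 (form_ge0 si).
Qed.

Lemma op_inj u v : H u -> H v -> B (A u - A v) (A u - A v) = 0 -> B (u - v) (u - v) = 0.
Proof.
move=> hu hv h; apply: op_null; first exact: domB.
rewrite (formC si) opB//; apply: form_null => //; first exact: domB.
by apply: domB; exact: (op_dom co).
Qed.

Definition galerkin (W : set V) := forall g, H g ->
  exists2 u, W u & forall q, W q -> B (A u - g) q = 0.

Definition subspace (W : set V) := [/\ W `<=` H, W 0 &
  forall (a : R) u v, W u -> W v -> W (a *: u + v)].

Definition adjoin (W : set V) (e : V) : set V :=
  [set u | exists w (c : R), W w /\ u = w + c *: e].

Lemma subspace_adjoin W e : subspace W -> H e -> subspace (adjoin W e).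
Proof.
move=> [WH W0 WL] he; split.
- by move=> _ [w [c [ww ->]]]; apply: domD; [exact: WH | exact: domZ].
- by exists 0, 0; rewrite scale0r addr0.
- move=> a _ _ [w [c [ww ->]]] [w' [c' [ww' ->]]].
  exists (a *: w + w'), (a * c + c'); split; first exact: WL.
  by rewrite scalerDr scalerA scalerDl addrACA.
Qed.

Lemma galerkin_adjoin W e : subspace W -> H e -> galerkin W -> galerkin (adjoin W e).
Proof.
move=> [WH W0 WL] he GW g hg.
have [we wwe owe] := GW (A e) (op_dom co he).
have hwe := WH _ wwe.
pose e' := e - we; have he' : H e' by exact: domB.
have oe q : W q -> B (A e') q = 0.
  move=> wq; have hq := WH _ wq; rewrite opB// formBl//; [|exact: op_dom|exact: op_dom].
  have := owe q wq; rewrite formBl//; [lra|exact: op_dom|exact: op_dom].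
have [u0 wu0 ou0] := GW g hg; have hu0 := WH _ wu0.
have hr : H (A u0 - g) by apply: domB => //; exact: op_dom.
pose c := - B (A u0 - g) e' / B (A e') e'.
have wN q : W q -> W (- q).
  by move=> wq; rewrite -[- q]addr0 -scaleN1r; exact: WL.
have wD p q : W p -> W q -> W (p + q).
  by move=> wp wq; rewrite -[p]scale1r; exact: WL.
have wZ a q : W q -> W (a *: q) by move=> wq; rewrite -[_ *: _]addr0; exact: WL.
exists (u0 + c *: e').
  exists (u0 - c *: we), c; split; first by apply: wD => //; apply: wN; exact: wZ.
  by rewrite /e' scalerBr addrAC addrA.
have AuE : A (u0 + c *: e') - g = (A u0 - g) + c *: A e'.
  by rewrite [u0 + _]addrC (op_lin co)// [_ *: _ + _]addrC addrAC.
have hAe : H (A e') by exact: op_dom.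
have ortho q : H q -> B (A (u0 + c *: e') - g) q = B (A u0 - g) q + c * B (A e') q.
  by move=> hq; rewrite AuE formDl ?formZl//; exact: domZ.
have ortho_e : B (A (u0 + c *: e') - g) e' = 0.
  rewrite ortho// /c; have [E|E] := eqVneq (B (A e') e') 0.
    by rewrite E mulr0 addr0 form_null//; exact: op_null.
  by field.
move=> _ [q [a [wq ->]]].
have -> : q + a *: e = (q + a *: we) + a *: e'.
  by rewrite /e' scalerBr addrACA subrr addr0.
have wq' : W (q + a *: we) by apply: wD => //; exact: wZ.
have hq' := WH _ wq'.
have hL : H (A (u0 + c *: e') - g) by rewrite AuE; apply: domD => //; exact: domZ.
rewrite formDr//; last exact: domZ.
by rewrite formZr// ortho_e mulr0 addr0 ortho// ou0// oe// mulr0 addr0.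
Qed.

Lemma galerkin0 : galerkin [set 0].
Proof.
move=> g hg; exists 0 => // _ ->; rewrite (formC si) form0l//.
by apply: domB => //; apply: op_dom => //; exact: dom0.
Qed.

Hypothesis M0 : 0 < M.

Lemma form_geometric_null v (K t : R) : 0 <= t < 1 ->
  (forall n, B v v <= K * t ^+ n) -> B v v = 0.
Proof.
move=> /andP[t0 t1] h; apply/eqP; rewrite eq_le form_ge0// andbT.
have c : (fun n => K * t ^+ n) @ \oo --> (0 : R).
  rewrite -(mulr0 K); apply: cvgMl_tmp; apply: cvg_expr; by rewrite ger0_norm.
by apply: (cvgr_to_ge c); exact: nearW.
Qed.

Hypothesis cmpl : forall (u : nat -> V) (K q : R), 0 <= K -> 0 <= q < 1 ->
  (forall n, H (u n)) ->
  (forall n, B (u n.+1 - u n) (u n.+1 - u n) <= K * q ^+ n) ->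
  exists f (K' t : R), [/\ H f, 0 < t < 1 &
    forall n, B (f - u n) (f - u n) <= K' * t ^+ n].

Lemma coercive_solve g : H g -> exists2 u, H u & B (A u - g) (A u - g) = 0.
Proof.
move=> hg; have e0 := op_gap_gt0 co.
pose N := M + eps ^+ 2; have N0 : 0 < N by rewrite addr_gt0 ?exprn_gt0.
have Nn := lt0r_neq0 N0.
have leN u : H u -> B (A u) (A u) <= N * B u u.
  move=> hu; apply: le_trans (op_bounded co hu) _.
  by rewrite ler_wpM2r ?form_ge0// lerDl sqr_ge0.
pose s := eps / N; have s0 : 0 < s by rewrite divr_gt0.
pose q := 1 - eps ^+ 2 / N.
have q01 : 0 <= q < 1.
  rewrite /q subr_ge0 ler_pdivrMr// mul1r lerDr (ltW M0)/=.
  by rewrite ltrBlDr ltrDl divr_gt0 ?exprn_gt0.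
pose u := fix u n := if n is n'.+1 then u n' - s *: (A (u n') - g) else 0.
have hu n : H (u n).
  elim: n => [|n ih] /=; first exact: dom0.
  by apply: domB => //; apply: domZ; apply: domB => //; exact: op_dom.
pose r n := A (u n) - g.
have hr n : H (r n) by apply: domB => //; exact: op_dom.
have rS n : r n.+1 = r n + (- s) *: A (r n).
  rewrite /r /= -/(r n) opB//; last exact: domZ.
  rewrite opZ//.
  by rewrite scaleNr addrAC.
have rq n : B (r n.+1) (r n.+1) <= q * B (r n) (r n).
  have hA : H (A (r n)) by exact: op_dom.
  rewrite rS form_sqrD// (formC si (r n)).
  have h1 := op_coercive co (hr n); have h2 := leN _ (hr n).
  have h3 : s * (eps * B (r n) (r n)) <= s * B (A (r n)) (r n) by rewrite ler_pM2l.
  have h4 : s ^+ 2 * B (A (r n)) (A (r n)) <= s ^+ 2 * (N * B (r n) (r n)).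
    by rewrite ler_pM2l// exprn_gt0.
  have E : s ^+ 2 * (N * B (r n) (r n)) = s * (eps * B (r n) (r n)) by rewrite /s; field.
  have E2 : q * B (r n) (r n) = B (r n) (r n) - s * (eps * B (r n) (r n)) by rewrite /q /s; field.
  rewrite E2 sqrrN; move: h3 h4; rewrite E; lra.
have rn n : B (r n) (r n) <= B (r 0%N) (r 0%N) * q ^+ n.
  elim: n => [|n ih]; first by rewrite expr0 mulr1.
  apply: le_trans (rq n) _; rewrite exprS mulrCA ler_wpM2l//; by case/andP: q01.
have [||f [K' [t [hf t01 Kf]]]] := @cmpl u (s ^+ 2 * B (r 0%N) (r 0%N)) q _ q01 hu.
- by rewrite mulr_ge0 ?sqr_ge0 ?form_ge0.
- move=> n; have -> : u n.+1 - u n = (- s) *: r n by rewrite /= addrC addKr scaleNr.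
  rewrite formZl ?formZr//; last exact: domZ.
  by rewrite mulrA mulrNN -expr2 -mulrA ler_pM2l ?exprn_gt0.
have hres n : H (A (f - u n)) by apply: op_dom => //; exact: domB.
case/andP: (t01) (q01) => t0 t1 /andP[q0 q1].
pose T := Num.max t q.
have T01 : 0 <= T < 1 by rewrite le_max (ltW t0) gt_max t1.
exists f => //.
apply: (@form_geometric_null _ (2 * (N * `|K'|) + 2 * B (r 0%N) (r 0%N)) T T01) => n.
have -> : A f - g = A (f - u n) + r n by rewrite opB// /r addrA subrK.
apply: le_trans (form_le2 (hres n) (hr n)) _.
have tT : t ^+ n <= T ^+ n by rewrite lerXn2r ?nnegrE ?le_max ?(ltW t0) ?lexx.
have qT : q ^+ n <= T ^+ n by rewrite lerXn2r ?nnegrE ?le_max ?q0 ?lexx ?orbT.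
rewrite [leRHS]mulrDl -!mulrA; apply: lerD; rewrite ler_pM2l//.
  apply: le_trans (leN _ (domB hf (hu n))) _; rewrite ler_pM2l//.
  apply: le_trans (Kf n) _; apply: (@le_trans _ _ (`|K'| * t ^+ n)).
    by rewrite ler_wpM2r ?ler_norm// exprn_ge0// ltW.
  by rewrite ler_wpM2l.
by apply: le_trans (rn n) _; rewrite ler_wpM2l// form_ge0.
Qed.

End Operator.

Section Discrete.
Variables (A : V -> V) (eps M : R).
Hypothesis co : coercive_op A eps M.
Variable W : set V.
Hypothesis sW : subspace W.

Lemma subspace_null_closure : subspace (null_closure W).
Proof.
case: sW => WH W0 WL; split.
- by move=> u [].
- by split; [exact: dom0 | exists 0 => //; rewrite subrr form0l//; exact: dom0].
move=> a u v [hu [s ws us]] [hv [t wt vt]]; split; first exact: dom_lin.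
exists (a *: s + t); first exact: WL.
have [hs ht] := (WH _ ws, WH _ wt); have [hus hvt] := (domB hu hs, domB hv ht).
have -> : a *: u + v - (a *: s + t) = a *: (u - s) + (v - t).
  by rewrite scalerBr opprD addrACA.
have hw : H (a *: (u - s) + (v - t)) by exact: dom_lin.
rewrite (form_lin si)// (formC si (u - s)) (formC si (v - t)).
by rewrite (form_null hw hus us) (form_null hw hvt vt) mulr0 addr0.
Qed.

Lemma galerkin_null_closure : galerkin A W -> galerkin A (null_closure W).
Proof.
case: sW => WH W0 WL GW g hg; have [u wu ou] := GW g hg; have hu := WH _ wu.
exists u; first by split=> //; exists u => //; rewrite subrr form0l//; exact: dom0.
move=> q [hq [s ws qs]]; have hs := WH _ ws.
have hr : H (A u - g) by apply: domB => //; exact: (op_dom co).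
rewrite -[q](subrK s) formDr//; last exact: domB.
by rewrite (ou s ws) addr0 form_null//; exact: domB.
Qed.

Variable P : V -> V.
Hypothesis PW : forall u, H u -> null_closure W (P u).
Hypothesis Port : forall u q, H u -> null_closure W q -> B (u - P u) q = 0.

Let WN := subspace_null_closure.
Let WNH u : null_closure W u -> H u. Proof. by case. Qed.
Let WNB u v : null_closure W u -> null_closure W v -> null_closure W (u - v).
Proof.
case: WN => _ _ WL wu wv; rewrite addrC -scaleN1r; exact: WL.
Qed.

Lemma proj_eqP u v : H u -> H v ->
  B (P u - P v) (P u - P v) = 0 <-> (forall q, null_closure W q -> B (u - v) q = 0).
Proof.
move=> hu hv; have [pu pv] := (PW hu, PW hv); have [hpu hpv] := (WNH pu, WNH pv).
have E q : null_closure W q -> B (P u - P v) q = B (u - v) q.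
  move=> wq; have hq := WNH wq; have := Port hu wq; have := Port hv wq.
  by rewrite !formBl//; lra.
split=> h; last by rewrite E ?h//; exact: WNB.
move=> q wq; rewrite -E//; rewrite formC//; apply: form_null => //; first exact: WNH.
exact: domB.
Qed.

Lemma proj_id u : null_closure W u -> B (u - P u) (u - P u) = 0.
Proof. by move=> wu; have hu := WNH wu; apply: Port => //; apply: WNB => //; exact: PW. Qed.

Lemma discrete_solve g : galerkin A W -> H g ->
  exists2 u, null_closure W u & B (P (A (P u)) - P g) (P (A (P u)) - P g) = 0 /\
    forall v, null_closure W v -> B (P (A (P v)) - P g) (P (A (P v)) - P g) = 0 ->
      B (v - u) (v - u) = 0.
Proof.
move=> GW hg; have [u wu ou] := galerkin_null_closure GW hg.
have AP v q : null_closure W v -> null_closure W q -> B (A (P v) - g) q = B (A v - g) q.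
  move=> wv wq; have hq := WNH wq; have hv := WNH wv; have hp := WNH (PW hv).
  have hd : H (v - P v) by exact: domB.
  have : B (A (v - P v)) q = 0.
    rewrite formC//; apply: form_null => //; first exact: (op_dom co).
    apply/eqP; rewrite eq_le form_ge0// andbT.
    by apply: le_trans (op_bounded co hd) _; rewrite proj_id// mulr0.
  by rewrite (opB co)// !formBl//; try exact: (op_dom co); lra.
have eqv v : null_closure W v -> B (P (A (P v)) - P g) (P (A (P v)) - P g) = 0 <->
    forall q, null_closure W q -> B (A v - g) q = 0.
  move=> wv; have hAP : H (A (P v)) by apply: (op_dom co); apply: WNH; apply: PW; exact: WNH.
  rewrite proj_eqP//; split=> h q wq; first by rewrite -AP// h.
  by rewrite AP// h.
exists u => //; split; first by apply/eqv.
move=> v wv /(eqv v wv) ov; have [hu hv] := (WNH wu, WNH wv).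
have [hAu hAv] := (op_dom co hu, op_dom co hv).
apply: (op_null co); first exact: domB.
have wd : null_closure W (v - u) by exact: WNB.
have hd := WNH wd.
have := ou _ wd; have := ov _ wd; rewrite (opB co)// !(formBl _ _ hd)//; lra.
Qed.

End Discrete.
End SemiInner.

Local Open Scope complex_scope.

Section ComplexFunctions.
Context {R : realType}.
Local Notation plane := (R * R)%type.
Local Notation fct := (plane -> R[i]).

Definition cfun : Type := plane -> R[i].

HB.instance Definition _ := GRing.Zmodule.copy cfun (plane -> R[i]).

Definition cfun_scale (a : R) (f : cfun) : cfun := fun x => a%:C * f x.

Fact cfun_scaleA a b f : cfun_scale a (cfun_scale b f) = cfun_scale (a * b) f.
Proof. by apply/funext => x; rewrite /cfun_scale mulrA rmorphM. Qed.

Fact cfun_scale1 : left_id 1 cfun_scale.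
Proof. by move=> f; apply/funext => x; rewrite /cfun_scale mul1r. Qed.

Fact cfun_scaleDr : right_distributive cfun_scale +%R.
Proof. by move=> a f g; apply/funext => x; rewrite /cfun_scale /= mulrDr. Qed.

Fact cfun_scaleDl f : {morph cfun_scale^~ f : a b / a + b}.
Proof. by move=> a b; apply/funext => x; rewrite /cfun_scale rmorphD mulrDl. Qed.

HB.instance Definition _ := GRing.Zmodule_isLmodule.Build R cfun
  cfun_scaleA cfun_scale1 cfun_scaleDr cfun_scaleDl.

Definition refun (f : fct) : plane -> R := fun x => complex.Re (f x).
Definition imfun (f : fct) : plane -> R := fun x => complex.Im (f x).

Lemma refun_lin (a : R) (f g : cfun) : refun (a *: f + g) = fun x => a * refun f x + refun g x.
Proof.
apply/funext => x; rewrite /refun /GRing.scale/= /GRing.add/=.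
by rewrite /cfun_scale; case: (f x) (g x) => [p q] [p' q'] /=; rewrite mul0r subr0.
Qed.

Lemma imfun_lin (a : R) (f g : cfun) : imfun (a *: f + g) = fun x => a * imfun f x + imfun g x.
Proof.
apply/funext => x; rewrite /imfun /GRing.scale/= /GRing.add/=.
by rewrite /cfun_scale; case: (f x) (g x) => [p q] [p' q'] /=; rewrite mul0r addr0.
Qed.

Lemma normc2 (z : R[i]) : Normc.normc z ^+ 2 = complex.Re z ^+ 2 + complex.Im z ^+ 2.
Proof. by case: z => a b /=; rewrite sqr_sqrtr// addr_ge0 ?sqr_ge0. Qed.

Lemma integral_hausdorff1_cmeas D (A : set plane) (f : plane -> \bar R) : A `<=` circle D ->
  (\int[hausdorff1]_(x in A) f x = \int[cmeas D]_(x in A) f x)%E.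
Proof. exact: (@integral_hausdorff1 R D _ unit10). Qed.

Lemma L2P D (f : fct) : L2 (circle D) f <-> l2c D (refun f) /\ l2c D (imfun f).
Proof.
have mC := measurable_circle D.
have m2 (g : plane -> R) : measurable_fun (circle D) g -> measurable_fun (circle D) (fun x => (g x ^+ 2)%:E).
  by move=> mg; apply/measurable_EFinP/measurable_funX.
have E : measurable_fun (circle D) (refun f) -> measurable_fun (circle D) (imfun f) ->
    (\int[hausdorff1]_(x in circle D) (Normc.normc (f x) ^+ 2)%:E =
     \int[cmeas D]_(x in circle D) (refun f x ^+ 2)%:E +
     \int[cmeas D]_(x in circle D) (imfun f x ^+ 2)%:E)%E.
  move=> mr mi; rewrite (@integral_hausdorff1_cmeas D)// -ge0_integralD//.
  - by apply: eq_integral => x _; rewrite normc2.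
  - by move=> x _; rewrite lee_fin sqr_ge0.
  - exact: m2.
  - by move=> x _; rewrite lee_fin sqr_ge0.
  - exact: m2.
have ge (g : plane -> R) : (0 <= \int[cmeas D]_(x in circle D) (g x ^+ 2)%:E)%E.
  by apply: integral_ge0 => x _; rewrite lee_fin sqr_ge0.
split=> [[mr mi]|[[mr fr] [mi fi]]].
  rewrite (E mr mi) => h; split; split=> //.
    by apply: le_lt_trans h; rewrite leeDl.
  by apply: le_lt_trans h; rewrite leeDr.
by split=> //; rewrite (E mr mi) lte_add_pinfty.
Qed.

Lemma transferE D D' (g : fct) : L2 (circle D) g ->
  transfer D D' g = fun x => rtrans D D' (refun g) x +i* rtrans D D' (imfun g) x.
Proof.
move=> /L2P[ri ii]; apply/funext => x; have mC := measurable_circle D.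
have T (k : plane -> R) : l2c D k -> int_arc D' D x ->
    rtrans D D' k x = (2 * pi)^-1 *
      fine (\int[hausdorff1]_(y in circle D) (poisson_kernel D x y * k y)%:E)%E.
  move=> ki xI; rewrite (@integral_hausdorff1_cmeas D)// /rtrans.
  have /(sqint_mul mC)/(_ ki) I := tker_l2c D D' x.
  have I2 : (cmeas D).-integrable (circle D) (EFin \o (fun y => poisson_kernel D x y * k y)).
    have := integrableZl mC (2 * pi) I; apply: eq_integrable => // y _ /=.
    rewrite tker_in// /pker -!EFinM; congr EFin.
    by have := gt_eqF (@pi_gt0 R); move: (pi : R) => P Pn; field; rewrite Pn.
  rewrite -(RintegralZl _ mC I2); apply: eq_Rintegral => y _.
  by rewrite tker_in// /pker mulrA.
have T0 (k : plane -> R) : ~ int_arc D' D x -> rtrans D D' k x = 0.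
  move=> xI; rewrite /rtrans (eq_Rintegral _ (g := fun=> 0)) ?Rintegral0//.
    by rewrite Rintegral_cst// mul0r.
  by move=> y _; rewrite tker_out// mul0r.
rewrite /transfer; case: ifPn => [/set_mem xI|/negP xI]; last first.
  have {}xI : ~ int_arc D' D x by move=> h; apply: xI; exact: mem_set.
  by rewrite !T0.
rewrite !T// /poisson /cint.
have ER y : complex.Re ((poisson_kernel D x y)%:C * g y) = poisson_kernel D x y * refun g y.
  by rewrite /refun; case: (g y) => a b /=; rewrite mul0r subr0.
have EI y : complex.Im ((poisson_kernel D x y)%:C * g y) = poisson_kernel D x y * imfun g y.
  by rewrite /imfun; case: (g y) => a b /=; rewrite mul0r addr0.
under [fun y => (complex.Re _)%:E]eq_fun do rewrite ER.
under [fun y => (complex.Im _)%:E]eq_fun do rewrite EI.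
by apply/eqP; rewrite eq_complex /= !mul0r subr0 addr0 !eqxx.
Qed.

End ComplexFunctions.

Section Pairs.
Context {R : realType}.
Local Notation plane := (R * R)%type.
Local Notation fct := (plane -> R[i]).
Variables D1 D2 : disk R.
Local Notation V := (@cfun R * @cfun R)%type.
Local Notation ip D := (ip2 (cmeas D) (circle D)).

Definition re_ip D (f g : fct) : R := ip D (refun f) (refun g) + ip D (imfun f) (imfun g).

Definition L2_pairs : set V := HH D1 D2.

Definition pair_form (u v : V) : R := re_ip D1 u.1 v.1 + re_ip D2 u.2 v.2.

Lemma L2_lin D (a : R) (f g : cfun) : L2 (circle D) f -> L2 (circle D) g ->
  L2 (circle D) (a *: f + g).
Proof.
move=> /L2P[fr fi] /L2P[gr gi]; have mC := measurable_circle D; apply/L2P.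
by rewrite refun_lin imfun_lin; split; exact: sqint_lin.
Qed.

Lemma re_ip_lin D (a : R) (f g k : cfun) : L2 (circle D) f -> L2 (circle D) g ->
  L2 (circle D) k -> re_ip D (a *: f + g) k = a * re_ip D f k + re_ip D g k.
Proof.
move=> /L2P[fr fi] /L2P[gr gi] /L2P[kr ki]; have mC := measurable_circle D.
by rewrite /re_ip refun_lin imfun_lin !ip2_lin//; ring.
Qed.

Lemma re_ipC D f g : re_ip D f g = re_ip D g f.
Proof. by rewrite /re_ip ip2C [in X in _ + X]ip2C. Qed.

Lemma re_ip_ge0 D f : 0 <= re_ip D f f.
Proof. by rewrite addr_ge0 ?ip2_ge0. Qed.

Lemma semi_inner_pairs : semi_inner L2_pairs pair_form.
Proof.
split.
- split; apply/L2P; split; exact: l2c_cst.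
- move=> a u v [u1 u2] [v1 v2]; split; exact: L2_lin.
- by move=> u v; rewrite /pair_form re_ipC [in X in _ + X]re_ipC.
- move=> a u v w [u1 u2] [v1 v2] [w1 w2]; rewrite /pair_form /=.
  by rewrite (re_ip_lin a u1 v1 w1) (re_ip_lin a u2 v2 w2) addrACA -mulrDr.
- by move=> u; rewrite addr_ge0 ?re_ip_ge0.
Qed.

Variables (h1 h2 : plane -> R) (l : R).
Hypothesis sd : schur_data D1 D2 h1 h2 l.
Let sd' := schur_dataC sd.

Definition ddcosmo_op (u : V) : V := ddcosmo D1 D2 u.

Lemma refun_transfer D D' (g : fct) : L2 (circle D) g ->
  refun (transfer D D' g) = rtrans D D' (refun g).
Proof. by move=> gi; rewrite transferE. Qed.

Lemma imfun_transfer D D' (g : fct) : L2 (circle D) g ->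
  imfun (transfer D D' g) = rtrans D D' (imfun g).
Proof. by move=> gi; rewrite transferE. Qed.

Lemma transfer_lin D D' (a : R) (f g : cfun) : L2 (circle D) f -> L2 (circle D) g ->
  transfer D D' (a *: f + g) = a *: (transfer D D' f : cfun) + (transfer D D' g : cfun).
Proof.
move=> fi gi; have si := L2_lin a fi gi; rewrite !transferE//.
move/L2P: fi => [fr fi]; move/L2P: gi => [gr gi].
apply/funext => x; apply/eqP; rewrite eq_complex /= refun_lin imfun_lin !rtrans_lin//.
by rewrite mul0r subr0 mul0r addr0 !eqxx.
Qed.

Lemma L2_transfer g : L2 (circle D2) g -> L2 (circle D1) (transfer D2 D1 g).
Proof.
move=> gi; apply/L2P; rewrite refun_transfer// imfun_transfer//.
by move/L2P: gi => [gr gi]; split; [have [] := rtrans_bound sd gr|have [] := rtrans_bound sd gi].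
Qed.

Lemma re_ip_transfer g : L2 (circle D2) g ->
  re_ip D1 (transfer D2 D1 g) (transfer D2 D1 g) <= l / (1 - l) * re_ip D2 g g.
Proof.
move=> gi; rewrite /re_ip refun_transfer// imfun_transfer// mulrDr.
move/L2P: gi => [gr gi].
by apply: lerD; [have [] := rtrans_bound sd gr|have [] := rtrans_bound sd gi].
Qed.

End Pairs.

Section Operator.
Context {R : realType}.

Let le_sum4 (a b c d k : R) : 0 <= a -> 0 <= b -> 0 <= c -> 0 <= d ->
  a + b + (c + d) <= k -> [/\ a <= k, b <= k, c <= k & d <= k].
Proof. by move=> *; split; lra. Qed.

Let gap_ineq (k a b c d : R) : c + d <= k * (a + b) -> (1 - k) * (a + b) <= a - c + (b - d).
Proof. by lra. Qed.

Let bound_ineq (k a b c d : R) : c <= k * b -> d <= k * a ->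
  2 * a + 2 * c + (2 * b + 2 * d) <= (2 + 2 * k) * (a + b).
Proof. by lra. Qed.

Local Notation plane := (R * R)%type.
Local Notation fct := (plane -> R[i]).
Variables D1 D2 : disk R.
Local Notation V := (@cfun R * @cfun R)%type.
Local Notation ip D := (ip2 (cmeas D) (circle D)).
Local Notation H := (L2_pairs D1 D2).
Local Notation B := (pair_form D1 D2).
Let si := semi_inner_pairs D1 D2.

Lemma re_ipB (D : disk R) (f g k : @cfun R) : L2 (circle D) f -> L2 (circle D) g ->
  L2 (circle D) k -> re_ip D (f - g) k = re_ip D f k - re_ip D g k.
Proof.
move=> fi gi ki; rewrite addrC -scaleN1r re_ip_lin// mulN1r addrC//.
Qed.

Lemma L2B (D : disk R) (f g : @cfun R) : L2 (circle D) f -> L2 (circle D) g -> L2 (circle D) (f - g).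
Proof. by move=> fi gi; rewrite addrC -scaleN1r; exact: L2_lin. Qed.

Lemma re_ip_leB (D : disk R) (f g : @cfun R) : L2 (circle D) f -> L2 (circle D) g ->
  re_ip D (f - g) (f - g) <= 2 * re_ip D f f + 2 * re_ip D g g.
Proof.
move=> fi gi; have fg := L2B fi gi.
have s : L2 (circle D) (f + g) by rewrite -[f]scale1r; exact: L2_lin.
have := re_ip_ge0 D (f + g).
have D' k : L2 (circle D) k -> re_ip D (f + g) k = re_ip D f k + re_ip D g k.
  by move=> ki; rewrite -[f in LHS]scale1r re_ip_lin// mul1r.
rewrite D'// !(re_ipC D _ (f + g)) !D'// re_ipB// !(re_ipC D _ (f - g)) !re_ipB//.
rewrite (re_ipC D f g); lra.
Qed.

Variables (h1 h2 : plane -> R) (l : R).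
Hypothesis sd : schur_data D1 D2 h1 h2 l.
Let sd' := schur_dataC sd.
Let l01 : 0 < l < 1. Proof. by case: sd. Qed.

Lemma coercive_ddcosmo : coercive_op H B (@ddcosmo_op R D1 D2) (1 - l) (2 + 2 * (l / (1 - l))).
Proof.
have /andP[l0 l1] := l01.
have c0 : 0 < l / (1 - l) by rewrite divr_gt0// subr_gt0.
have T u : H u -> L2 (circle D1) (transfer D2 D1 u.2) /\ L2 (circle D2) (transfer D1 D2 u.1).
  by move=> [u1 u2]; split; [exact: (L2_transfer sd) | exact: (L2_transfer sd')].
have AE u : ddcosmo_op D1 D2 u = ((u.1 : cfun) - (transfer D2 D1 u.2 : cfun),
                           (u.2 : cfun) - (transfer D1 D2 u.1 : cfun)) by [].
split.
- move=> u hu; have [t1 t2] := T u hu; case: hu => u1 u2.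
  rewrite AE; exact: (conj (L2B u1 t1) (L2B u2 t2)).
- move=> a u v [u1 u2] [v1 v2]; rewrite !AE /=.
  rewrite !transfer_lin//; congr pair; rewrite /= scalerBr opprD addrACA//.
- by rewrite subr_gt0.
- move=> u hu; have [t1 t2] := T u hu; case: (hu) => u1 u2.
  rewrite AE /pair_form /= !re_ipB//.
  have [u1r u1i] := (L2P _ _).1 u1; have [u2r u2i] := (L2P _ _).1 u2.
  have Fr := ip_rtrans_form sd u1r u2r; have Fi := ip_rtrans_form sd u1i u2i.
  have X : re_ip D1 (transfer D2 D1 u.2) u.1 + re_ip D2 (transfer D1 D2 u.1) u.2 <=
      l * (re_ip D1 u.1 u.1 + re_ip D2 u.2 u.2).
    rewrite /re_ip !refun_transfer// !imfun_transfer// addrACA.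
    by apply: (le_trans (lerD Fr Fi)); rewrite -mulrDr [in leRHS]addrACA.
  exact: gap_ineq X.
- move=> u hu; have [t1 t2] := T u hu; case: (hu) => u1 u2.
  rewrite AE /pair_form /=.
  have L1 := re_ip_leB u1 t1; have L2' := re_ip_leB u2 t2.
  have R1 := re_ip_transfer sd u2; have R2 := re_ip_transfer sd' u1.
  have g1 := re_ip_ge0 D1 u.1; have g2 := re_ip_ge0 D2 u.2.
  by apply: (le_trans (lerD L1 L2')); exact: bound_ineq R1 R2.
Qed.

Lemma complete_pairs (u : nat -> V) (K q : R) : 0 <= K -> 0 <= q < 1 ->
  (forall n, H (u n)) ->
  (forall n, B (u n.+1 - u n) (u n.+1 - u n) <= K * q ^+ n) ->
  exists f (K' t : R), [/\ H f, 0 < t < 1 &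
    forall n, B (f - u n) (f - u n) <= K' * t ^+ n].
Proof.
move=> K0 q01 hu uK.
have reB (f g : @cfun R) : refun (f - g) = fun x => refun f x - refun g x.
  rewrite addrC -scaleN1r refun_lin; apply/funext => x; ring.
have imB (f g : @cfun R) : imfun (f - g) = fun x => imfun f x - imfun g x.
  rewrite addrC -scaleN1r imfun_lin; apply/funext => x; ring.
have comp (D : disk R) (w : nat -> plane -> R) : (forall n, l2c D (w n)) ->
    (forall n, ip D (fun x => w n.+1 x - w n x) (fun x => w n.+1 x - w n x) <= K * q ^+ n) ->
    exists (f : plane -> R) (K' t : R), [/\ l2c D f, 0 < t < 1 &
      forall n, ip D (fun x => f x - w n x) (fun x => f x - w n x) <= K' * t ^+ n].
  move=> wi wK; have mC := measurable_circle D.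
  apply: (sqint_complete mC K0 q01 wi) => n.
  have di : l2c D (fun x => w n.+1 x - w n x).
    have := sqint_lin mC (-1) (wi n) (wi n.+1).
    rewrite (_ : (fun x => -1 * w n x + w n.+1 x) = (fun x => w n.+1 x - w n x))//.
    by apply/funext => x; rewrite mulN1r addrC.
  by rewrite -(ip2E mC di) lee_fin.
have up n : [/\ ip D1 (fun x => refun (u n.+1).1 x - refun (u n).1 x) (fun x => refun (u n.+1).1 x - refun (u n).1 x) <= K * q ^+ n,
    ip D1 (fun x => imfun (u n.+1).1 x - imfun (u n).1 x) (fun x => imfun (u n.+1).1 x - imfun (u n).1 x) <= K * q ^+ n,
    ip D2 (fun x => refun (u n.+1).2 x - refun (u n).2 x) (fun x => refun (u n.+1).2 x - refun (u n).2 x) <= K * q ^+ n &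
    ip D2 (fun x => imfun (u n.+1).2 x - imfun (u n).2 x) (fun x => imfun (u n.+1).2 x - imfun (u n).2 x) <= K * q ^+ n].
  have := uK n; rewrite /pair_form /re_ip /= !reB !imB => h.
  by apply: le_sum4 h; exact: ip2_ge0.
have lr1 n : l2c D1 (refun (u n).1) by have [/L2P[]] := hu n.
have li1 n : l2c D1 (imfun (u n).1) by have [/L2P[]] := hu n.
have lr2 n : l2c D2 (refun (u n).2) by have [_ /L2P[]] := hu n.
have li2 n : l2c D2 (imfun (u n).2) by have [_ /L2P[]] := hu n.
have [|f1 [K1 [t1 [f1i /andP[t10 t11] H1]]]] := comp D1 _ lr1; first by move=> n; case: (up n).
have [|f2 [K2 [t2 [f2i /andP[t20 t21] H2]]]] := comp D1 _ li1; first by move=> n; case: (up n).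
have [|f3 [K3 [t3 [f3i /andP[t30 t31] H3]]]] := comp D2 _ lr2; first by move=> n; case: (up n).
have [|f4 [K4 [t4 [f4i /andP[t40 t41] H4]]]] := comp D2 _ li2; first by move=> n; case: (up n).
pose t := Num.max (Num.max t1 t2) (Num.max t3 t4).
have le t' K' : 0 < t' -> t' <= t -> forall n, K' * t' ^+ n <= `|K'| * t ^+ n.
  move=> t'0 t't n; apply: (@le_trans _ _ (`|K'| * t' ^+ n)).
    by rewrite ler_wpM2r ?ler_norm// exprn_ge0// ltW.
  by rewrite ler_wpM2l// lerXn2r ?nnegrE ?(ltW t'0)// (le_trans (ltW t'0)).
have [l1 l2 l3 l4] : [/\ t1 <= t, t2 <= t, t3 <= t & t4 <= t].
  by split; rewrite /t !le_max lexx ?orbT.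
exists ((fun x => f1 x +i* f2 x) : cfun, (fun x => f3 x +i* f4 x) : cfun).
exists (`|K1| + `|K2| + `|K3| + `|K4|), t; split.
- have i1 : L2 (circle D1) (fun x => f1 x +i* f2 x) by apply/L2P; exact: (conj f1i f2i).
  have i2 : L2 (circle D2) (fun x => f3 x +i* f4 x) by apply/L2P; exact: (conj f3i f4i).
  exact: (conj i1 i2).
- by rewrite (lt_le_trans t10 l1) /t !gt_max t11 t21 t31 t41.
move=> n; rewrite /pair_form /re_ip /= !reB !imB.
have m1 := le_trans (H1 n) (le _ K1 t10 l1 n); have m2 := le_trans (H2 n) (le _ K2 t20 l2 n).
have m3 := le_trans (H3 n) (le _ K3 t30 l3 n); have m4 := le_trans (H4 n) (le _ K4 t40 l4 n).
apply: (le_trans (lerD (lerD m1 m2) (lerD m3 m4))).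
by rewrite -!mulrDl addrA.
Qed.

End Operator.

Section Classes.
Context {R : realType}.
Local Notation plane := (R * R)%type.
Local Notation fct := (plane -> R[i]).
Local Notation ip D := (ip2 (cmeas D) (circle D)).

Lemma L2eqP (D : disk R) (f g : @cfun R) : L2 (circle D) f -> L2 (circle D) g ->
  L2eq (circle D) f g <-> re_ip D (f - g) (f - g) = 0.
Proof.
move=> fi gi; have mC := measurable_circle D.
have /L2P[dr di] := L2B fi gi.
have E : L2eq (circle D) f g <-> {ae cmeas D, forall x, circle D x -> f x = g x}.
  exact: (@ae_hausdorff1 R D _ unit10).
have E0 : re_ip D (f - g) (f - g) = 0 <->
    ip D (refun (f - g)) (refun (f - g)) = 0 /\ ip D (imfun (f - g)) (imfun (f - g)) = 0.
  split=> [/eqP|[]]; last by rewrite /re_ip => -> ->; rewrite addr0.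
  by rewrite /re_ip paddr_eq0 ?ip2_ge0// => /andP[/eqP ? /eqP ?].
rewrite E E0 (ip2_eq0 mC dr) (ip2_eq0 mC di); split.
  by move=> h; split; apply: filterS h => x h xC; rewrite /refun /imfun /GRing.add/= h// subrr.
move=> [hr hi]; apply: filterS2 hr hi => x hr hi xC.
have := hr xC; have := hi xC; rewrite /refun /imfun /GRing.add/= /GRing.opp/=.
case: (f x) (g x) => [a b] [a' b'] /= /eqP; rewrite subr_eq0 => /eqP -> /eqP.
by rewrite subr_eq0 => /eqP ->.
Qed.

Definition cmul (c : R[i]) (f : @cfun R) : @cfun R := fun x => c * f x.

Lemma refun_muli (f : @cfun R) : refun (cmul 'i f) = fun x => -1 * imfun f x + 0.
Proof.
by apply/funext => x; rewrite /refun /imfun /cmul; case: (f x) => a b /=; ring.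
Qed.

Lemma imfun_muli (f : @cfun R) : imfun (cmul 'i f) = refun f.
Proof.
by apply/funext => x; rewrite /refun /imfun /cmul; case: (f x) => a b /=; ring.
Qed.

Lemma L2_muli (D : disk R) (f : @cfun R) : L2 (circle D) f -> L2 (circle D) (cmul 'i f).
Proof.
move=> /L2P[fr fi]; apply/L2P; rewrite refun_muli imfun_muli; split=> //.
exact: (sqint_lin (measurable_circle D) (-1) fi (l2c_cst D 0)).
Qed.

Lemma L2ipE (D : disk R) (f g : @cfun R) : L2 (circle D) f -> L2 (circle D) g ->
  L2ip (circle D) f g = re_ip D f g +i* re_ip D f (cmul 'i g).
Proof.
move=> fi gi; have mC := measurable_circle D.
have /L2P[fr fm] := fi; have /L2P[gr gm] := gi; have /L2P[gr' gm'] := L2_muli gi.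
rewrite /L2ip /cint !(@integral_hausdorff1_cmeas R D)//.
have K (p q p' q' : plane -> R) : l2c D p -> l2c D q -> l2c D p' -> l2c D q' ->
   fine (\int[cmeas D]_(x in circle D) (p x * q x + p' x * q' x)%:E) = ip D p q + ip D p' q'.
  by move=> *; rewrite /ip2 -RintegralD//; exact: sqint_mul.
congr (_ +i* _); rewrite /re_ip -K//; congr fine; apply: eq_integral => x _; congr EFin.
  by rewrite /refun /imfun; case: (f x) (g x) => a b [a' b'] /=; ring.
by rewrite /refun /imfun /cmul; case: (f x) (g x) => a b [a' b'] /=; ring.
Qed.

End Classes.

Section PairClasses.
Context {R : realType}.
Local Notation plane := (R * R)%type.
Variables D1 D2 : disk R.
Local Notation V := (@cfun R * @cfun R)%type.
Local Notation H := (L2_pairs D1 D2).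
Local Notation B := (pair_form D1 D2).
Let si := semi_inner_pairs D1 D2.

Lemma HHeqP (u v : V) : H u -> H v -> HHeq D1 D2 u v <-> B (u - v) (u - v) = 0.
Proof.
move=> [u1 u2] [v1 v2]; rewrite /HHeq L2eqP// L2eqP// /pair_form /=; split.
  by move=> [-> ->]; rewrite addr0.
by move=> /eqP; rewrite paddr_eq0 ?re_ip_ge0// => /andP[/eqP ? /eqP ?].
Qed.

Definition pmul (c : R[i]) (u : V) : V := (cmul c u.1, cmul c u.2).

Lemma H_muli u : H u -> H (pmul 'i u).
Proof. by move=> [u1 u2]; split; exact: L2_muli. Qed.

Lemma HHipE (u v : V) : H u -> H v -> HHip D1 D2 u v = B u v +i* B u (pmul 'i v).
Proof.
move=> [u1 u2] [v1 v2]; rewrite /HHip !L2ipE// /pair_form /=.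
Qed.

Lemma pair_form_muli (u : V) : H u -> B (pmul 'i u) (pmul 'i u) = B u u.
Proof.
move=> [/L2P[a b] /L2P[c d]].
rewrite /pair_form /re_ip /= !imfun_muli.
have K (D : disk R) (f : @cfun R) : l2c D (imfun f) -> ip2 (cmeas D) (circle D) (refun (cmul 'i f)) (refun (cmul 'i f)) =
    ip2 (cmeas D) (circle D) (imfun f) (imfun f).
  by move=> _; apply: eq_Rintegral => x _; rewrite refun_muli addr0 mulN1r mulrNN.
by rewrite !K// addrC [in LHS]addrC; congr (_ + _); rewrite addrC.
Qed.

End PairClasses.

Section Harmonics.
Context {R : realType}.
Local Notation plane := (R * R)%type.
Local Notation cfun := (@cfun R).
Implicit Types (D : disk R) (a b : nat -> R[i]) (c : R[i]).

Definition zpow D n : cfun := fun x => toC (x - center D) ^+ n.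
Definition zbar D n : cfun := fun x => conjc (toC (x - center D)) ^+ n.

Definition trigpoly D n a b : cfun :=
  fun x => \sum_(0 <= k < n) (a k * zpow D k x + b k * zbar D k x).

Lemma measurable_cmulX (f : cfun) c n :
  measurable_fun [set: plane] (refun f) -> measurable_fun [set: plane] (imfun f) ->
  measurable_fun [set: plane] (refun (cmul c (fun x => f x ^+ n))) /\
  measurable_fun [set: plane] (imfun (cmul c (fun x => f x ^+ n))).
Proof.
move=> mr mi; elim: n => [|n [ihr ihi]].
  rewrite (_ : cmul c _ = cst c); last by apply/funext => x; rewrite /cmul expr0 mulr1.
  by split; exact: measurable_cst.
split.
- rewrite (_ : refun _ = fun x => refun (cmul c (fun x => f x ^+ n)) x * refun f x -
    imfun (cmul c (fun x => f x ^+ n)) x * imfun f x).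
    by apply: measurable_funB; apply: measurable_funM.
  apply/funext => x; rewrite /refun /imfun /cmul /= exprSr mulrA.
  by case: (c * f x ^+ n) => p q; case: (f x) => p1 q1 /=; ring.
- rewrite (_ : imfun _ = fun x => refun (cmul c (fun x => f x ^+ n)) x * imfun f x +
    imfun (cmul c (fun x => f x ^+ n)) x * refun f x).
    by apply: measurable_funD; apply: measurable_funM.
  apply/funext => x; rewrite /refun /imfun /cmul /= exprSr mulrA.
  by case: (c * f x ^+ n) => p q; case: (f x) => p1 q1 /=; ring.
Qed.

Lemma normcX (z : R[i]) n : Normc.normc (z ^+ n) = Normc.normc z ^+ n.
Proof.
elim: n => [|n ih]; first by rewrite !expr0 Normc.normc1.
by rewrite !exprS Normc.normcM ih.
Qed.

Lemma L2_cmulX D (f : cfun) c n : measurable_fun [set: plane] (refun f) ->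
  measurable_fun [set: plane] (imfun f) ->
  (forall x, circle D x -> Normc.normc (f x) = radius D) ->
  L2 (circle D) (cmul c (fun x => f x ^+ n)).
Proof.
move=> mr mi fr; have [m1 m2] := measurable_cmulX c n mr mi.
split; [exact: measurable_funTS | exact: measurable_funTS | ].
rewrite (@integral_hausdorff1_cmeas R D)//.
have [_ H] := l2c_cst D (Normc.normc c * radius D ^+ n).
rewrite (_ : (\int[_]_(x in _) _ = \int[cmeas D]_(x in circle D) ((cst (Normc.normc c * radius D ^+ n) x) ^+ 2)%:E)%E)//.
apply: eq_integral => x /set_mem xC; congr EFin.
by rewrite /cmul Normc.normcM normcX fr.
Qed.

Lemma L2_zpow D c n : L2 (circle D) (cmul c (zpow D n)).
Proof.
apply: L2_cmulX.
- by apply: measurable_funB.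
- by apply: measurable_funB.
- by move=> x; rewrite circleE /= => <-.
Qed.

Lemma L2_zbar D c n : L2 (circle D) (cmul c (zbar D n)).
Proof.
apply: L2_cmulX.
- by apply: measurable_funB.
- by apply: measurable_funN; apply: measurable_funB.
- by move=> x; rewrite circleE /= => <-; rewrite sqrrN.
Qed.

Lemma trigpolyS D n a b : trigpoly D n.+1 a b =
  trigpoly D n a b + cmul (a n) (zpow D n) + cmul (b n) (zbar D n).
Proof. by apply/funext => x; rewrite /trigpoly big_nat_recr//= addrA. Qed.

Lemma eq_trigpoly D n a b a' b' : (forall k, (k < n)%N -> a k = a' k) ->
  (forall k, (k < n)%N -> b k = b' k) -> trigpoly D n a b = trigpoly D n a' b'.
Proof.
move=> ea eb; apply/funext => x; apply: eq_big_nat => k /andP[_ kn].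
by rewrite ea// eb.
Qed.

Lemma trigpoly_muli D n a b : cmul 'i (trigpoly D n a b) =
  trigpoly D n (fun k => 'i * a k) (fun k => 'i * b k).
Proof.
apply/funext => x; rewrite /cmul /trigpoly mulr_sumr; apply: eq_bigr => k _.
by rewrite mulrDr !mulrA.
Qed.

End Harmonics.

Section HarmonicPairs.
Context {R : realType}.
Local Notation plane := (R * R)%type.
Local Notation cfun := (@cfun R).
Variables D1 D2 : disk R.
Local Notation V := (cfun * cfun)%type.
Local Notation H := (L2_pairs D1 D2).
Local Notation B := (pair_form D1 D2).
Let si := semi_inner_pairs D1 D2.

Definition trig_pairs n : set V := [set u | exists a b a' b' : nat -> R[i],
  u = (trigpoly D1 n a b, trigpoly D2 n a' b')].

Definition galerkin_space (A : V -> V) (W : set V) := subspace H W /\ galerkin H B A W.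

(* one complex dimension is two real ones *)
Lemma galerkin_adjoinC A eps M (W : set V) (e : R[i] -> V) :
  coercive_op H B A eps M -> (forall c, H (e c)) ->
  (forall c, e c = complex.Re c *: e 1 + complex.Im c *: e 'i) ->
  galerkin_space A W -> galerkin_space A [set u | exists w c, W w /\ u = w + e c].
Proof.
move=> co he el [sW gW].
have -> : [set u | exists w c, W w /\ u = w + e c] = adjoin (adjoin W (e 1)) (e 'i).
  apply/seteqP; split=> [u [w [c [ww ->]]]|u [_ [y [[w [x [ww ->]]] ->]]]].
    exists (w + complex.Re c *: e 1), (complex.Im c); split; last by rewrite el addrA.
    by exists w, (complex.Re c).
  by exists w, (x +i* y); split=> //; rewrite (el (x +i* y)) addrA.
have s1 := subspace_adjoin si sW (he 1).
split; first exact: (subspace_adjoin si s1 (he _)).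
by apply: (galerkin_adjoin si co) => //; exact: (galerkin_adjoin si co).
Qed.

Lemma cmul_lin (f : cfun) (c : R[i]) :
  cmul c f = complex.Re c *: cmul 1 f + complex.Im c *: cmul 'i f.
Proof.
apply/funext => x; rewrite /cmul /GRing.add/= /GRing.scale/= /cfun_scale.
by apply/eqP; case: c (f x) => a b [p q]; rewrite eq_complex /=; apply/andP; split; apply/eqP; ring.
Qed.

Definition left_pair (f : cfun) : V := (f, 0).
Definition right_pair (f : cfun) : V := (0, f).

Lemma L2_0 (D : disk R) : L2 (circle D) (0 : cfun).
Proof. by apply/L2P; split; exact: l2c_cst. Qed.

Lemma galerkin_trig_pairs A eps M n : coercive_op H B A eps M ->
  galerkin_space A (trig_pairs n).
Proof.
move=> co; elim: n => [|n ih].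
  rewrite (_ : trig_pairs 0 = [set 0]).
    split; last exact: (galerkin0 si co).
    split; first by move=> _ ->; exact: (dom0 si).
    - by [].
    - by move=> a _ _ -> ->; rewrite scaler0 addr0.
  have E (D : disk R) a b : trigpoly D 0 a b = 0.
    by apply/funext => x; rewrite /trigpoly big_geq.
  apply/seteqP; split=> [_ [a [b [a' [b' ->]]]]|_ ->]; first by rewrite /= !E.
  by exists (fun=> 0), (fun=> 0), (fun=> 0), (fun=> 0); rewrite !E.
have l1 f c : left_pair (cmul c f) = complex.Re c *: left_pair (cmul 1 f) + complex.Im c *: left_pair (cmul 'i f).
  by rewrite /left_pair cmul_lin; congr pair; rewrite /= !scaler0 addr0.
have l2 f c : right_pair (cmul c f) = complex.Re c *: right_pair (cmul 1 f) + complex.Im c *: right_pair (cmul 'i f).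
  by rewrite /right_pair cmul_lin; congr pair; rewrite /= !scaler0 addr0.
have h1 c : H (left_pair (cmul c (zpow D1 n))) by split; [exact: L2_zpow | exact: L2_0].
have h2 c : H (left_pair (cmul c (zbar D1 n))) by split; [exact: L2_zbar | exact: L2_0].
have h3 c : H (right_pair (cmul c (zpow D2 n))) by split; [exact: L2_0 | exact: L2_zpow].
have h4 c : H (right_pair (cmul c (zbar D2 n))) by split; [exact: L2_0 | exact: L2_zbar].
have g1 := galerkin_adjoinC co h1 (l1 _) ih.
have g2 := galerkin_adjoinC co h2 (l1 _) g1.
have g3 := galerkin_adjoinC co h3 (l2 _) g2.
have g4 := galerkin_adjoinC co h4 (l2 _) g3.
move: g4; congr galerkin_space; apply/seteqP; split.
- move=> _ [_ [c4 [[_ [c3 [[_ [c2 [[_ [c1 [[a [b [a' [b' ->]]]] ->]]] ->]]] ->]]] ->]]].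
  pose upd (s : nat -> R[i]) c k := if k == n then c else s k.
  have updn s c : upd s c n = c by rewrite /upd eqxx.
  have updk s c k : (k < n)%N -> s k = upd s c k by rewrite /upd => kn; rewrite ltn_eqF.
  exists (upd a c1), (upd b c2), (upd a' c3), (upd b' c4).
  rewrite !trigpolyS !updn.
  rewrite -(@eq_trigpoly _ D1 n a b _ _ (updk a c1) (updk b c2)).
  rewrite -(@eq_trigpoly _ D2 n a' b' _ _ (updk a' c3) (updk b' c4)).
  by congr pair; rewrite /= ?addr0.
- move=> _ [a [b [a' [b' ->]]]]; rewrite !trigpolyS.
  exists (trigpoly D1 n a b + cmul (a n) (zpow D1 n) + cmul (b n) (zbar D1 n),
          trigpoly D2 n a' b' + cmul (a' n) (zpow D2 n)), (b' n); split; last first.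
    by congr pair; rewrite /= ?addr0.
  exists (trigpoly D1 n a b + cmul (a n) (zpow D1 n) + cmul (b n) (zbar D1 n),
          trigpoly D2 n a' b'), (a' n); split; last by congr pair; rewrite /= ?addr0.
  exists (trigpoly D1 n a b + cmul (a n) (zpow D1 n),
          trigpoly D2 n a' b'), (b n); split; last by congr pair; rewrite /= ?addr0.
  exists (trigpoly D1 n a b, trigpoly D2 n a' b'), (a n).
  by split; [exists a, b, a', b' | congr pair; rewrite /= ?addr0].
Qed.

Lemma HHLP L : HHL D1 D2 L = null_closure H B (trig_pairs L.+1).
Proof.
have co : coercive_op H B id 1 1.
  by split => // u hu; rewrite mul1r.
have [[sub _ _] _] := galerkin_trig_pairs L.+1 co.
apply/seteqP; split=> [u [[u1 [a [b e1]]] [u2 [a' [b' e2]]]]|u [hu [s ss us]]].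
  have hu : H u by split.
  split=> //; exists (trigpoly D1 L.+1 a b, trigpoly D2 L.+1 a' b').
    by exists a, b, a', b'.
  have hs : H (trigpoly D1 L.+1 a b, trigpoly D2 L.+1 a' b') by apply: sub; exists a, b, a', b'.
  exact: (HHeqP hu hs).1 (conj e1 e2).
have [e1 e2] := (HHeqP hu (sub _ ss)).2 us.
move: ss => [a [b [a' [b' sE]]]]; rewrite sE /= in e1 e2.
by case: hu => u1 u2; split; split=> //; [exists a, b | exists a', b'].
Qed.

Lemma null_closure_muli L u : null_closure H B (trig_pairs L) u -> null_closure H B (trig_pairs L) (pmul 'i u).
Proof.
have co : coercive_op H B id 1 1.
  by split => // v hv; rewrite mul1r.
have [[sub _ _] _] := galerkin_trig_pairs L co.
move=> [hu [s ss us]]; have hs := sub _ ss; split; first exact: H_muli.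
exists (pmul 'i s).
  move: ss => [a [b [a' [b' ->]]]].
  exists (fun k => 'i * a k), (fun k => 'i * b k), (fun k => 'i * a' k), (fun k => 'i * b' k).
  by rewrite /pmul /= !trigpoly_muli.
have -> : pmul 'i u - pmul 'i s = pmul 'i (u - s).
  by apply: (f_equal2 pair); apply/funext => x; rewrite /cmul; exact/esym/mulrBr.
by rewrite pair_form_muli//; exact: (domB si).
Qed.

Lemma projLP L (u : V) : H u -> HHL D1 D2 L (projL D1 D2 L u) /\
  forall q, HHL D1 D2 L q -> HHip D1 D2 ((u : V) - (projL D1 D2 L u : V)) q = 0.
Proof.
move=> hu; have co : coercive_op H B id 1 1.
  by split => // v hv; rewrite mul1r.
have [sW gW] := galerkin_trig_pairs L.+1 co.
suff : exists p, HHL D1 D2 L p /\ forall q, HHL D1 D2 L q -> HHip D1 D2 (u - p) q = 0.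
  exact: xgetPex.
have [p wp op] := galerkin_null_closure si co sW gW hu.
exists p; rewrite HHLP; split=> // q wq.
have [hp hq] : H p /\ H q by case: wp; case: wq.
have ort r : null_closure H B (trig_pairs L.+1) r -> B (u - p) r = 0.
  move=> wr; have hr : H r by case: wr.
  by have := op r wr; rewrite /= !(formBl si)//; lra.
rewrite (HHipE (domB si hu hp) hq) (ort _ wq) ort//; exact: null_closure_muli.
Qed.

End HarmonicPairs.

Theorem theorem2p11 (R : realType) (D1 D2 : disk R)
    (hcap : open_disk D1 `&` open_disk D2 !=set0)
    (h12 : ~ (open_disk D1 `<=` open_disk D2))
    (h21 : ~ (open_disk D2 `<=` open_disk D1)) :
  (forall g, HH D1 D2 g ->
     exists u, [/\ HH D1 D2 u,
                   HHeq D1 D2 (ddcosmo D1 D2 u) g &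
                   forall v, HH D1 D2 v ->
                     HHeq D1 D2 (ddcosmo D1 D2 v) g -> HHeq D1 D2 v u]) /\
  (forall (L : nat) g, HH D1 D2 g ->
     exists uL, [/\ HHL D1 D2 L uL,
                    HHeq D1 D2
                      (projL D1 D2 L (ddcosmo D1 D2 (projL D1 D2 L uL)))
                      (projL D1 D2 L g) &
                    forall vL, HHL D1 D2 L vL ->
                      HHeq D1 D2
                        (projL D1 D2 L (ddcosmo D1 D2 (projL D1 D2 L vL)))
                        (projL D1 D2 L g) -> HHeq D1 D2 vL uL]).
Proof.
have [h1 [h2 [l sd]]] := schur_data_exists hcap h12 h21.
have si := semi_inner_pairs D1 D2.
have co := coercive_ddcosmo sd.
have /andP[l0 l1] : 0 < l < 1 by case: sd.
have M0 : 0 < 2 + 2 * (l / (1 - l)) by rewrite addr_gt0// mulr_gt0// divr_gt0// subr_gt0.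
split=> [g hg|L g hg].
  have [u hu ug] := coercive_solve si co M0 (@complete_pairs R D1 D2) hg.
  exists u; split => //; first by apply/HHeqP => //; exact: (op_dom co).
  move=> v hv /(HHeqP (op_dom co hv) hg) vg; apply/HHeqP => //.
  apply: (op_inj si co) => //.
  have [hAu hAv] := (op_dom co hu, op_dom co hv).
  exact: (form_null_sub si hAv hAu hg vg ug).
have HHLE := HHLP D1 D2 L.
have [sW gW] := galerkin_trig_pairs L.+1 co.
have PW u : L2_pairs D1 D2 u -> null_closure (L2_pairs D1 D2) (pair_form D1 D2) (trig_pairs D1 D2 L.+1) (projL D1 D2 L u).
  by move=> hu; rewrite -HHLE; have [] := projLP L hu.
have NH u : null_closure (L2_pairs D1 D2) (pair_form D1 D2) (trig_pairs D1 D2 L.+1) u -> L2_pairs D1 D2 u by case.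
have Port u q : L2_pairs D1 D2 u -> null_closure (L2_pairs D1 D2) (pair_form D1 D2) (trig_pairs D1 D2 L.+1) q ->
    pair_form D1 D2 (u - projL D1 D2 L u) q = 0.
  move=> hu wq; have hq := NH _ wq; have hp := NH _ (PW _ hu).
  have [_ /(_ q)] := projLP L hu; rewrite HHLE => /(_ wq).
  by rewrite (HHipE (domB si hu hp) hq); case.
have [uL wuL [eL uniqL]] := discrete_solve si co sW PW Port gW hg.
have hPA v : null_closure (L2_pairs D1 D2) (pair_form D1 D2) (trig_pairs D1 D2 L.+1) v ->
    L2_pairs D1 D2 (projL D1 D2 L (ddcosmo D1 D2 (projL D1 D2 L v))).
  by move=> wv; exact: (NH _ (PW _ (op_dom co (NH _ (PW _ (NH _ wv)))))).
have hPg : L2_pairs D1 D2 (projL D1 D2 L g) by exact: (NH _ (PW _ hg)).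
exists uL; rewrite HHLE; split => //; first by apply/(HHeqP (hPA _ wuL) hPg).
move=> vL wvL /(HHeqP (hPA _ wvL) hPg) ev.
by apply/HHeqP; [exact: (NH _ wvL) | exact: (NH _ wuL) | exact: uniqL].
Qed.
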